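(* Let $\mu$ be a positive NC measure. Then $\mu$ is the NC Clark measure of a contractive NC rational multiplier $\mathfrak b \in [\mathbb H^\infty_d]_1$ of the Fock space if and only if $\mu$ is a finitely-correlated Cuntz--Toeplitz functional, i.e. if and only if the subspace $\mathcal H_\mu = \bigvee_{\omega\in\mathbb F^d} \Pi_\mu^{*\omega}(1+N_\mu)$ of its GNS space $\mathbb H^2_d(\mu)$ is finite-dimensional.
   Context: Fix $d\in\mathbb N$. $\mathbb F^d$ is the free monoid of words in the letters $1,\dots,d$ with unit the empty word $\emptyset$; for $\omega=i_1\cdots i_m$ and a $d$-tuple $A=(A_1,\dots,A_d)$ of operators, $A^\omega:=A_{i_1}\cdots A_{i_m}$ and $A^{*\omega}:=(A^\omega)^*$. $\bigvee$ denotes closed linear span; inner products are linear in the second variable. Fock space and multipliers: $\mathbb H^2_d$ is the Hilbert space of formal power series $h=\sum_\omega \hat h_\omega \mathfrak z^\omega$ in non-commuting variables $\mathfrak z=(\mathfrak z_1,\dots,\mathfrak z_d)$ with square-summable coefficients and $\ell^2$ inner product. $L_k$ is left multiplication by $\mathfrak z_k$. $\mathbb C^d_n:=\mathbb C^{n\times n}\otimes\mathbb C^{1\times d}$ is the set of row $d$-tuples of $n\times n$ matrices, $\mathbb B^d_n=\{Z\in\mathbb C^d_n: \sum_j Z_jZ_j^*<I_n\}$ and $\mathbb B^d_{\mathbb N}=\bigsqcup_n\mathbb B^d_n$; elements of $\mathbb H^2_d$ define NC functions on $\mathbb B^d_{\mathbb N}$. $\mathbb H^\infty_d$ is the algebra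 of NC functions uniformly bounded on $\mathbb B^d_{\mathbb N}$, identified isometrically with the left multipliers of $\mathbb H^2_d$; $[\mathbb H^\infty_d]_1$ is its closed unit ball. An NC rational function is an equivalence class of valid expressions formed from $\mathfrak z_1,\dots,\mathfrak z_d$, complex scalars, $+,\cdot,{}^{-1}$, two expressions being equivalent if they agree on tuples of matrices of all sizes in the intersection of their domains; $\mathfrak b\in\mathbb H^\infty_d$ is NC rational if it is given on $\mathbb B^d_{\mathbb N}$ by such a function. NC measures: $\mathbb A_d:=\mathrm{Alg}\{I,L_1,\dots,L_d\}^{-\|\cdot\|}$ is the free disk algebra, $\mathscr A_d:=(\mathbb A_d+\mathbb A_d^* )^{-\|\cdot\|}$ the free disk system; a positive NC measure is a positive linear functional on $\mathscr A_d$. Its NC Herglotz--Riesz transform is $H_\mu(Z)=(\mathrm{id}_n\otimes\mu)\big((I+ZL^* )(I-ZL^* )^{-1}\big)$, $Z\in\mathbb B^d_n$, $ZL^*:=\sum_j Z_j\otimes L_j^*$. For $b\in[\mathbb H^\infty_d]_1$, $b\not\equiv1$, the NC Clark measure $\mu_b$ of $b$ is the unique positive NC measure $\mu$ such that $(I_n+b(Z))(I_n-b(Z))^{-1}=H_\mu(Z)+it I_n$ for all $Z\in\mathbb B^d_n$, $n\in\mathbb N$, where $t\in\mathbb R$ is the imaginary part of $\frac{1+b(0)}{1-b(0)}$. GNS construction: $\mathbb H^2_d(\mu)$ is the completion of $\mathbb C\{\mathfrak z\}/N_\mu$ (free polynomials modulo vectors of zero length) for the pre-inner product $\langle p,q\rangle_\mu:=\mu(p(L)^*q(L))$,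 and $\Pi_\mu=(\Pi_{\mu;1},\dots,\Pi_{\mu;d})$ is the GNS row isometry $\Pi_{\mu;k}(p+N_\mu)=\mathfrak z_kp+N_\mu$. *)

(* Defs.v *)
From HB Require Import structures.
From mathcomp Require Import all_boot all_order all_algebra.
From mathcomp Require Import generic_quotient ring_quotient finmap monalg.
From mathcomp Require Import all_classical all_reals all_analysis.
From mathcomp Require Import complex.
From mathcomp Require Import ring lra.

Set Implicit Arguments.
Unset Strict Implicit.
Unset Printing Implicit Defensive.
Import Order.TTheory GRing.Theory Num.Theory.
Import numFieldNormedType.Exports.
Local Open Scope classical_set_scope.
Local Open Scope ring_scope.
Local Open Scope complex_scope.

Section ComplexLimits.
Variable R : realType.
Local Notation C := R[i].

Definition sqabs (z : C) : R := complex.Re z ^+ 2 + complex.Im z ^+ 2.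

Definition climn (u : nat -> C) : C :=
  limn (fun n => complex.Re (u n)) +i* limn (fun n => complex.Im (u n)).

Definition ccvgn (u : nat -> C) : Prop :=
  cvgn (fun n => complex.Re (u n)) /\ cvgn (fun n => complex.Im (u n)).

Lemma climnD u v : ccvgn u -> ccvgn v ->
  climn (fun n => u n + v n) = climn u + climn v.
Proof.
move=> [ru iu] [rv iv]; rewrite /climn.
have -> : (fun n => complex.Re (u n + v n)) =
   (fun n => complex.Re (u n)) \+ (fun n => complex.Re (v n)).
  by apply/funext => n /=; case: (u n) (v n) => [? ?] [? ?].
have -> : (fun n => complex.Im (u n + v n)) =
   (fun n => complex.Im (u n)) \+ (fun n => complex.Im (v n)).
  by apply/funext => n /=; case: (u n) (v n) => [? ?] [? ?].
by rewrite !limD.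
Qed.

Lemma climnZ a u : ccvgn u -> climn (fun n => a * u n) = a * climn u.
Proof.
move=> [ru iu]; rewrite /climn; case: a => a b.
have -> : (fun n => complex.Re ((a +i* b) * u n)) =
   (fun n => a * complex.Re (u n)) \- (fun n => b * complex.Im (u n)).
  by apply/funext => n /=; case: (u n) => [? ?].
have -> : (fun n => complex.Im ((a +i* b) * u n)) =
   (fun n => a * complex.Im (u n)) \+ (fun n => b * complex.Re (u n)).
  by apply/funext => n /=; case: (u n) => [? ?].
have c (x : R) (f : nat -> R) : cvgn f -> cvgn (fun n => x * f n).
  by move=> ?; apply: is_cvgM => //; exact: is_cvg_cst.
have l (x : R) (f : nat -> R) : cvgn f -> limn (fun n => x * f n) = x * limn f.
  by move=> h; apply/cvg_lim => //; apply: cvgM => //; exact: cvg_cst.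
have cr := c a _ ru; have ci := c b _ iu.
have dr := c b _ ru; have di := c a _ iu.
by rewrite limB // limD // !l.
Qed.

Lemma climnC u : ccvgn u -> climn (fun n => (u n)^*) = (climn u)^*.
Proof.
move=> [ru iu]; rewrite /climn /=.
have -> : (fun n => complex.Re ((u n)^*)) = (fun n => complex.Re (u n)).
  by apply/funext => n /=; case: (u n) => [? ?].
have -> : (fun n => complex.Im ((u n)^*)) = \- (fun n => complex.Im (u n)).
  by apply/funext => n /=; case: (u n) => [? ?].
by rewrite limN.
Qed.

Lemma climnS u : climn (fun n => u n.+1) = climn u.
Proof.
have e (f : nat -> R) : limn (fun n => f n.+1) = limn f.
  rewrite /lim; congr get; apply/funext => l.
  exact: (cvg_shiftS f (nbhs l)).
by rewrite /climn (e (fun n => complex.Re (u n))) (e (fun n => complex.Im (u n))).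
Qed.

Lemma sqabs_ge0 z : 0 <= sqabs z.
Proof. by rewrite addr_ge0 // sqr_ge0. Qed.

Lemma sqabsD (x y : C) : sqabs (x + y) <= 2 * sqabs x + 2 * sqabs y.
Proof.
case: x y => [a b] [c e]; rewrite /sqabs /= -subr_ge0.
have -> : 2 * (a ^+ 2 + b ^+ 2) + 2 * (c ^+ 2 + e ^+ 2) -
    ((a + c) ^+ 2 + (b + e) ^+ 2) = (a - c) ^+ 2 + (b - e) ^+ 2 by ring.
by rewrite addr_ge0 // sqr_ge0.
Qed.

Lemma sqabsM (x y : C) : sqabs (x * y) = sqabs x * sqabs y.
Proof. by case: x y => [a b] [c e]; rewrite /sqabs /=; ring. Qed.

End ComplexLimits.

Section Fock.
Variables (R : realType) (d : nat).
Local Notation C := R[i].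
Local Notation word := (seq 'I_d).

Definition sqsummable (h : word -> C^o) : Prop :=
  (\esum_(w in [set: word]) (sqabs (h w))%:E < +oo)%E.

Definition sqsum_pred : {pred (word -> C^o)} := [pred h | `[< sqsummable h >]].

Lemma sqsummableP (h : word -> C^o) : sqsummable h <->
  exists M : R, forall s : seq word, uniq s -> \sum_(w <- s) sqabs (h w) <= M.
Proof.
have g0 w : (0 <= (sqabs (h w))%:E)%E by rewrite lee_fin sqabs_ge0.
split=> [hs|[M hM]].
  exists (fine (\esum_(w in [set: word]) (sqabs (h w))%:E)) => s us.
  rewrite -lee_fin fineK; last by rewrite ge0_fin_numE // esum_ge0.
  apply: esum_ge; exists [set` s].
    by split => //; exact: finite_seq.
  by rewrite -fsbig_seq // sumEFin.
apply: (@le_lt_trans _ _ M%:E); last exact: ltry.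
apply: ge_ereal_sup => _ [A [fA _] <-].
by rewrite fsbig_finite //= sumEFin lee_fin; apply: hM; exact: fset_uniq.
Qed.

Lemma sqsum_closed : submod_closed sqsum_pred.
Proof.
split=> [|a u v].
  rewrite unfold_in; apply: asboolT; apply/sqsummableP; exists 0 => s _.
  by rewrite big1 // => w _; rewrite /sqabs /= !expr0n /= addr0.
rewrite !unfold_in => /asboolW/sqsummableP[M hM] /asboolW/sqsummableP[N hN].
apply: asboolT; apply/(sqsummableP _); exists (2 * (sqabs a * M) + 2 * N) => s us.
apply: (@le_trans _ _ (\sum_(w <- s) (2 * (sqabs a * sqabs (u w)) + 2 * sqabs (v w)))).
  by apply: ler_sum => w _; rewrite -sqabsM; exact: sqabsD.
rewrite big_split /= -!mulr_sumr; apply: lerD.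
  by rewrite ler_pM2l // ler_wpM2l ?sqabs_ge0 ?hM.
by rewrite ler_pM2l // hN.
Qed.

HB.instance Definition _ :=
  GRing.isSubmodClosed.Build C (word -> C^o) sqsum_pred sqsum_closed.

Record fock := Fock { fcoef :> word -> C^o ; _ : fcoef \in sqsum_pred }.
HB.instance Definition _ := [isSub for fcoef].
HB.instance Definition _ := [Choice of fock by <:].
HB.instance Definition _ := [SubChoice_isSubLmodule of fock by <:].

Lemma fcoefP (h : fock) : sqsummable h.
Proof. by case: h => h /= /asboolW. Qed.

Definition mkfock (h : word -> C^o) (hs : sqsummable h) : fock :=
  @Fock h (asboolT hs).

Lemma fockP (h g : fock) : (forall w, h w = g w) -> h = g.
Proof. by move=> e; apply/val_inj/funext. Qed.

Lemma fockD (h g : fock) w : (h + g) w = h w + g w. Proof. by []. Qed.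
Lemma fockZ a (h : fock) w : (a *: h) w = a * h w. Proof. by []. Qed.

(* Sum over the words of length < N. *)
Definition sum_lt (V : nmodType) (f : word -> V) (N : nat) : V :=
  \sum_(m < N) \sum_(w : m.-tuple 'I_d) f w.

(* Linear in the second variable; the limit exists by fdot_cvg. *)
Definition fdot (h g : fock) : C := climn (sum_lt (fun w => (h w)^* * g w)).

Definition fnorm (h : fock) : R := Num.sqrt (complex.Re (fdot h h)).

Definition words_lt (N : nat) : seq word :=
  flatten [seq map val (enum {: m.-tuple 'I_d}) | m <- iota 0 N].

Lemma sum_ltE (V : nmodType) (f : word -> V) N :
  sum_lt f N = \sum_(w <- words_lt N) f w.
Proof.
rewrite /sum_lt /words_lt big_flatten big_map /= -(big_mkord xpredT
  (fun m => \sum_(w : m.-tuple 'I_d) f w)) /index_iota subn0.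
apply: eq_bigr => m _; rewrite big_map /=.
by rewrite [RHS]big_enum.
Qed.

Lemma words_lt_uniq N : uniq (words_lt N).
Proof.
rewrite /words_lt; elim: N => // N IH.
rewrite -addn1 iotaD map_cat flatten_cat cat_uniq IH /= cats0 add0n.
rewrite map_inj_uniq ?enum_uniq ?andbT; last exact: val_inj.
apply/hasPn => _ /mapP[t _ ->] /=; apply/negP => /flatten_mapP[m].
rewrite mem_iota add0n leq0n /= => mN /mapP[t' _ /(congr1 size)].
by rewrite !size_tuple => e; rewrite e ltnn in mN.
Qed.

Lemma real_abscvg (f : word -> R) (M : R) :
  (forall s, uniq s -> \sum_(w <- s) `|f w| <= M) -> cvgn (sum_lt f).
Proof.
move=> hM; pose u m := \sum_(w : m.-tuple 'I_d) f w.
have e g : sum_lt g = series (fun m => \sum_(w : m.-tuple 'I_d) (g w : R)).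
  by apply/funext => N; rewrite /sum_lt /series /= big_mkord.
rewrite e; apply: normed_cvg => /=.
pose v m := \sum_(w : m.-tuple 'I_d) `|f w|.
apply: (@series_le_cvg _ _ v).
- by move=> n /=; exact: normr_ge0.
- by move=> n; apply: sumr_ge0.
- by move=> n; apply: ler_norm_sum.
have ev : series v = sum_lt (fun w => `|f w|) by rewrite e.
rewrite ev; apply: nondecreasing_is_cvgn.
  by rewrite -ev; apply: nondecreasing_series => n _ _; apply: sumr_ge0.
by exists M => _ [n _ <-]; rewrite sum_ltE; apply: hM; exact: words_lt_uniq.
Qed.

Lemma Re_sum (I : Type) (s : seq I) P (f : I -> C) :
  complex.Re (\sum_(i <- s | P i) f i) = \sum_(i <- s | P i) complex.Re (f i).
Proof. by apply: (big_morph (@complex.Re R)) => // [[? ?] [? ?]]. Qed.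

Lemma Im_sum (I : Type) (s : seq I) P (f : I -> C) :
  complex.Im (\sum_(i <- s | P i) f i) = \sum_(i <- s | P i) complex.Im (f i).
Proof. by apply: (big_morph (@complex.Im R)) => // [[? ?] [? ?]]. Qed.

Lemma fdot_cvg (h g : fock) : ccvgn (sum_lt (fun w => (h w)^* * g w)).
Proof.
have /sqsummableP[M hM] := fcoefP h; have /sqsummableP[N hN] := fcoefP g.
have b (f : word -> R) : (forall w, `|f w| <= sqabs (h w) + sqabs (g w)) ->
    forall s, uniq s -> \sum_(w <- s) `|f w| <= M + N.
  move=> hf s us; 
  apply: (@le_trans _ _ (\sum_(w <- s) (sqabs (h w) + sqabs (g w)))).
    by apply: ler_sum => w _; exact: hf.
  by rewrite big_split /=; apply: lerD; [exact: hM|exact: hN].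
split.
  rewrite (_ : (fun n => _) = sum_lt (fun w => complex.Re ((h w)^* * g w))).
    apply/real_abscvg/b => w; case: (h w) (g w) => [a e] [c f] /=.
    have h1 := sqr_ge0 (a - c); have h2 := sqr_ge0 (a + c).
    have h3 := sqr_ge0 (e - f); have h4 := sqr_ge0 (e + f).
    by rewrite /sqabs /= ler_norml; apply/andP; split; nra.
  by apply/funext => n; rewrite /sum_lt Re_sum; apply: eq_bigr => m _; rewrite Re_sum.
rewrite (_ : (fun n => _) = sum_lt (fun w => complex.Im ((h w)^* * g w))).
  apply/real_abscvg/b => w; case: (h w) (g w) => [a e] [c f] /=.
  have h1 := sqr_ge0 (a - f); have h2 := sqr_ge0 (a + f).
  have h3 := sqr_ge0 (e - c); have h4 := sqr_ge0 (e + c).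
  by rewrite /sqabs /= ler_norml; apply/andP; split; nra.
by apply/funext => n; rewrite /sum_lt Im_sum; apply: eq_bigr => m _; rewrite Im_sum.
Qed.

Lemma fdotDr h g k : fdot h (g + k) = fdot h g + fdot h k.
Proof.
rewrite /fdot -climnD; try exact: fdot_cvg.
congr climn; apply/funext => n; rewrite !sum_ltE -big_split /=.
by apply: eq_bigr => w _; rewrite -mulrDr.
Qed.

Lemma fdotZr a h g : fdot h (a *: g) = a * fdot h g.
Proof.
rewrite /fdot -climnZ; last exact: fdot_cvg.
congr climn; apply/funext => n; rewrite !sum_ltE mulr_sumr.
by apply: eq_bigr => w _; rewrite mulrCA.
Qed.

Lemma fdotC h g : fdot h g = (fdot g h)^*.
Proof.
rewrite /fdot -climnC; last exact: fdot_cvg.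
congr climn; apply/funext => n; rewrite !sum_ltE rmorph_sum.
by apply: eq_bigr => w _ /=; case: (h w) (g w) => [a b] [c e] /=; congr (_ +i* _); ring.
Qed.

Lemma fdotDl h g k : fdot (h + g) k = fdot h k + fdot g k.
Proof. by rewrite fdotC fdotDr rmorphD [fdot h k]fdotC [fdot g k]fdotC. Qed.

Lemma fdotZl a h g : fdot (a *: h) g = a^* * fdot h g.
Proof. by rewrite fdotC fdotZr rmorphM [fdot h g]fdotC. Qed.

Lemma fdot_ge0 h : 0 <= fdot h h.
Proof.
have [hr hi] := fdot_cvg h h.
have e w : (h w)^* * h w = (sqabs (h w))%:C.
  by case: (h w) => a b; rewrite /sqabs /=; congr (_ +i* _); ring.
rewrite lecE; apply/andP; split.
  apply/eqP; rewrite /fdot /= (_ : (fun n => _) = cst 0) ?lim_cst //.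
  apply/funext => n; rewrite sum_ltE Im_sum big1 // => w _.
  by rewrite e.
rewrite /fdot /=; apply: limr_ge => //; near=> n.
rewrite sum_ltE Re_sum; apply: sumr_ge0 => w _.
by rewrite e /= sqabs_ge0.
Unshelve. all: by end_near.
Qed.

Lemma fnorm0 : fnorm 0 = 0.
Proof.
have e : fdot 0 0 = 0 by rewrite -[X in fdot _ X](scale0r 0) fdotZr mul0r.
by rewrite /fnorm e sqrtr0.
Qed.

Definition Lop_fun (k : 'I_d) (h : word -> C^o) (w : word) : C^o :=
  if w is j :: v then (if j == k then h v else 0) else 0.

Lemma Lop_sqsum k (h : fock) : sqsummable (Lop_fun k h).
Proof.
have /sqsummableP[M hM] := fcoefP h.
apply/sqsummableP; exists M => s us.
pose t := [seq w <- s | if w is j :: _ then j == k else false].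
have ut : uniq t by exact: filter_uniq.
have z0 : sqabs (0 : C) = 0 by rewrite /sqabs /= !expr0n /= addr0.
have -> : \sum_(w <- s) sqabs (Lop_fun k h w) = \sum_(w <- t) sqabs (h (behead w)).
  rewrite /t big_filter [RHS]big_mkcond /=; apply: eq_bigr => -[|j v] _ //=.
  by case: eqP => // _.
rewrite -(big_map behead xpredT (fun w => sqabs (h w))); apply: hM.
rewrite map_inj_in_uniq // => -[|i u] [|j v]; rewrite !mem_filter //=.
by move=> /andP[/eqP-> _] /andP[/eqP-> _] ->.
Qed.

Definition Lop k (h : fock) : fock := mkfock (Lop_sqsum k h).

Lemma Lop_adj_sqsum (k : 'I_d) (h : fock) : sqsummable (fun w => h (k :: w)).
Proof.
have /sqsummableP[M hM] := fcoefP h.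
apply/sqsummableP; exists M => s us.
rewrite -(big_map (cons k) xpredT (fun w => sqabs (h w))); apply: hM.
by rewrite map_inj_uniq // => u v [].
Qed.

(* The backward shift; it is the adjoint of Lop k by fdot_Lop. *)
Definition Lop_adj k (h : fock) : fock := mkfock (Lop_adj_sqsum k h).

Lemma Lop_adjK j k h : Lop_adj j (Lop k h) = if j == k then h else 0.
Proof. by apply/fockP => w /=; case: eqP. Qed.

Lemma sum_ltS (V : nmodType) (f : word -> V) N :
  sum_lt f N.+1 = f [::] + \sum_(k < d) sum_lt (fun w => f (k :: w)) N.
Proof.
rewrite /sum_lt big_ord_recl exchange_big /=; congr (_ + _).
  rewrite (big_pred1 [tuple]) // => t; apply/esym/eqP; exact: tuple0.
apply: eq_bigr => m _; rewrite pair_big /=.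
rewrite (reindex (fun p : 'I_d * m.-tuple 'I_d => [tuple of p.1 :: p.2])) //=.
exists (fun t : m.+1.-tuple 'I_d => (thead t, [tuple of behead t])).
  by move=> [a t] _ /=; congr (_, _); apply/val_inj.
by move=> t _ /=; rewrite [in RHS](tuple_eta t); apply/val_inj.
Qed.

Lemma fdot_Lop k h g : fdot (Lop k h) g = fdot h (Lop_adj k g).
Proof.
rewrite /fdot -climnS; congr climn; apply/funext => n /=.
have c0 (x : C) : (0 : C)^* * x = 0 by rewrite rmorph0 mul0r.
rewrite sum_ltS.
have -> : (Lop k h [::])^* * g [::] = 0 :> C by exact: c0.
rewrite add0r (bigD1 k) //= big1 ?addr0.
  by rewrite !sum_ltE; apply: eq_bigr => w _; rewrite eqxx.
move=> j /negbTE jk; rewrite sum_ltE big1 // => w _.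
by rewrite jk c0.
Qed.

End Fock.

Section PolyMap.
Variables (R : realType) (K : choiceType) (V : lmodType R[i]).
Variables (s : {rmorphism R[i] -> R[i]}) (F : K -> V).
Local Notation C := R[i].

Definition malg_map (p : {malg C[K]}) : V := \sum_(w <- msupp p) s p@_w *: F w.

Lemma malg_mapEw (D : {fset K}) p : (msupp p `<=` D)%fset ->
  malg_map p = \sum_(w <- D) s p@_w *: F w.
Proof.
move=> sD; rewrite /malg_map; apply: big_fset_incl => // w _ /mcoeff_outdom ->.
by rewrite rmorph0 scale0r.
Qed.

Lemma malg_mapD p q : malg_map (p + q) = malg_map p + malg_map q.
Proof.
have sp : (msupp p `<=` msupp p `|` msupp q)%fset by exact: fsubsetUl.
have sq : (msupp q `<=` msupp p `|` msupp q)%fset by exact: fsubsetUr.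
rewrite (malg_mapEw (msuppD_le p q)) (malg_mapEw sp) (malg_mapEw sq) -big_split /=.
by apply: eq_bigr => w _; rewrite mcoeffD rmorphD scalerDl.
Qed.

Lemma malg_mapZ a p : malg_map (a *: p) = s a *: malg_map p.
Proof.
rewrite (malg_mapEw (msuppZ_le a p)) scaler_sumr.
by apply: eq_bigr => w _; rewrite mcoeffZ rmorphM scalerA.
Qed.

Lemma malg_map0 : malg_map 0 = 0.
Proof. by rewrite /malg_map msupp0 big_seq_fset0. Qed.

Lemma malg_mapU c w : malg_map << c *g w >> = s c *: F w.
Proof. by rewrite (malg_mapEw msuppU_le) big_seq_fset1 mcoeffUU. Qed.

End PolyMap.

Section DiskSystem.
Variables (R : realType) (d : nat).
Local Notation C := R[i].
Local Notation word := (seq 'I_d).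
Local Notation fock := (fock R d).
Local Notation op := (fock -> fock).
Local Notation fpoly := {malg C[{fmonom 'I_d}]}.

Definition Lword (w : word) : op := foldr (fun k T => @Lop R d k \o T) id w.
Definition Lword_adj (w : word) : op := foldr (fun k T => T \o @Lop_adj R d k) id w.

Definition evalL (p : fpoly) : op := \sum_(w <- msupp p) p@_w *: Lword w.
Definition evalL_adj (p : fpoly) : op := \sum_(w <- msupp p) (p@_w)^* *: Lword_adj w.

(* S^* = T *)
Definition is_adjoint (S T : op) : Prop :=
  forall h g, fdot (S h) g = fdot h (T g).

(* Operator-norm closure. When the members of E are bounded linear operators,
   so are those of its closure: no separate requirement on T is needed. *)
Definition opclosure (E : set op) : set op :=
  [set T | forall e : R, 0 < e ->
     exists2 S, E S & forall h, fnorm (T h - S h) <= e * fnorm h].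

(* The operators p(L) are exactly the elements of Alg{I, L_1 .. L_d}. *)
Definition disk_algebra : set op := opclosure (range evalL).

Definition disk_system : set op :=
  opclosure [set S | exists S1 S2 T2, [/\ disk_algebra S1, disk_algebra S2,
                       is_adjoint S2 T2 & S = S1 + T2]].

(* Positive NC measures. Only the values on the free disk system matter:
   nothing is required of, nor derived from, the other values. *)
Record ncMeasure := NCMeasure {
  ncm :> op -> C;
  ncm_lin : forall a S T, disk_system S -> disk_system T ->
    ncm (a *: S + T) = a * ncm S + ncm T;
  ncm_ge0 : forall T, disk_system T -> (forall h, 0 <= fdot h (T h)) ->
    0 <= ncm T }.

Implicit Types (k : 'I_d) (h g : fock) (a : C) (p q : fpoly) (S T : op) (v w : word).

Lemma Lop_adj_lin k a h g : Lop_adj k (a *: h + g) = a *: Lop_adj k h + Lop_adj k g.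
Proof. by apply/fockP. Qed.

Lemma Lop_lin k a h g : Lop k (a *: h + g) = a *: Lop k h + Lop k g.
Proof.
apply/fockP => -[|j v].
  by transitivity (a * 0 + 0 : C) => //; rewrite mulr0 addr0.
transitivity (a * (if j == k then h v else 0) + (if j == k then g v else 0) : C) => //.
by rewrite /=; case: (j == k) => //; rewrite mulr0 addr0.
Qed.

Lemma Lword_adj_lin w a h g : Lword_adj w (a *: h + g) = a *: Lword_adj w h + Lword_adj w g.
Proof. by elim: w h g => //= k w IH h g; rewrite Lop_adj_lin IH. Qed.

Lemma Lop0 k : Lop k (0 : fock) = 0.
Proof. by have := Lop_lin k (-1) 0 0; rewrite scaler0 addr0 scaleN1r addNr. Qed.

Lemma Lword_adj0 w : Lword_adj w 0 = 0.
Proof. by have := Lword_adj_lin w (-1) 0 0; rewrite scaler0 addr0 scaleN1r addNr. Qed.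

Lemma evalLE p : evalL p = malg_map idfun (Lword : {fmonom 'I_d} -> op) p.
Proof. by []. Qed.

Lemma evalL_adjE p : evalL_adj p = malg_map (@Num.conj C) (Lword_adj : {fmonom 'I_d} -> op) p.
Proof. by []. Qed.

Lemma evalL_D p q : evalL (p + q) = evalL p + evalL q.
Proof. by rewrite !evalLE malg_mapD. Qed.

Lemma evalL_Z a p : evalL (a *: p) = a *: evalL p.
Proof. by rewrite !evalLE malg_mapZ. Qed.

Lemma evalL_adjD p q : evalL_adj (p + q) = evalL_adj p + evalL_adj q.
Proof. by rewrite !evalL_adjE malg_mapD. Qed.

Lemma evalL_adjZ a p : evalL_adj (a *: p) = a^* *: evalL_adj p.
Proof. by rewrite !evalL_adjE malg_mapZ. Qed.

Lemma opD (S T : op) h : (S + T) h = S h + T h. Proof. by []. Qed.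
Lemma opZ a (S : op) h : (a *: S) h = a *: S h. Proof. by []. Qed.

Lemma evalL_adj_lin p a h g : evalL_adj p (a *: h + g) = a *: evalL_adj p h + evalL_adj p g.
Proof.
rewrite /evalL_adj !fct_sumE scaler_sumr -big_split /=; apply: eq_bigr => w _.
by rewrite !opZ Lword_adj_lin scalerDr !scalerA mulrC.
Qed.

Lemma fdot0l g : fdot (0 : fock) g = 0.
Proof. by rewrite -(scale0r (0 : fock)) fdotZl rmorph0 mul0r. Qed.

Lemma fdot0r h : fdot h (0 : fock) = 0.
Proof. by rewrite -(scale0r (0 : fock)) fdotZr mul0r. Qed.

Lemma Lword_adjP w : is_adjoint (Lword w) (Lword_adj w).
Proof. by elim: w => [|k w IH] h g //=; rewrite fdot_Lop IH. Qed.

Lemma evalL_adjP p : is_adjoint (evalL p) (evalL_adj p).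
Proof.
move=> h g; rewrite /evalL /evalL_adj !fct_sumE.
elim: (enum_fset (msupp p)) => [|w s IH].
  by rewrite !big_nil fdot0l fdot0r.
by rewrite !big_cons fdotDl fdotDr IH !opZ fdotZl fdotZr Lword_adjP.
Qed.

Lemma subset_opclosure E : E `<=` opclosure E.
Proof.
move=> T ET e e0; exists T => // h.
rewrite subrr fnorm0; apply: mulr_ge0; first exact: ltW.
exact: sqrtr_ge0.
Qed.

Let hpair (T : op) := exists p q, T = evalL p + evalL_adj q.

Let hpair_sys T : hpair T -> disk_system T.
Proof.
move=> [p [q ->]]; apply: subset_opclosure.
exists (evalL p), (evalL q), (evalL_adj q); split => //.
- by apply: subset_opclosure; exists p.
- by apply: subset_opclosure; exists q.
- exact: evalL_adjP.
Qed.

Let evalL0 : evalL 0 = 0. Proof. by rewrite evalLE malg_map0. Qed.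
Let evalL_adj0 : evalL_adj 0 = 0. Proof. by rewrite evalL_adjE malg_map0. Qed.

Let hpair0 : hpair 0.
Proof. by exists 0, 0; rewrite evalL0 evalL_adj0 addr0. Qed.

Let hpairD S T : hpair S -> hpair T -> hpair (S + T).
Proof.
move=> [p [q ->]] [p' [q' ->]]; exists (p + p'), (q + q').
by rewrite evalL_D evalL_adjD addrACA.
Qed.

Let hpairZ a S : hpair S -> hpair (a *: S).
Proof.
move=> [p [q ->]]; exists (a *: p), (a^* *: q).
by rewrite evalL_Z evalL_adjZ conjCK scalerDr.
Qed.

Let hpair_w v w : hpair (Lword_adj v \o Lword w).
Proof.
elim: v w => [|k v IH] [|j w] /=.
- exists <<(fmone 'I_d)>>, 0; rewrite evalL_adj0 addr0 evalLE malg_mapU scale1r.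
  by rewrite [fmone _ in RHS]fmE.
- exists <<FMonom (j :: w)>>, 0; rewrite evalL_adj0 addr0 evalLE malg_mapU scale1r //.
- exists 0, <<FMonom (k :: v)>>; rewrite evalL0 add0r evalL_adjE malg_mapU rmorph1 scale1r //.
have := IH w; case: (eqVneq k j) => [->|kj] h.
  by congr hpair: h; apply/funext => x /=; rewrite Lop_adjK eqxx.
have -> : (Lword_adj v \o Lop_adj k) \o (Lop j \o Lword w) = 0 :> op.
  apply/funext => x /=; rewrite Lop_adjK (negbTE kj).
  exact: Lword_adj0.
exact: hpair0.
Qed.

Lemma disk_system_gram p q : disk_system (evalL_adj p \o evalL q).
Proof.
apply: hpair_sys.
have -> : evalL_adj p \o evalL q = \sum_(v <- msupp p) \sum_(w <- msupp q)
    ((p@_v)^* * q@_w) *: (Lword_adj v \o Lword w).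
  apply/funext => h; rewrite /= /evalL_adj !fct_sumE; apply: eq_bigr => v _.
  rewrite opZ fct_sumE /evalL fct_sumE.
  rewrite (big_morph (Lword_adj v) (id1 := 0) (op1 := +%R)).
  - rewrite scaler_sumr; apply: eq_bigr => w _.
    by rewrite opZ -[q@_w *: _]addr0 Lword_adj_lin Lword_adj0 addr0 scalerA.
  - by move=> x y; rewrite -[x]scale1r Lword_adj_lin !scale1r.
  - exact: Lword_adj0.
apply: (big_ind hpair) => [||v _]; [exact: hpair0|exact: hpairD|].
apply: (big_ind hpair) => [||w _]; [exact: hpair0|exact: hpairD|].
by apply: hpairZ; exact: hpair_w.
Qed.

Variable mu : ncMeasure.

(* p(L)^* q(L) belongs to the free disk system by disk_system_gram. *)
Definition mu_form (p q : fpoly) : C := mu (evalL_adj p \o evalL q).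

Lemma mu_form_linr p a q q' :
  mu_form p (a *: q + q') = a * mu_form p q + mu_form p q'.
Proof.
rewrite /mu_form -ncm_lin; try exact: disk_system_gram.
by congr (ncm mu); apply/funext => h /=; rewrite evalL_D evalL_Z opD opZ evalL_adj_lin.
Qed.

Lemma mu_form_linl p a p' q :
  mu_form (a *: p + p') q = a^* * mu_form p q + mu_form p' q.
Proof.
rewrite /mu_form -ncm_lin; try exact: disk_system_gram.
by congr (ncm mu); apply/funext => h /=; rewrite evalL_adjD evalL_adjZ.
Qed.

Lemma mu_form_ge0 p : 0 <= mu_form p p.
Proof.
apply: ncm_ge0 => [|h]; first exact: disk_system_gram.
by rewrite /= -evalL_adjP fdot_ge0.
Qed.

Lemma mu_form_shift k p q :
  mu_form (<<fmu k>> * p) (<<fmu k>> * q) = mu_form p q.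
Proof.
have eLop r : evalL (<<fmu k>> * r) = @Lop R d k \o evalL r.
  apply/funext => h; rewrite malgM_def fgmulUg evalLE.
  rewrite (big_morph _ (malg_mapD idfun (Lword : {fmonom 'I_d} -> op)) (malg_map0 _ _)).
  rewrite /= /evalL !fct_sumE (big_morph (Lop k) (id1 := 0) (op1 := +%R)).
  - apply: eq_bigr => w _; rewrite malg_mapU mul1r !opZ fmM fmU /=.
    by have := Lop_lin k r@_w (Lword w h) 0; rewrite Lop0 !addr0.
  - by move=> x y; have := Lop_lin k 1 x y; rewrite !scale1r.
  - exact: Lop0.
rewrite {1}/mu_form eLop; congr (ncm mu); apply/funext => h.
suff eLs r g : evalL_adj (<<fmu k>> * r) g = evalL_adj r (Lop_adj k g).
  by rewrite /= eLs Lop_adjK eqxx.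
rewrite malgM_def fgmulUg evalL_adjE.
rewrite (big_morph _ (malg_mapD (@Num.conj C) (Lword_adj : {fmonom 'I_d} -> op)) (malg_map0 _ _)).
rewrite /evalL_adj !fct_sumE; apply: eq_bigr => w _.
by rewrite malg_mapU mul1r !opZ fmM fmU.
Qed.

End DiskSystem.

(* Positive semidefinite sesquilinear forms, linear in the second variable. *)
Record preInner (R : realType) (V : lmodType R[i]) := PreInner {
  ip :> V -> V -> R[i];
  ip_linr : forall x a y z, ip x (a *: y + z) = a * ip x y + ip x z;
  ip_linl : forall a x y z, ip (a *: x + y) z = a^* * ip x z + ip y z;
  ip_ge0 : forall x, 0 <= ip x x }.

Section Completion.
Variables (R : realType) (V : lmodType R[i]) (s : preInner V).
Local Notation C := R[i].
Implicit Types (a : C) (x y z : V) (u v : nat -> V).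

Definition sqn x : R := complex.Re (s x x).

Definition cauchy_for_ip u : Prop := forall e : R, 0 < e ->
  exists N, forall m n, (N <= m)%N -> (N <= n)%N -> sqn (u m - u n) < e.

Definition null_for_ip u : Prop := forall e : R, 0 < e ->
  exists N, forall n, (N <= n)%N -> sqn (u n) < e.

Lemma ipDr x y z : s x (y + z) = s x y + s x z.
Proof. by have := ip_linr s x 1 y z; rewrite scale1r mul1r. Qed.

Lemma ipDl x y z : s (x + y) z = s x z + s y z.
Proof. by have := ip_linl s 1 x y z; rewrite scale1r rmorph1 mul1r. Qed.

Lemma ip0r x : s x 0 = 0.
Proof. by apply: (addrI (s x 0)); rewrite -ipDr !addr0. Qed.

Lemma ip0l x : s 0 x = 0.
Proof. by apply: (addrI (s 0 x)); rewrite -ipDl !addr0. Qed.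

Lemma ipZr x a y : s x (a *: y) = a * s x y.
Proof. by have := ip_linr s x a y 0; rewrite ip0r !addr0. Qed.

Lemma ipZl x a y : s (a *: x) y = a^* * s x y.
Proof. by have := ip_linl s a x 0 y; rewrite ip0l !addr0. Qed.

Lemma sqn_ge0 x : 0 <= sqn x.
Proof. by have := ip_ge0 s x; rewrite lecE => /andP[]. Qed.

Lemma sqn0 : sqn 0 = 0. Proof. by rewrite /sqn ip0r. Qed.

Lemma sqnZ a x : sqn (a *: x) = sqabs a * sqn x.
Proof.
rewrite /sqn ipZr ipZl; have := ip_ge0 s x; rewrite lecE => /andP[/eqP].
case: a (s x x) => [a b] [c e] /= -> _; rewrite /sqabs /=; ring.
Qed.

Lemma sqnN x : sqn (- x) = sqn x.
Proof.
by rewrite -scaleN1r sqnZ /sqabs /= oppr0 sqrrN expr1n expr0n /= addr0 mul1r.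
Qed.

Lemma sqnD x y : sqn (x + y) <= 2 * sqn x + 2 * sqn y.
Proof.
have h := sqn_ge0 (x - y); rewrite -subr_ge0; move: h.
suff -> : sqn (x - y) = 2 * sqn x + 2 * sqn y - sqn (x + y) by [].
have Nl z : s (- y) z = - s y z.
  by rewrite -scaleN1r ipZl rmorphN1 mulN1r.
have Nr z : s z (- y) = - s z y by rewrite -scaleN1r ipZr mulN1r.
rewrite /sqn !ipDr !ipDl !Nl !Nr.
case: (s x x) (s x y) (s y x) (s y y) => [a b] [a1 b1] [a2 b2] [a3 b3] /=.
ring.
Qed.

Definition cauchy_pred : {pred (nat -> V)} := [pred u | `[< cauchy_for_ip u >]].

Lemma cauchy_closed : submod_closed cauchy_pred.
Proof.
split=> [|a u v].
  rewrite unfold_in; apply: asboolT => e e0; exists 0%N => m n _ _.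
  by rewrite subrr sqn0.
rewrite !unfold_in => /asboolW hu /asboolW hv; apply: asboolT => e e0.
have ap : 0 < 4 * (sqabs a + 1) by rewrite mulr_gt0 // ltr_wpDl // sqabs_ge0.
have [N hN] := hu _ (divr_gt0 e0 ap).
have e4 : 0 < e / 4 by rewrite divr_gt0.
have [M hM] := hv _ e4.
exists (maxn N M) => m n; rewrite !geq_max => /andP[Nm Mm] /andP[Nn Mn].
rewrite (_ : _ - _ = a *: (u m - u n) + (v m - v n)); last first.
  by rewrite scalerBr opprD addrACA.
apply: (le_lt_trans (sqnD _ _)); rewrite sqnZ.
have {hN}/= := hN _ _ Nm Nn; have {hM}/= := hM _ _ Mm Mn.
rewrite ltr_pdivlMr // ltr_pdivlMr //.
have := sqn_ge0 (u m - u n); have := sqn_ge0 (v m - v n).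
by have := sqabs_ge0 a; nra.
Qed.

HB.instance Definition _ :=
  GRing.isSubmodClosed.Build C (nat -> V) cauchy_pred cauchy_closed.

Record cauchySeq := CauchySeq { cseq :> nat -> V; _ : cseq \in cauchy_pred }.
HB.instance Definition _ := [isSub for cseq].
HB.instance Definition _ := [Choice of cauchySeq by <:].
HB.instance Definition _ := [SubChoice_isSubLmodule of cauchySeq by <:].

Definition null_pred : {pred cauchySeq} := [pred u : cauchySeq | `[< null_for_ip u >]].

Lemma null_closed : submod_closed null_pred.
Proof.
split=> [|a u v].
  rewrite unfold_in; apply: asboolT => e e0; exists 0%N => n _ /=.
  by rewrite sqn0.
rewrite !unfold_in => /asboolW hu /asboolW hv; apply: asboolT => e e0.
have ap : 0 < 4 * (sqabs a + 1) by rewrite mulr_gt0 // ltr_wpDl // sqabs_ge0.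
have [N hN] := hu _ (divr_gt0 e0 ap).
have e4 : 0 < e / 4 by rewrite divr_gt0.
have [M hM] := hv _ e4.
exists (maxn N M) => n; rewrite !geq_max => /andP[Nn Mn].
apply: (@le_lt_trans _ _ _ _ _ (sqnD (a *: u n) (v n))); rewrite sqnZ.
have {hN}/= := hN _ Nn; have {hM}/= := hM _ Mn.
rewrite ltr_pdivlMr // ltr_pdivlMr //.
have := sqn_ge0 (u n); have := sqn_ge0 (v n).
by have := sqabs_ge0 a; nra.
Qed.

HB.instance Definition _ :=
  GRing.isSubmodClosed.Build C cauchySeq null_pred null_closed.

(* Hausdorff completion of (V, s): Cauchy sequences modulo null sequences.
   Vectors of zero length are identified with 0. *)
Definition completion := Quotient.quot null_pred.
HB.instance Definition _ := GRing.Zmodule.on completion.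

Local Notation cls := (\pi_completion)%qT.

Definition cscale a (X : completion) : completion := cls (a *: repr X).

Lemma cls_eq (U W : cauchySeq) : U - W \in null_pred -> cls U = cls W.
Proof. by move=> h; apply/eqP; rewrite piE Quotient.equivE. Qed.

Lemma cls_repr (U : cauchySeq) : repr (cls U) - U \in null_pred.
Proof. by rewrite Quotient.idealrBE reprK. Qed.

Lemma clsZ a (U : cauchySeq) : cls (a *: U) = cscale a (cls U).
Proof.
apply: cls_eq; rewrite -scalerBr rpredZ // -opprB rpredN; exact: cls_repr.
Qed.

Lemma clsD (U W : cauchySeq) : cls (U + W) = cls U + cls W.
Proof. by rewrite !piE. Qed.

Lemma cscaleA a b X : cscale a (cscale b X) = cscale (a * b) X.
Proof. by rewrite -[X]reprK -(clsZ b) -(clsZ a) -(clsZ (a * b)) scalerA. Qed.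

Lemma cscale1 : left_id 1 cscale.
Proof. by move=> X; rewrite -[X]reprK -clsZ scale1r. Qed.

Lemma cscaleDr : right_distributive cscale +%R.
Proof.
by move=> a X Y; rewrite -[X]reprK -[Y]reprK -clsD -!clsZ -clsD scalerDr.
Qed.

Lemma cscaleDl X : {morph cscale^~ X : a b / a + b}.
Proof. by move=> a b; rewrite -[X]reprK -!clsZ -clsD scalerDl. Qed.

HB.instance Definition _ := GRing.Zmodule_isLmodule.Build C completion
  cscaleA cscale1 cscaleDr cscaleDl.

Lemma cauchy_cst x : cauchy_for_ip (fun=> x).
Proof. by move=> e e0; exists 0%N => m n _ _; rewrite subrr sqn0. Qed.

Definition mkcauchy u (hu : cauchy_for_ip u) : completion :=
  cls (@CauchySeq u (asboolT hu)).

Definition embed x : completion := mkcauchy (cauchy_cst x).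

Lemma cseqP (U : cauchySeq) : cauchy_for_ip U.
Proof. by case: U => U /= /asboolW. Qed.

Definition cdot (X Y : completion) : C :=
  climn (fun n => s (repr X n) (repr Y n)).

Definition cnorm (X : completion) : R := Num.sqrt (complex.Re (cdot X X)).

End Completion.

Section ClosedSpan.
Variables (R : realType) (V : lmodType R[i]) (s : preInner V).
Local Notation C := R[i].
Local Notation H := (completion s).

(* Adjoint of an operator on the completion; the default value is never used
   for bounded operators, by the Riesz representation theorem. *)
Definition adj (T : H -> H) : H -> H :=
  xget (fun=> 0) [set S | forall X Y, cdot (T X) Y = cdot X (S Y)].

Definition closed_span (E : set H) : set H :=
  [set X | forall e : R, 0 < e -> exists n (c : 'I_n -> C) (v : 'I_n -> H),
     (forall i, E (v i)) /\ cnorm (X - \sum_(i < n) c i *: v i) < e].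

Definition finite_dim (E : set H) : Prop :=
  exists n (v : 'I_n -> H), forall X, E X ->
    exists c : 'I_n -> C, X = \sum_(i < n) c i *: v i.

End ClosedSpan.

Section GNS.
Variables (R : realType) (d : nat) (mu : ncMeasure R d).
Local Notation C := R[i].
Local Notation fpoly := {malg C[{fmonom 'I_d}]}.

Definition gns_ip : preInner fpoly :=
  PreInner (mu_form_linr mu) (fun a x y z => mu_form_linl mu x a y z)
    (mu_form_ge0 mu).

Definition gns := completion gns_ip.

(* The class p + N_mu. *)
Definition gns_vec (p : fpoly) : gns := embed gns_ip p.

Lemma sqn_shift k p : sqn gns_ip (<<fmu k>> * p) = sqn gns_ip p.
Proof. by rewrite /sqn /= mu_form_shift. Qed.

Lemma cauchy_shift k (U : cauchySeq gns_ip) :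
  cauchy_for_ip gns_ip (fun n => <<fmu k>> * U n).
Proof.
move=> e e0; have [N hN] := cseqP U e0; exists N => m n Nm Nn.
by rewrite -mulrBr sqn_shift; exact: hN.
Qed.

(* The row isometry Pi_mu : left multiplication by the k-th variable,
   extended from polynomials to their Cauchy sequences. *)
Definition gns_shift (k : 'I_d) (X : gns) : gns :=
  mkcauchy (cauchy_shift k (repr X)).

Lemma gns_shift_vec k p : gns_shift k (gns_vec p) = gns_vec (<<fmu k>> * p).
Proof.
apply: cls_eq; rewrite unfold_in; apply: asboolT => e e0.
have /asboolW h := cls_repr (CauchySeq (asboolT (cauchy_cst gns_ip p))).
have [N hN] := h _ e0; exists N => n Nn /=.
by rewrite -mulrBr sqn_shift; exact: (hN _ Nn).
Qed.

Definition gns_word (w : seq 'I_d) : gns -> gns :=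
  foldr (fun k T => gns_shift k \o T) id w.

(* Closed span of the vectors Pi_mu^{*w}(1 + N_mu), w a word. *)
Definition H_mu : set gns :=
  closed_span [set adj (gns_word w) (gns_vec 1) | w in [set: seq 'I_d]].

Definition finitely_correlated : Prop := finite_dim H_mu.

End GNS.

Section NCFunctions.
Variables (R : realType) (d : nat).
Local Notation C := R[i].
Local Open Scope sesquilinear_scope.

Definition posdef n (A : 'M[C]_n) : Prop :=
  forall x : 'cV[C]_n, x != 0 -> 0 < (x^t* *m A *m x) 0 0.

Definition in_ball n (Z : 'I_d -> 'M[C]_n) : Prop :=
  (0 < n)%N /\ posdef (1%:M - \sum_(j < d) Z j *m (Z j)^t* ).

Definition ncfun := forall n, ('I_d -> 'M[C]_n) -> 'M[C]_n.

(* Grading is built into ncfun; only the values on the NC unit ball matter. *)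
Definition nc_function (f : ncfun) : Prop :=
  (forall n m (Z : 'I_d -> 'M[C]_n) (W : 'I_d -> 'M[C]_m),
     in_ball Z -> in_ball W ->
     f (n + m)%N (fun j => block_mx (Z j) 0 0 (W j)) =
       block_mx (f n Z) 0 0 (f m W)) /\
  (forall n (S : 'M[C]_n) (Z : 'I_d -> 'M[C]_n), S \in unitmx ->
     in_ball Z -> in_ball (fun j => S *m Z j *m invmx S) ->
     f n (fun j => S *m Z j *m invmx S) = S *m f n Z *m invmx S).

Definition mx_contraction n (A : 'M[C]_n) : Prop :=
  forall x : 'cV[C]_n,
    \sum_(i < n) `|(A *m x) i 0| ^+ 2 <= \sum_(i < n) `|x i 0| ^+ 2.

(* The closed unit ball of H^oo_d for the supremum norm over the NC unit ball. *)
Definition Hinf_unit_ball (b : ncfun) : Prop :=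
  nc_function b /\
  forall n (Z : 'I_d -> 'M[C]_n), in_ball Z -> mx_contraction (b n Z).

Definition not_identically_one (b : ncfun) : Prop :=
  exists n (Z : 'I_d -> 'M[C]_n), in_ball Z /\ b n Z <> 1%:M.

Inductive rexpr :=
  | RVar of 'I_d
  | RConst of C
  | RAdd of rexpr & rexpr
  | RMul of rexpr & rexpr
  | RInv of rexpr.

Fixpoint reval n (Z : 'I_d -> 'M[C]_n) (r : rexpr) : 'M[C]_n :=
  match r with
  | RVar j => Z j
  | RConst c => c%:M
  | RAdd r1 r2 => reval Z r1 + reval Z r2
  | RMul r1 r2 => reval Z r1 *m reval Z r2
  | RInv r1 => invmx (reval Z r1)
  end.

Fixpoint rdom n (Z : 'I_d -> 'M[C]_n) (r : rexpr) : bool :=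
  match r with
  | RVar _ | RConst _ => true
  | RAdd r1 r2 | RMul r1 r2 => rdom Z r1 && rdom Z r2
  | RInv r1 => rdom Z r1 && (reval Z r1 \in unitmx)
  end.

(* An expression is valid if its domain is nonempty at some positive size. *)
Definition rvalid (r : rexpr) : Prop :=
  exists n (Z : 'I_d -> 'M[C]_n), (0 < n)%N /\ rdom Z r.

Definition requiv (r1 r2 : rexpr) : Prop :=
  forall n (Z : 'I_d -> 'M[C]_n), (0 < n)%N -> rdom Z r1 -> rdom Z r2 ->
    reval Z r1 = reval Z r2.

(* The domain of an NC rational function is the union of the domains of its
   representatives, so the representative may depend on the point. *)
Definition nc_rational (b : ncfun) : Prop :=
  exists2 r, rvalid r & forall n (Z : 'I_d -> 'M[C]_n), in_ball Z ->
    exists r', [/\ rvalid r', requiv r r', rdom Z r' & b n Z = reval Z r'].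

End NCFunctions.

Section Clark.
Variables (R : realType) (d : nat).
Local Notation C := R[i].
Local Notation fock := (fock R d).

(* C^n (x) H^2_d is represented by n-tuples of Fock space vectors. *)
Definition ZLadj n (Z : 'I_d -> 'M[C]_n) (X : 'I_n -> fock) : 'I_n -> fock :=
  fun i => \sum_(k < d) \sum_(j < n) Z k i j *: Lop_adj k (X j).

(* Two-sided inverse; for Z in the NC unit ball, I - Z L^* is invertible. *)
Definition inv_op (T : choiceType) (f : T -> T) : T -> T :=
  xget (fun x : T => x) [set g : T -> T | cancel f g /\ cancel g f].

Definition herglotz_op n (Z : 'I_d -> 'M[C]_n) :
    ('I_n -> fock) -> ('I_n -> fock) :=
  (fun X => X + ZLadj Z X) \o inv_op (fun X => X - ZLadj Z X).

(* id_n (x) mu acts entrywise on the matrix of operators on H^2_d. *)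
Definition herglotz (mu : ncMeasure R d) n (Z : 'I_d -> 'M[C]_n) : 'M[C]_n :=
  \matrix_(i, j) mu (fun h =>
    herglotz_op Z (fun l => if l == j then h else 0) i).

(* Invertibility of I - b(Z) is part of the meaning of the displayed inverse. *)
Definition is_clark_measure (b : ncfun R d) (mu : ncMeasure R d) : Prop :=
  let b0 := b 1%N (fun=> 0) 0 0 in
  let t := complex.Im ((1 + b0) / (1 - b0)) in
  forall n (Z : 'I_d -> 'M[C]_n), in_ball Z ->
    (1%:M - b n Z \in unitmx) /\
    (1%:M + b n Z) *m invmx (1%:M - b n Z) =
      herglotz mu Z + (0 +i* t)%:M.

End Clark.

(* Main.v *)
(** The adjoint vectors [Pi^{*w} 1] pair with the monomial [z^u] to the moment of [w ++ u], so
    [H_mu] is finite dimensional iff the Hankel matrix of the moments has finite rank.  The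
    Herglotz transform of [mu] is, up to constants, the power series whose coefficients are
    the moments of the reversed words.

    If the Clark function is rational, it has a representative regular at 0; the expansion at
    0 of a rational expression has a finite-rank Hankel matrix (these series are closed under
    sums, products and inverses), and evaluation at nilpotent matrices reads off the
    coefficients of the Herglotz transform.

    Conversely, a Hankel matrix of finite rank gives a realization
    [c w = gam A^w bet], hence the Herglotz transform is [2 gam (1 - sum A_k Z_k)^-1 bet - c_0]
    on the whole ball, and its Cayley transform is contractive because its real part is
    nonnegative.  For a given point [Z] the inverse [P] of the pencil [1 - sum A_k Z_k] is a
    polynomial in the pencil by Cayley-Hamilton; after multiplication by this polynomial the
    pencil is the identity at [Z], so Gaussian elimination without pivoting produces a
    rational expression defined at [Z].  All these expressions agree wherever they are
    defined, being left inverses of a pencil that the expression built at [0] inverts on both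
    sides. *)

Require Import Defs.
From mathcomp Require Import all_boot all_order all_algebra.
From mathcomp Require Import generic_quotient ring_quotient finmap monalg.
From mathcomp Require Import all_classical all_reals all_analysis.
From mathcomp Require Import complex mxtens.
From mathcomp Require Import ring lra zify.

Set Implicit Arguments.
Unset Strict Implicit.
Unset Printing Implicit Defensive.
Import Order.TTheory GRing.Theory Num.Theory.
Import numFieldNormedType.Exports.
Local Open Scope classical_set_scope.
Local Open Scope ring_scope.
Local Open Scope complex_scope.

(** * Limits of complex sequences and semi-inner products *)

(** The delicate point is the invertibility of [1 - sum A_k Z_k] at every point of the ball: a
    realization of a series regular at 0 says nothing far from 0. Here the realization is read off
    an invertible finite section of the Hankel matrix, so each entry of [A^w] is a fixed finite
    combination of moments of words [x ++ w ++ y]. On the ball [Z L^*] is a strict contraction, and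
    positivity makes [mu] bounded on the norm closure of the operators [p(L)^*]; hence the sums of
    these moments against [Z^w] over the words of length m tend to 0. So the powers of [sum A_k Z_k]
    tend to 0 and 1 is not an eigenvalue.

    The same boundedness makes the Herglotz transform an entrywise limit of the partial sums of its
    power series. Its algebraic properties (direct sums, similarities, the resolvent formula) are
    then obtained by computing with partial sums and using uniqueness of limits. *)

Section ComplexTools.
Variable R : realType.
Local Notation C := R[i].
Implicit Types (x y z : C) (u v : nat -> C).

(** [climn] has a value even without convergence. This relation carries existence and value
    together, so identities follow from [ctends_unique]. *)
Definition ctends u (l : C) : Prop :=
  (fun n => complex.Re (u n)) @ \oo --> complex.Re l /\
  (fun n => complex.Im (u n)) @ \oo --> complex.Im l.

Lemma ctends_climn u l : ctends u l -> climn u = l.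
Proof.
by case=> hr hi; rewrite /climn (cvg_lim _ hr) // (cvg_lim _ hi) //; case: l {hr hi}.
Qed.

Lemma ccvgn_ctends u : ccvgn u -> ctends u (climn u).
Proof. by case. Qed.

Lemma ctends_unique u l l' : ctends u l -> ctends u l' -> l = l'.
Proof. by move=> /ctends_climn <- /ctends_climn. Qed.

Lemma ctends_cst l : ctends (fun=> l) l.
Proof. by split; exact: cvg_cst. Qed.

Lemma eq_ctends u v l : u =1 v -> ctends u l -> ctends v l.
Proof. by move=> /funext ->. Qed.

Lemma ctendsD u v l m : ctends u l -> ctends v m ->
  ctends (fun n => u n + v n) (l + m).
Proof.
move=> [ur ui] [vr vi]; split.
  rewrite raddfD; have -> : (fun n => complex.Re (u n + v n)) =
    (fun n => complex.Re (u n)) \+ (fun n => complex.Re (v n)).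
    by apply/funext => n /=; rewrite raddfD.
  exact: cvgD.
rewrite raddfD; have -> : (fun n => complex.Im (u n + v n)) =
    (fun n => complex.Im (u n)) \+ (fun n => complex.Im (v n)).
  by apply/funext => n /=; rewrite raddfD.
exact: cvgD.
Qed.

Lemma cReM x y : complex.Re (x * y) =
  complex.Re x * complex.Re y - complex.Im x * complex.Im y.
Proof. by case: x y => [? ?] [? ?]. Qed.

Lemma cImM x y : complex.Im (x * y) =
  complex.Re x * complex.Im y + complex.Im x * complex.Re y.
Proof. by case: x y => [? ?] [? ?]. Qed.

Lemma cRe_conj x : complex.Re x^* = complex.Re x. Proof. by case: x. Qed.
Lemma cIm_conj x : complex.Im x^* = - complex.Im x. Proof. by case: x. Qed.

Lemma ctendsM u v l m : ctends u l -> ctends v m ->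
  ctends (fun n => u n * v n) (l * m).
Proof.
move=> [ur ui] [vr vi]; split.
  rewrite cReM; under eq_fun do rewrite cReM.
  by apply: cvgB; apply: cvgM.
rewrite cImM; under eq_fun do rewrite cImM.
by apply: cvgD; apply: cvgM.
Qed.

Lemma ctendsZ a u l : ctends u l -> ctends (fun n => a * u n) (a * l).
Proof. by apply: ctendsM; exact: ctends_cst. Qed.

Lemma ctendsN u l : ctends u l -> ctends (fun n => - u n) (- l).
Proof.
move=> /(ctendsZ (-1)); rewrite mulN1r; apply: eq_ctends => n.
by rewrite mulN1r.
Qed.

Lemma ctendsB u v l m : ctends u l -> ctends v m ->
  ctends (fun n => u n - v n) (l - m).
Proof. by move=> hu hv; apply: ctendsD => //; exact: ctendsN. Qed.

Lemma ctends_sum (I : Type) (s : seq I) (P : pred I) (u : I -> nat -> C)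
    (l : I -> C) : (forall i, P i -> ctends (u i) (l i)) ->
  ctends (fun n => \sum_(i <- s | P i) u i n) (\sum_(i <- s | P i) l i).
Proof.
move=> h; elim: s => [|i s IH].
  rewrite big_nil; under eq_fun do rewrite big_nil.
  exact: ctends_cst.
rewrite big_cons; under eq_fun do rewrite big_cons.
by case: ifP => // Pi; apply: ctendsD => //; exact: h.
Qed.

Lemma ctends_conj u l : ctends u l -> ctends (fun n => (u n)^*) l^*.
Proof.
move=> [hr hi]; split.
  by rewrite cRe_conj; under eq_fun do rewrite cRe_conj.
by rewrite cIm_conj; under eq_fun do rewrite cIm_conj; apply: cvgN.
Qed.

Lemma ctends_shift u l : ctends u l -> ctends (fun n => u n.+1) l.
Proof.
move=> [hr hi]; split.
  by have /= -> := cvg_shiftS (fun n => complex.Re (u n)) (nbhs (complex.Re l)).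
by have /= -> := cvg_shiftS (fun n => complex.Im (u n)) (nbhs (complex.Im l)).
Qed.

Lemma ctends_near u v l (N : nat) : (forall n, (N <= n)%N -> u n = v n) ->
  ctends u l -> ctends v l.
Proof.
move=> e [hr hi]; split.
  apply: cvg_trans hr; apply: near_eq_cvg; exists N => //= n /= Nn.
  by rewrite e.
apply: cvg_trans hi; apply: near_eq_cvg; exists N => //= n /= Nn.
by rewrite e.
Qed.

Lemma ctends_eps u l :
  (forall e : R, 0 < e -> exists N, forall n, (N <= n)%N -> sqabs (u n - l) < e) ->
  ctends u l.
Proof.
move=> h; split; apply/cvgrPdist_lt => e e0.
  have [N hN] := h _ (exprn_gt0 2 e0); exists N => //= n /= Nn.
  have := hN _ Nn; rewrite /sqabs !raddfB /= => hlt.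
  rewrite -ltr_sqr ?nnegrE ?normr_ge0 1?ltW // real_normK ?num_real //.
  by rewrite -sqrrN opprB; apply: le_lt_trans hlt; rewrite lerDl sqr_ge0.
have [N hN] := h _ (exprn_gt0 2 e0); exists N => //= n /= Nn.
have := hN _ Nn; rewrite /sqabs !raddfB /= => hlt.
rewrite -ltr_sqr ?nnegrE ?normr_ge0 1?ltW // real_normK ?num_real //.
by rewrite -sqrrN opprB; apply: le_lt_trans hlt; rewrite lerDr sqr_ge0.
Qed.

Lemma ctends_squeeze u l (e : nat -> R) : (forall n, sqabs (u n - l) <= e n) ->
  e @ \oo --> (0 : R) -> ctends u l.
Proof.
move=> h he; apply: ctends_eps => eps eps0.
have /cvgrPdist_lt/(_ _ eps0)[N _ hN] := he.
exists N => n Nn; apply: le_lt_trans (h n) _.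
have := hN _ Nn; rewrite sub0r normrN /=; apply: le_lt_trans; exact: ler_norm.
Qed.

Lemma sqabs0_eq0 z : sqabs z = 0 -> z = 0.
Proof.
case: z => a b; rewrite /sqabs /= => /eqP.
rewrite paddr_eq0 ?sqr_ge0 // !sqrf_eq0 => /andP[/eqP-> /eqP->] //.
Qed.

Lemma sqabs0 : sqabs (0 : C) = 0.
Proof. by rewrite /sqabs /= expr0n /= addr0. Qed.

Lemma sqabsN z : sqabs (- z) = sqabs z.
Proof. by case: z => a b; rewrite /sqabs /= !sqrrN. Qed.

Lemma sqabs_conj z : sqabs z^* = sqabs z.
Proof. by case: z => a b; rewrite /sqabs /= sqrrN. Qed.

Lemma mulCconj z : z^* * z = (sqabs z)%:C.
Proof. by case: z => a b; rewrite /sqabs /=; congr (_ +i* _); ring. Qed.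

Lemma ctends_le0 u l : ctends u l -> (forall n, 0 <= complex.Re (u n)) ->
  0 <= complex.Re l.
Proof.
move=> [hr _] h; rewrite -(cvg_lim _ hr) //.
by apply: limr_ge; [apply/cvg_ex; exists (complex.Re l)|near=> n].
Unshelve. all: by end_near. Qed.

Lemma ctends_Re_le u l (M : R) : ctends u l -> (forall n, complex.Re (u n) <= M) ->
  complex.Re l <= M.
Proof.
move=> [hr _] h; rewrite -(cvg_lim _ hr) //.
by apply: limr_le; [apply/cvg_ex; exists (complex.Re l)|near=> n].
Unshelve. all: by end_near. Qed.

(* Discriminant argument, without assuming c > 0. *)
Lemma quad_bound (a b c : R) : 0 <= a -> 0 <= b -> 0 <= c ->
  (forall t : R, 0 <= a - 2 * t * b + t ^+ 2 * b * c) -> b <= a * c.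
Proof.
move=> a0 b0 c0 h; have [c_0|cn0] := eqVneq c 0.
  have [b_0|bn0] := eqVneq b 0; first by rewrite b_0 c_0 mulr0.
  (* With c = 0 and b > 0 the quadratic is linear in t and takes the value -1 here. For c > 0 below,
     t = 1/c is the minimizer. *)
  have := h ((a + 1) / (2 * b)); rewrite c_0 mulr0 addr0.
  have -> : 2 * ((a + 1) / (2 * b)) * b = a + 1 by field.
  lra.
have cp : 0 < c by rewrite lt_neqAle eq_sym cn0.
have := h c^-1.
have -> : a - 2 * c^-1 * b + c^-1 ^+ 2 * b * c = a - b / c by field.
by rewrite subr_ge0 ler_pdivrMr.
Qed.

End ComplexTools.

(** * Semi-inner products: symmetry, Cauchy-Schwarz, convergence of pairings *)

Section PreInnerTheory.
Variables (R : realType) (V : lmodType R[i]) (s : preInner V).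
Local Notation C := R[i].
Implicit Types (x y z : V) (a b : C).

(** Symmetry is not a field of [preInner]. It follows by polarization, since the form is real at
    [x + y] and at ['i *: x + y]. *)
Lemma ip_sym x y : s y x = (s x y)^*.
Proof.
have real z : complex.Im (s z z) = 0.
  by have := ip_ge0 s z; rewrite lecE => /andP[/eqP].
have h1 := real (x + y); have h2 := real ('i *: x + y).
have hx := real x; have hy := real y.
move: h1 h2; rewrite !(ipDl, ipDr, ipZl, ipZr).
case: (s x x) hx => xr xi /= ->; case: (s y y) hy => yr yi /= ->.
case: (s x y) (s y x) => [a b] [c e] /= h1 h2.
by congr (_ +i* _); lra.
Qed.

Lemma ipNr x y : s x (- y) = - s x y.
Proof. by rewrite -scaleN1r ipZr mulN1r. Qed.

Lemma ipNl x y : s (- x) y = - s x y.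
Proof. by rewrite -scaleN1r ipZl rmorphN1 mulN1r. Qed.

Lemma ipBr x y z : s x (y - z) = s x y - s x z.
Proof. by rewrite ipDr ipNr. Qed.

Lemma ipBl x y z : s (x - y) z = s x z - s y z.
Proof. by rewrite ipDl ipNl. Qed.

Lemma ip_sumr (I : Type) (r : seq I) (P : pred I) x (F : I -> V) :
  s x (\sum_(i <- r | P i) F i) = \sum_(i <- r | P i) s x (F i).
Proof.
by apply: (big_morph (s x)) => [y z|]; [exact: ipDr|exact: ip0r].
Qed.

Lemma ip_suml (I : Type) (r : seq I) (P : pred I) x (F : I -> V) :
  s (\sum_(i <- r | P i) F i) x = \sum_(i <- r | P i) s (F i) x.
Proof.
by apply: (big_morph (s^~ x)) => [y z|]; [exact: ipDl|exact: ip0l].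
Qed.

Lemma ip_sqn x : s x x = (sqn s x)%:C.
Proof.
have := ip_ge0 s x; rewrite lecE /sqn => /andP[/eqP].
by case: (s x x) => a b /= ->.
Qed.

Lemma sqnDE x y : sqn s (x + y) = sqn s x + 2 * complex.Re (s x y) + sqn s y.
Proof.
rewrite /sqn !(ipDl, ipDr) (ip_sym x y) !raddfD /= cRe_conj; ring.
Qed.

(** The phase of the coefficient is aligned with [s y x], so that the cross term becomes
    [sqabs (s x y)] and positivity has exactly the shape of the hypothesis of [quad_bound]. *)
Lemma ip_quad x y (t : R) :
  sqn s (x - (t%:C * s y x) *: y) =
  sqn s x - 2 * t * sqabs (s x y) + t ^+ 2 * sqabs (s x y) * sqn s y.
Proof.
rewrite sqnDE sqnN sqnZ ipNr ipZr (ip_sym x y).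
case: (s x y) => [a b]; rewrite /sqabs /=; ring.
Qed.

Lemma ip_CS x y : sqabs (s x y) <= sqn s x * sqn s y.
Proof.
apply: quad_bound; rewrite ?sqn_ge0 ?sqabs_ge0 // => t.
by rewrite -ip_quad sqn_ge0.
Qed.

Definition nrm x : R := Num.sqrt (sqn s x).

Lemma nrm_ge0 x : 0 <= nrm x. Proof. exact: sqrtr_ge0. Qed.

Lemma nrm_sqr x : nrm x ^+ 2 = sqn s x.
Proof. by rewrite sqr_sqrtr // sqn_ge0. Qed.

Lemma nrmN x : nrm (- x) = nrm x. Proof. by rewrite /nrm sqnN. Qed.

Lemma nrm0 : nrm 0 = 0. Proof. by rewrite /nrm sqn0 sqrtr0. Qed.

Lemma Re_ip_le x y : `|complex.Re (s x y)| <= nrm x * nrm y.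
Proof.
rewrite -ler_sqr ?nnegrE ?mulr_ge0 ?nrm_ge0 // exprMn !nrm_sqr.
rewrite real_normK ?num_real //; apply: le_trans (ip_CS x y).
by rewrite /sqabs lerDl sqr_ge0.
Qed.

Lemma nrmD x y : nrm (x + y) <= nrm x + nrm y.
Proof.
rewrite -ler_sqr ?nnegrE ?addr_ge0 ?nrm_ge0 // sqrrD !nrm_sqr sqnDE.
have := le_trans (ler_norm _) (Re_ip_le x y); rewrite mulr2n; lra.
Qed.

Lemma nrm_le_sqr x (M : R) : 0 <= M -> (nrm x <= M) = (sqn s x <= M ^+ 2).
Proof. by move=> M0; rewrite -nrm_sqr ler_sqr ?nnegrE ?nrm_ge0. Qed.

Lemma parallelogram x y :
  sqn s (x - y) = 2 * sqn s x + 2 * sqn s y - sqn s (x + y).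
Proof. rewrite !sqnDE sqnN ipNr raddfN /=; ring. Qed.

Lemma null_ip (u : nat -> V) y : null_for_ip s u -> ctends (fun n => s (u n) y) 0.
Proof.
move=> hu; apply: ctends_eps => e e0.
have yp : 0 < sqn s y + 1 by rewrite ltr_wpDl ?sqn_ge0.
have [N hN] := hu _ (divr_gt0 e0 yp); exists N => n Nn.
rewrite subr0; apply: le_lt_trans (ip_CS _ _) _.
have := hN _ Nn; rewrite ltr_pdivlMr //; have := sqn_ge0 s (u n); nra.
Qed.

Lemma cauchy_bounded (u : nat -> V) : cauchy_for_ip s u ->
  exists2 M : R, 0 < M & exists N, forall n, (N <= n)%N -> sqn s (u n) <= M.
Proof.
move=> hu; have [N hN] := hu 1 ltr01.
exists (2 * sqn s (u N) + 2); first by have := sqn_ge0 s (u N); lra.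
exists N => n Nn; have h := hN _ _ Nn (leqnn N).
have := sqnD s (u n - u N) (u N); rewrite subrK; lra.
Qed.

Lemma ip_ccvgn (u v : nat -> V) : cauchy_for_ip s u -> cauchy_for_ip s v ->
  ccvgn (fun n => s (u n) (v n)).
Proof.
move=> hu hv; have [M M0 [N1 hM]] := cauchy_bounded hu.
have [M' M'0 [N2 hM']] := cauchy_bounded hv.
have key (e : R) : 0 < e -> exists N, forall m n, (N <= m)%N -> (N <= n)%N ->
    sqabs (s (u m) (v m) - s (u n) (v n)) < e.
  move=> e0.
  have [N3 h3] := hu _ (divr_gt0 e0 (mulr_gt0 (ltr0n R 4) M'0)).
  have [N4 h4] := hv _ (divr_gt0 e0 (mulr_gt0 (ltr0n R 4) M0)).
  exists (maxn (maxn N1 N2) (maxn N3 N4)) => m n; rewrite !geq_max.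
  move=> /andP[/andP[m1 m2] /andP[m3 m4]] /andP[/andP[n1 n2] /andP[n3 n4]].
  have -> : s (u m) (v m) - s (u n) (v n) =
    s (u m - u n) (v m) + s (u n) (v m - v n) by rewrite ipBl ipBr; ring.
  apply: le_lt_trans (sqabsD _ _) _.
  have := ip_CS (u m - u n) (v m); have := ip_CS (u n) (v m - v n).
  have := h3 _ _ m3 n3; have := h4 _ _ m4 n4.
  rewrite !ltr_pdivlMr ?mulr_gt0 //.
  have := hM' _ m2; have := hM _ n1.
  have := sqn_ge0 s (u m - u n); have := sqn_ge0 s (v m - v n).
  have := sqn_ge0 s (v m); have := sqn_ge0 s (u n).
  move: (sqabs _) (sqabs _) => A B; move: (sqn _ _) (sqn _ _) (sqn _ _) (sqn _ _) => a b c g.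
  nra.
have cR (f : nat -> R) : (forall e : R, 0 < e -> exists N, forall m n,
    (N <= m)%N -> (N <= n)%N -> (f m - f n) ^+ 2 < e) -> cvgn f.
  move=> h; apply/cauchy_cvgP/cauchy_exP => e e0.
  have [N hN] := h _ (exprn_gt0 2 e0); exists (f N); exists N => //= n /= Nn.
  rewrite /ball /= -ltr_sqr ?nnegrE ?normr_ge0 1?ltW // real_normK ?num_real //.
  exact: hN.
split; apply: cR => e e0; have [N hN] := key _ e0; exists N => m n Nm Nn;
  apply: le_lt_trans (hN _ _ Nm Nn); rewrite /sqabs !raddfB /=.
  by rewrite lerDl sqr_ge0.
by rewrite lerDr sqr_ge0.
Qed.

End PreInnerTheory.

(** * Completion, Riesz representation, adjoints *)

Section CompletionTheory.
Variables (R : realType) (V : lmodType R[i]) (s : preInner V).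
Local Notation C := R[i].
Local Notation H := (completion s).
Implicit Types (x y z : V) (a b : C) (U W : cauchySeq s) (X Y Z : H).

Definition ccls U : H := (\pi_H U)%qT.

Lemma ccls_repr X : exists U, X = ccls U.
Proof. by exists (repr X); rewrite /ccls reprK. Qed.

Lemma cclsD U W : ccls (U + W) = ccls U + ccls W.
Proof. exact: clsD. Qed.

Lemma cclsZ a U : ccls (a *: U) = a *: ccls U.
Proof. exact: clsZ. Qed.

Lemma ccls_eq U W : null_for_ip s (fun n => U n - W n) -> ccls U = ccls W.
Proof. by move=> h; apply: cls_eq; rewrite unfold_in; exact: asboolT. Qed.

Lemma ccls_reprP U : null_for_ip s (fun n => repr (ccls U) n - U n).
Proof. by have /asboolW := cls_repr U. Qed.

Lemma null_ip_cauchy (u v : nat -> V) : null_for_ip s u -> cauchy_for_ip s v ->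
  ctends (fun n => s (u n) (v n)) 0.
Proof.
move=> hu /cauchy_bounded[M M0 [N1 hM]]; apply: ctends_eps => e e0.
have [N hN] := hu _ (divr_gt0 e0 M0); exists (maxn N1 N) => n.
rewrite geq_max => /andP[n1 n2]; rewrite subr0; apply: le_lt_trans (ip_CS _ _ _) _.
have := hN _ n2; rewrite ltr_pdivlMr //; have := hM _ n1.
have := sqn_ge0 s (u n); have := sqn_ge0 s (v n); nra.
Qed.

(** [cdot] is defined with the representatives chosen by [repr]. Changing representatives adds null
    sequences, whose products with Cauchy sequences tend to 0, so any representatives compute it. *)
Lemma cdot_ccls U W : ctends (fun n => s (U n) (W n)) (cdot (ccls U) (ccls W)).
Proof.
have h := ccvgn_ctends (ip_ccvgn (cseqP (repr (ccls U))) (cseqP (repr (ccls W)))).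
have /asboolW hU := cls_repr U; have /asboolW hW := cls_repr W.
have h1 := null_ip_cauchy hU (cseqP (repr (ccls W))).
have h2 := ctends_conj (null_ip_cauchy hW (cseqP U)).
have := ctendsB (ctendsB h h1) h2; rewrite rmorph0 !subr0; apply: eq_ctends => n.
have -> : (repr (\pi_(completion s) U)%qT - U : cauchySeq s) n =
   repr (ccls U) n - U n by [].
have -> : (repr (\pi_(completion s) W)%qT - W : cauchySeq s) n =
   repr (ccls W) n - W n by [].
by rewrite -ip_sym ipBl ipBr; ring.
Qed.

Lemma cdot_linr X a Y Z : cdot X (a *: Y + Z) = a * cdot X Y + cdot X Z.
Proof.
have [U ->] := ccls_repr X; have [W ->] := ccls_repr Y; have [T ->] := ccls_repr Z.
rewrite -cclsZ -cclsD; apply: ctends_unique (cdot_ccls _ _) _.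
have := ctendsD (ctendsZ a (cdot_ccls U W)) (cdot_ccls U T); apply: eq_ctends => n.
by rewrite -ip_linr.
Qed.

Lemma cdot_linl a X Y Z : cdot (a *: X + Y) Z = a^* * cdot X Z + cdot Y Z.
Proof.
have [U ->] := ccls_repr X; have [W ->] := ccls_repr Y; have [T ->] := ccls_repr Z.
rewrite -cclsZ -cclsD; apply: ctends_unique (cdot_ccls _ _) _.
have := ctendsD (ctendsZ a^* (cdot_ccls U T)) (cdot_ccls W T); apply: eq_ctends => n.
by rewrite -ip_linl.
Qed.

Lemma cdot_ge0 X : 0 <= cdot X X.
Proof.
have [U ->] := ccls_repr X; have h := cdot_ccls U U.
rewrite lecE; apply/andP; split; last first.
  by apply: ctends_le0 h _ => n; rewrite sqn_ge0.
apply/eqP; case: h => _ hi; rewrite -(cvg_lim _ hi) //.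
have -> : (fun n => complex.Im (s (U n) (U n))) = cst 0; last by rewrite lim_cst.
by apply/funext => n; rewrite ip_sqn.
Qed.

Definition cdotp : preInner H := PreInner cdot_linr cdot_linl cdot_ge0.

Lemma cdot_embed x y : cdot (embed s x) (embed s y) = s x y.
Proof.
apply: ctends_unique (cdot_ccls (CauchySeq (asboolT (cauchy_cst s x)))
  (CauchySeq (asboolT (cauchy_cst s y)))) _.
exact: ctends_cst.
Qed.

Lemma embed_lin a x y : embed s (a *: x + y) = a *: embed s x + embed s y.
Proof.
rewrite /embed /mkcauchy -/(ccls _) -/(ccls _) -/(ccls _) -cclsZ -cclsD.
by congr ccls; apply/val_inj.
Qed.

Lemma embed0 : embed s 0 = 0.
Proof. by have := embed_lin (-1) 0 0; rewrite scaler0 addr0 scaleN1r addNr. Qed.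

Lemma embed_sum (I : Type) (r : seq I) (P : pred I) (a : I -> C) (F : I -> V) :
  embed s (\sum_(i <- r | P i) a i *: F i) = \sum_(i <- r | P i) a i *: embed s (F i).
Proof.
elim: r => [|i r IH]; first by rewrite !big_nil embed0.
by rewrite !big_cons; case: ifP => // _; rewrite embed_lin IH.
Qed.

Lemma sqn_embed x : sqn cdotp (embed s x) = sqn s x.
Proof. by rewrite /sqn -cdot_embed. Qed.

Lemma embed_dense X (e : R) : 0 < e -> exists x, sqn cdotp (X - embed s x) < e.
Proof.
move=> e0; have [U ->] := ccls_repr X.
have [N hN] := cseqP U (divr_gt0 e0 (ltr0n R 2)); exists (U N).
have -> : ccls U - embed s (U N) =
    ccls (U - CauchySeq (asboolT (cauchy_cst s (U N)))).
  by rewrite cclsD -[in RHS]scaleN1r cclsZ scaleN1r.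
have h := ctends_shift (cdot_ccls (U - CauchySeq (asboolT (cauchy_cst s (U N))))
   (U - CauchySeq (asboolT (cauchy_cst s (U N))))).
apply: (@le_lt_trans _ _ (e / 2)); last by rewrite gtr_pMr // invf_lt1 ?ltr1n.
have hs (k : nat) u l : ctends u l -> ctends (fun n => u (n + k)%N : C) l.
  move=> hu; elim: k => [|k IH]; first by apply: eq_ctends hu => n; rewrite addn0.
  by apply: eq_ctends (ctends_shift IH) => n; rewrite addSnnS.
apply: ctends_Re_le (hs N _ _ (cdot_ccls _ _)) _ => n.
exact: ltW (hN _ _ (leq_addl _ _) (leqnn N)).
Qed.

Lemma sqn_completion_eq0 X : sqn cdotp X = 0 -> X = 0.
Proof.
have [U ->] := ccls_repr X => h.
have -> : 0 = ccls 0 by rewrite -[in RHS](scale0r 0) cclsZ scale0r.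
apply: cls_eq; rewrite subr0 unfold_in; apply: asboolT => e e0.
have := cdot_ccls U U; rewrite -[cdot _ _]/(cdotp _ _) ip_sqn h => -[/= hr _].
have /cvgrPdist_lt/(_ _ e0)[N _ hN] := hr.
exists N => n Nn; have := hN _ Nn; rewrite sub0r normrN /=.
by apply: le_lt_trans; exact: ler_norm.
Qed.

(** Extension by density. Only differences are involved, so it serves linear and conjugate-linear
    functionals alike. *)
Lemma embed_dense_eq (f : H -> C) (K : R) X : (forall Y, sqabs (f Y) <= K * sqn cdotp Y) ->
  (forall Y Z, f (Y - Z) = f Y - f Z) -> (forall x, f (embed s x) = 0) -> f X = 0.
Proof.
move=> fK fB f0; apply: sqabs0_eq0; apply/eqP; rewrite eq_le sqabs_ge0 andbT.
apply/ler_addgt0Pr => e e0; rewrite add0r.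
have K1 : 0 < `|K| + 1 by rewrite ltr_wpDl.
have [x hx] := embed_dense X (divr_gt0 e0 K1).
have -> : f X = f (X - embed s x) by rewrite fB f0 subr0.
apply: le_trans (fK _) _; move: hx; rewrite ltr_pdivlMr // => hx.
apply: le_trans (ltW hx); rewrite mulrC ler_wpM2l ?sqn_ge0 //.
by apply: le_trans (ler_norm _) _; rewrite lerDl.
Qed.

Lemma completion_eq X Y : (forall x, cdot (embed s x) X = cdot (embed s x) Y) -> X = Y.
Proof.
move=> h; apply/eqP; rewrite -subr_eq0; apply/eqP/sqn_completion_eq0.
suff /(_ (X - Y)) : forall Z, cdotp Z (X - Y) = 0 by rewrite /sqn => ->.
move=> Z; apply: (@embed_dense_eq (fun Z => cdotp Z (X - Y)) (sqn cdotp (X - Y))).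
- by move=> T; rewrite mulrC; exact: (ip_CS cdotp).
- by move=> T S; exact: (ipBl cdotp).
- by move=> x; rewrite (ipBr cdotp); apply/eqP; rewrite subr_eq0; exact/eqP/h.
Qed.

(* The representing vector is the limit of a minimizing sequence of
   [J x = |x|^2 - 2 Re (phi x)]; no completeness of the space of vectors is needed
   since the Cauchy sequence itself is a point of the completion. *)
Lemma riesz (phi : V -> C) (K : R) :
  (forall a x y, phi (a *: x + y) = a^* * phi x + phi y) ->
  (forall x, sqabs (phi x) <= K * sqn s x) ->
  exists X : H, forall x, cdot (embed s x) X = phi x.
Proof.
move=> phi_lin phiK.
have phiD x y : phi (x + y) = phi x + phi y.
  by rewrite -[x]scale1r phi_lin rmorph1 mul1r scale1r.
have phi0 : phi 0 = 0 by apply: (addrI (phi 0)); rewrite -phiD !addr0.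
have phiZ a x : phi (a *: x) = a^* * phi x.
  by rewrite -[a *: x]addr0 phi_lin phi0 addr0.
pose J x := sqn s x - 2 * complex.Re (phi x).
have Jlb x : - `|K| <= J x.
  have h1 := phiK x; have h2 := sqn_ge0 s x.
  have h3 : sqabs (phi x) <= `|K| * sqn s x.
    by apply: le_trans h1 _; rewrite ler_wpM2r // ler_norm.
  have h4 := normr_ge0 K.
  have h5 : complex.Re (phi x) ^+ 2 <= `|K| * sqn s x.
    by apply: le_trans h3; rewrite /sqabs lerDl sqr_ge0.
  have h6 : (2 * complex.Re (phi x)) ^+ 2 <= (sqn s x + `|K|) ^+ 2.
    have := sqr_ge0 (sqn s x - `|K|); nra.
  suff : 2 * complex.Re (phi x) <= sqn s x + `|K| by rewrite /J; lra.
  case: (lerP (2 * complex.Re (phi x)) 0) => h7; first by lra.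
  by rewrite -ler_sqr ?nnegrE ?(ltW h7) ?addr_ge0.
pose E := range J.
have Einf : has_inf E by split; [exists (J 0), 0|exists (- `|K|) => _ [x _ <-]].
have Jinf x : inf E <= J x by apply: ge_inf; [case: Einf|exists x].
have exx (n : nat) : exists x, J x < inf E + n.+1%:R^-1.
  have n0 : (0 : R) < n.+1%:R^-1 by rewrite invr_gt0 ltr0n.
  by have [_ [x _ <-] hx] := inf_adherent n0 Einf; exists x.
have [p hp] := choice exx.
(* Parallelogram law at the midpoint: the midpoint has [J] at least [inf E], so two near-minimizers
   are close to each other and [p] is Cauchy. *)
have Jpar x y : sqn s (x - y) = 2 * (J x + J y - 2 * J ((1 / 2)%:C *: (x + y))).
  rewrite parallelogram /J sqnZ phiZ phiD.
  have -> : complex.Re (((1 / 2)%:C)^* * (phi x + phi y)) =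
    (complex.Re (phi x) + complex.Re (phi y)) / 2.
    by case: (phi x) (phi y) => [? ?] [? ?] /=; rewrite oppr0; field.
  by rewrite /sqabs /= expr0n /= addr0; field.
have pc : cauchy_for_ip s p.
  move=> e e0; have [N hN] : exists N : nat, 4 * N.+1%:R^-1 < e.
    have [N hN] : exists N : nat, (4 / e) < N%:R.
      have h : 0 <= 4 / e by rewrite divr_ge0 // ltW.
      by have := archi_boundP h; exists (Num.bound (4 / e)).
    exists N; rewrite ltr_pdivrMr ?ltr0n //; move: hN; rewrite ltr_pdivrMr // => hN.
    by apply: lt_trans hN _; rewrite mulrC ltr_pM2l // ltr_nat.
  exists N => m n Nm Nn; rewrite Jpar.
  have im : m.+1%:R^-1 <= N.+1%:R^-1 :> R by rewrite lef_pV2 ?posrE ?ltr0n // ler_nat.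
  have jn : n.+1%:R^-1 <= N.+1%:R^-1 :> R by rewrite lef_pV2 ?posrE ?ltr0n // ler_nat.
  have hm : J (p m) < inf E + N.+1%:R^-1 by apply: lt_le_trans (hp m) _; rewrite lerD2l.
  have hn : J (p n) < inf E + N.+1%:R^-1 by apply: lt_le_trans (hp n) _; rewrite lerD2l.
  move: hm hn (Jinf ((1 / 2)%:C *: (p m + p n))) hN.
  move: (N.+1%:R^-1) (inf E) (J _) (J _) (J _) => a b c f g; lra.
exists (mkcauchy pc) => q.
have hd := cdot_ccls (CauchySeq (asboolT (cauchy_cst s q))) (CauchySeq (asboolT pc)).
move: hd; set L := cdot _ _ => hd.
rewrite -[LHS]/L; apply/eqP; rewrite -subr_eq0; apply/eqP/sqabs0_eq0/eqP.
rewrite eq_le sqabs_ge0 andbT -[leRHS](mul0r (sqn s q)).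
apply: quad_bound; rewrite ?sqabs_ge0 ?sqn_ge0 // => t.
(* Near-minimality of [p n] against the perturbation [p n + lam *: q] gives, in the limit, the
   quadratic of [quad_bound] with a = 0; hence [L - phi q] vanishes. *)
pose lam (n : nat) := - (t%:C * (L - phi q)).
have hj (n : nat) : 0 <= complex.Re ((n.+1%:R^-1)%:C + 2 * (lam n)^* * (s q (p n) - phi q))
    + sqabs (lam n) * sqn s q.
  have := Jinf (p n + lam n *: q); have := hp n; rewrite /J phiD phiZ sqnDE sqnZ ipZr.
  rewrite (ip_sym s q (p n)) /=.
  case: (lam n) (s q (p n)) (phi q) (phi (p n)) => [a b] [c e] [f g] [k l] /=.
  move: (sqabs _) (inf E) (n.+1%:R^-1) (sqn s (p n)) (sqn s q) => u1 u2 u3 u4 u5; nra.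
have h0 : ctends (fun n => (n.+1%:R^-1)%:C : C) 0.
  by split => /=; [exact: cvg_harmonic|exact: cvg_cst].
have hlim := ctendsD (ctendsD h0 (ctendsZ (2 * (lam 0%N)^*)
  (ctendsB hd (ctends_cst (phi q))))) (ctends_cst (sqabs (lam 0%N) * sqn s q)%:C).
have := ctends_le0 hlim _.
have -> : complex.Re (0 + 2 * (lam 0%N)^* * (L - phi q) + (sqabs (lam 0%N) * sqn s q)%:C)
   = 0 - 2 * t * sqabs (L - phi q) + t ^+ 2 * sqabs (L - phi q) * sqn s q.
  by rewrite /lam; case: (L - phi q) => [a b]; rewrite /sqabs /=; ring.
by apply=> n; rewrite raddfD /=; exact: hj.
Qed.

Definition cbounded (T : H -> H) : Prop :=
  exists K : R, forall X, sqn cdotp (T X) <= K * sqn cdotp X.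

(** Riesz represents [X |-> cdot (T X) Y] on the dense image of V, and density extends the relation
    to the completion. An adjoint thus exists, so the [xget] in [adj] does not fall back on its
    default. *)
Lemma adjP (T : H -> H) : (forall a X Y, T (a *: X + Y) = a *: T X + T Y) ->
  cbounded T -> forall X Y, cdot (T X) Y = cdot X (adj T Y).
Proof.
move=> Tlin [K TK].
have ex Y : exists Z, forall X, cdot (T X) Y = cdot X Z.
  have [Z hZ] : exists Z : H, forall x, cdot (embed s x) Z = cdot (T (embed s x)) Y.
    apply: (@riesz _ (K * sqn cdotp Y)) => [a x y|x].
      by rewrite embed_lin Tlin cdot_linl.
    apply: le_trans (ip_CS cdotp _ _) _; rewrite mulrAC ler_wpM2r ?sqn_ge0 //.
    by rewrite -sqn_embed; exact: TK.
  exists Z => X; apply/eqP; rewrite -subr_eq0; apply/eqP.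
  apply: (@embed_dense_eq (fun X => cdot (T X) Y - cdot X Z)
    (2 * (K * sqn cdotp Y) + 2 * sqn cdotp Z)).
  - move=> W; apply: le_trans (sqabsD _ _) _; rewrite sqabsN [leRHS]mulrDl -(mulrA 2 (K * _)) -(mulrA 2 (sqn _ _)).
    apply: lerD; rewrite ler_pM2l //.
      apply: le_trans (ip_CS cdotp _ _) _; rewrite [leRHS]mulrAC.
      by rewrite ler_wpM2r ?sqn_ge0.
    by apply: le_trans (ip_CS cdotp _ _) _; rewrite mulrC.
  - move=> W W'; have -> : T (W - W') = T W - T W'.
      by rewrite addrC -scaleN1r Tlin scaleN1r addrC.
    by rewrite [cdot (T W - _) Y](ipBl cdotp) [cdot (W - _) Z](ipBl cdotp) /=; ring.
  - by move=> x; rewrite hZ subrr.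
have [S hS] := choice ex.
rewrite /adj; case: xgetP => [_ -> //|nS].
by case: (nS S) => X Y; exact: hS.
Qed.

End CompletionTheory.

(** * Power series with a Hankel matrix of finite rank *)

Section Series.
Variables (F : fieldType) (T : eqType).
Local Notation series := (seq T -> F).
Implicit Types (f g h : series) (u v w : seq T).

(* The Hankel matrix with entries f (u ++ v) has finite rank. *)
Definition finrank f : Prop := exists s : seq (series * series),
  forall u v, f (u ++ v) = \sum_(p <- s) p.1 u * p.2 v.

Definition sconst (c : F) : series := fun w => if w is [::] then c else 0.

Definition svar (k : T) : series := fun w => if w is [:: j] then (j == k)%:R else 0.

(** The Cauchy product in non-commuting variables. Recursion on the first letter makes the left
    translates [fun u => f (k :: u)] appear, and these drive the rank arguments below. *)
Fixpoint sconv f g w : F :=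
  if w is k :: v then f [::] * g w + sconv (fun u => f (k :: u)) g v
  else f [::] * g [::].

Lemma sconvE f g w :
  sconv f g w = \sum_(i < (size w).+1) f (take i w) * g (drop i w).
Proof.
elim: w f => [|k w IH] f /=; first by rewrite big_ord_recl big_ord0 addr0.
by rewrite big_ord_recl /= IH.
Qed.

Lemma sconv_suml (I : Type) (r : seq I) (a : I -> F) (x : I -> series) g w :
  sconv (fun u => \sum_(i <- r) a i * x i u) g w =
  \sum_(i <- r) a i * sconv (x i) g w.
Proof.
rewrite sconvE; under eq_bigr do rewrite mulr_suml.
rewrite exchange_big; apply: eq_bigr => i _; rewrite sconvE mulr_sumr.
by apply: eq_bigr => j _; rewrite mulrA.
Qed.

Lemma eq_convl f f' g w : f =1 f' -> sconv f g w = sconv f' g w.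
Proof. by move=> /funext ->. Qed.

Lemma eq_convr_le f g g' w : (forall u, (size u <= size w)%N -> g u = g' u) ->
  sconv f g w = sconv f g' w.
Proof.
move=> e; rewrite !sconvE; apply: eq_bigr => i _; rewrite e //.
by rewrite size_drop leq_subr.
Qed.

(** The recursion for the inverse uses its values at all shorter suffixes through [sconv], so it is
    not structural in the word. The integer [n] is fuel, sufficient as soon as it exceeds the length
    of the word. *)
Fixpoint sinv_rec (f : series) (n : nat) : series :=
  if n is m.+1 then
    fun w => if w is k :: v
      then - (f [::])^-1 * sconv (fun u => f (k :: u)) (sinv_rec f m) v
      else (f [::])^-1
  else fun=> 0.

Lemma sinv_rec_stable f n m w : (size w < n)%N -> (size w < m)%N ->
  sinv_rec f n w = sinv_rec f m w.
Proof.
elim: n m w => // n IH [//|m] [|k w] //=; rewrite !ltnS => wn wm.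
congr (_ * _); apply: eq_convr_le => u us.
by apply: IH; exact: leq_ltn_trans us _.
Qed.

(* A right inverse of f for sconv, meaningless when f [::] = 0. *)
Definition sinv f : series := fun w => sinv_rec f (size w).+1 w.

Lemma sinv_cons f k w :
  sinv f (k :: w) = - (f [::])^-1 * sconv (fun u => f (k :: u)) (sinv f) w.
Proof.
rewrite -[LHS]/(- (f [::])^-1 * sconv _ (sinv_rec f (size w).+1) w).
by congr (_ * _); apply: eq_convr_le => u us; apply: sinv_rec_stable.
Qed.

Lemma sconv_sinv f : f [::] != 0 -> sconv f (sinv f) = sconst 1.
Proof.
move=> f0; apply/funext => -[|k w] /=; first by rewrite divff.
by rewrite sinv_cons mulrA mulrN divff // mulN1r addNr.
Qed.

Lemma finrank_const c : finrank (sconst c).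
Proof.
exists [:: (sconst c, sconst 1)] => -[|k u] [|j v]; rewrite big_seq1 /=;
  by rewrite ?mulr1 ?mulr0 ?mul0r.
Qed.

Lemma finrank_var k : finrank (svar k).
Proof.
exists [:: (sconst 1, svar k); (svar k, sconst 1)] => u v.
rewrite big_cons big_seq1 /=.
by case: u => [|i [|j u]] //=; case: v => [|l v] /=; rewrite ?(mul1r, mulr1, mulr0, mul0r, addr0, add0r).
Qed.

Lemma finrankD f g : finrank f -> finrank g -> finrank (fun w => f w + g w).
Proof. by move=> [s hs] [t ht]; exists (s ++ t) => u v; rewrite big_cat hs ht. Qed.

Lemma finrankZ c f : finrank f -> finrank (fun w => c * f w).
Proof.
move=> [s hs]; exists [seq ((fun u => c * p.1 u) : series, p.2) | p <- s] => u v.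
rewrite hs big_map mulr_sumr; apply: eq_bigr => p _; exact: mulrA.
Qed.

(** A cut of [u ++ v] falls either inside [v] (the end of [u] included) or strictly before the end
    of [u]. The decomposition of [f] separates u from v in the first kind, that of [g] in the
    second; [convl] collects the cuts of [u] that leave a nonempty right part. *)
Lemma finrank_sconv f g : finrank f -> finrank g -> finrank (sconv f g).
Proof.
move=> [s hs] [t ht].
pose convl := fix convl (f a : series) w : F :=
  if w is k :: v then f [::] * a w + convl (fun u => f (k :: u)) a v else 0.
have key (e : series) u v : sconv e g (u ++ v) =
    sconv (fun w => e (u ++ w)) g v + \sum_(p <- t) convl e p.1 u * p.2 v.
  elim: u e => [|k u IH] e /=.
    by rewrite big1 ?addr0 // => p _; rewrite mul0r.
  rewrite IH (ht (k :: u)) mulr_sumr addrCA -big_split /=; congr (_ + _).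
  by apply: eq_bigr => p _; rewrite mulrDl mulrA.
exists ([seq (p.1, sconv p.2 g) | p <- s] ++ [seq ((convl f p.1) : series, p.2) | p <- t]).
move=> u v; rewrite big_cat !big_map key /=; congr (_ + _).
rewrite -(sconv_suml s (fun p => p.1 u) (fun p => p.2)).
by apply: eq_convl => w; exact: hs.
Qed.

(** Every left translate of [g] is a multiple of [g] plus [sconv e g] with [e] a combination of left
    translates of [f]: by [sinv_cons], this class survives the removal of one more letter. Since the
    translates of [f] span a finite-dimensional space, so do those of [g]. *)
Lemma finrank_sinv f : f [::] != 0 -> finrank f -> finrank (sinv f).
Proof.
move=> f0 [s hs]; set g := sinv f.
(* A combination of left translates of [f] is kept as a list of coefficients and words, so that
   [choice] can select one for each [u]. *)
pose comb (L : seq (F * seq T)) : series := fun w => \sum_(p <- L) p.1 * f (p.2 ++ w).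
have step u : forall L, exists L', forall v, sconv (comb L) g (u ++ v) = sconv (comb L') g v.
  elim: u => [|k u IH] L; first by exists L.
  have [L' hL'] := IH ((- comb L [::] * (f [::])^-1, [:: k]) ::
                       [seq (p.1, rcons p.2 k) | p <- L]).
  exists L' => v; rewrite -hL' /= /g sinv_cons -/g.
  have -> : sconv (comb ((- comb L [::] * (f [::])^-1, [:: k]) ::
      [seq (p.1, rcons p.2 k) | p <- L])) g (u ++ v) =
    - comb L [::] * (f [::])^-1 * sconv (fun w => f (k :: w)) g (u ++ v) +
    sconv (fun w => comb L (k :: w)) g (u ++ v).
    rewrite /comb sconv_suml big_cons big_map /=; congr (_ + _).
    rewrite sconv_suml; apply: eq_bigr => p _; congr (_ * _).
    by apply: eq_convl => w; rewrite cat_rcons.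
  by rewrite mulrA mulNr mulrN.
have dec u : exists cL : F * seq (F * seq T), forall v,
    g (u ++ v) = cL.1 * g v + sconv (comb cL.2) g v.
  case: u => [|k u].
    exists (1, [::]) => v /=; rewrite mul1r.
    have -> : comb [::] = fun w => \sum_(i <- [::] : seq unit) 0 * 0 :> F.
      by apply/funext => w; rewrite /comb !big_nil.
    by rewrite (sconv_suml [::] (fun _ : unit => 0) (fun=> fun=> 0)) big_nil addr0.
  have [L hL] := step u [:: (- (f [::])^-1, [:: k])].
  exists (0, L) => v /=; rewrite mul0r add0r -hL /g sinv_cons.
  by rewrite /comb sconv_suml big_seq1 /=.
have [c hc] := choice dec.
exists ((fun u => (c u).1, g) ::
  [seq ((fun u => \sum_(q <- (c u).2) q.1 * p.1 q.2), sconv p.2 g) | p <- s]) => u v.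
rewrite hc big_cons big_map /=; congr (_ + _).
rewrite /comb sconv_suml; under [RHS]eq_bigr do rewrite mulr_suml.
rewrite exchange_big; apply: eq_bigr => q _ /=.
rewrite (@eq_convl _ (fun w => \sum_(p <- s) p.1 q.2 * p.2 w)); last by move=> w; exact: hs.
rewrite sconv_suml mulr_sumr; apply: eq_bigr => p _; exact: mulrA.
Qed.

Lemma finrank_rev f : finrank f -> finrank (fun w => f (rev w)).
Proof.
move=> [s hs].
exists [seq ((fun u => p.2 (rev u)), fun v => p.1 (rev v)) | p <- s] => u v.
by rewrite rev_cat hs big_map; apply: eq_bigr => p _; rewrite mulrC.
Qed.

Definition hankel r (f : series) (x y : 'I_r -> seq T) : 'M[F]_r :=
  \matrix_(p, q) f (x p ++ y q).

(* Skeleton factorization: take an invertible finite section of the Hankel matrix of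
   maximal size and expand the determinants that border it. *)
Lemma hankel_skeleton f : finrank f -> exists r (x y : 'I_r -> seq T),
  hankel f x y \in unitmx /\
  forall u v, f (u ++ v) = \sum_p \sum_q
    f (u ++ y q) * invmx (hankel f x y) q p * f (x p ++ v).
Proof.
move=> [s hs].
pose P r := `[< exists x y : 'I_r -> seq T, hankel f x y \in unitmx >].
have P0 : exists r, P r.
  exists 0%N; apply/asboolP; exists (fun=> [::]), (fun=> [::]).
  by rewrite unitmxE det_mx00 unitr1.
have Pmax r : P r -> (r <= size s)%N.
  move=> /asboolP[x [y]]; rewrite -row_full_unit -col_leq_rank => /leq_trans; apply.
  have -> : hankel f x y = (\matrix_(p < r, i < size s) (s`_i).1 (x p)) *m
      (\matrix_(i < size s, q < r) (s`_i).2 (y q)).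
    apply/matrixP => p q; rewrite !mxE hs (big_nth 0) big_mkord.
    by apply: eq_bigr => i _; rewrite !mxE.
  exact: leq_trans (mxrankM_maxl _ _) (rank_leq_col _).
case: (ex_maxnP P0 Pmax) => r /asboolP[x [y H0u]] rmax.
exists r, x, y; split=> // u v; set H0 := hankel f x y in H0u *.
pose ro : 'rV_r := \row_q f (u ++ y q); pose co : 'cV_r := \col_p f (x p ++ v).
pose sc : 'M[F]_1 := (f (u ++ v))%:M.
have -> : \sum_p \sum_q f (u ++ y q) * invmx H0 q p * f (x p ++ v) =
   (ro *m invmx H0 *m co) 0 0.
  rewrite mxE; apply: eq_bigr => p _; rewrite !mxE mulr_suml.
  by apply: eq_bigr => q _; rewrite !mxE.
apply/eqP; rewrite -subr_eq0; apply/negP => /negP nz.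
(* The Schur complement of [H0] in the section bordered by [u] and [v]. If it were nonzero, the
   bordered section would be invertible of size r + 1, against maximality. *)
pose D : 'M[F]_1 := sc - ro *m invmx H0 *m co.
have Du : D \in unitmx by rewrite unitmxE det_mx11 !mxE eqxx mulr1n unitfE; rewrite !mxE in nz.
suff /rmax : P (r + 1)%N by rewrite addn1 ltnn.
apply/asboolP; exists (fun i => match fintype.split i with inl p => x p | inr _ => u end).
exists (fun i => match fintype.split i with inl p => y p | inr _ => v end).
have -> : hankel f (fun i => match fintype.split i with inl p => x p | inr _ => u end)
    (fun i => match fintype.split i with inl p => y p | inr _ => v end) =
    block_mx 1%:M 0 (ro *m invmx H0) 1%:M *m block_mx H0 co 0 D.
  rewrite mulmx_block !mul1mx !mul0mx !addr0 mulmxKV // [ro *m _ *m co + _]addrC subrK.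
  have eL (p : 'I_r) : fintype.split (lshift 1 p) = inl p := unsplitK (inl p).
  have eR (p : 'I_1) : fintype.split (rshift r p) = inr p := unsplitK (inr p).
  apply/matrixP => i j; rewrite -[ i ]splitK -[ j ]splitK.
  case: (fintype.split i) => p; case: (fintype.split j) => q /=;
    rewrite ?block_mxEul ?block_mxEur ?block_mxEdl ?block_mxEdr mxE !(eL, eR) !mxE //.
  by rewrite !ord1 eqxx mulr1n.
rewrite unitmx_mul !unitmxE det_lblock det_ublock !det1 mul1r unitr1 /=.
by rewrite unitrM -!unitmxE H0u.
Qed.

Definition mxword n (Z : T -> 'M[F]_n) w : 'M[F]_n :=
  foldr (fun k M => Z k *m M) 1%:M w.

(** [A k] is the Hankel section shifted by the letter k, times the inverse of the unshifted section;
    the skeleton factorization makes the shifted sections multiplicative in the word. The last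
    conclusion keeps the entries of [A^w] tied to values of [f], from which the decay on the ball is
    deduced. *)
Lemma realization f : finrank f ->
  exists r (A : T -> 'M[F]_r) (gam : 'rV[F]_r) (bet : 'cV[F]_r)
    (x y : 'I_r -> seq T) (G : 'M[F]_r),
  (forall w, f w = (gam *m mxword A w *m bet) 0 0) /\
  (forall w p q, mxword A w p q = \sum_s f (x p ++ w ++ y s) * G s q).
Proof.
move=> /hankel_skeleton[r [x [y [Hu hf]]]]; set G := invmx _ in hf.
pose M w : 'M[F]_r := (\matrix_(p, q) f (x p ++ w ++ y q)) *m G.
pose ro u : 'rV[F]_r := \row_q f (u ++ y q).
pose co v : 'cV[F]_r := \col_p f (x p ++ v).
have fE u v : f (u ++ v) = (ro u *m G *m co v) 0 0.
  rewrite hf mxE; apply: eq_bigr => p _; rewrite !mxE mulr_suml.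
  by apply: eq_bigr => q _; rewrite !mxE.
have rowE u p : ro (x p ++ u) = row p (\matrix_(p, q) f (x p ++ u ++ y q)).
  by apply/matrixP => i q; rewrite !mxE catA.
have M0 : M [::] = 1%:M by rewrite -[RHS](mulmxV Hu).
have Mcons k w : M (k :: w) = M [:: k] *m M w.
  rewrite /M mulmxA; congr (_ *m _); apply/matrixP => p q; rewrite mxE.
  have -> : x p ++ (k :: w) ++ y q = (x p ++ [:: k]) ++ (w ++ y q).
    by rewrite -catA cat1s.
  rewrite fE rowE [RHS]mxE mxE; apply: eq_bigr => t _; congr (_ * _).
    by rewrite -row_mul mxE.
  by rewrite !mxE.
have MA w : mxword (fun k => M [:: k]) w = M w.
  by elim: w => [|k w IH]; [rewrite M0|rewrite (Mcons k w) -IH].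
exists r, (fun k => M [:: k]), (ro [::] *m G), (co [::]), x, y, G.
split=> w; last by move=> p q; rewrite MA mxE; apply: eq_bigr => s _; rewrite mxE.
rewrite MA -[in LHS](cat0s w) fE -[RHS]/(((ro [::] *m G) *m M w *m co [::]) 0 0).
rewrite -(mulmxA _ (M w)); suff -> : co w = M w *m co [::] by [].
apply/matrixP => p j; rewrite ord1 mxE -[in LHS](cats0 w) catA fE rowE /M.
by rewrite -row_mul -row_mul mxE.
Qed.

End Series.

(** * The GNS space and the moments *)

Section Monomials.
Variables (K : monomType) (F : comNzRingType).
Implicit Types (k m : K) (a : F) (p : {malg F[K]}).

Lemma malgU_scale k a p : << k >> * (a *: p) = a *: (<< k >> * p).
Proof.
have e : << k >> * a%:MP = a%:MP * << k >> :> {malg F[K]}.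
  by rewrite !malgM_def !fgmulUU mulr1 mul1r mul1m mulm1.
by rewrite -!mul_malgC !mulrA e.
Qed.

Lemma malgU_mulA k m p : << mmul k m >> * p = << k >> * (<< m >> * p).
Proof. by rewrite mulrA; congr (_ * _); rewrite malgM_def fgmulUU mul1r. Qed.

Lemma malgU_mul k m : << mmul k m >> = << k >> * << m >> :> {malg F[K]}.
Proof. by rewrite malgM_def fgmulUU mul1r. Qed.

Lemma malg_sumU p : p = \sum_(m <- msupp p) p@_m *: << m >>.
Proof.
rewrite [LHS]monalgE; apply: eq_bigr => m _.
by rewrite -(mul_malgC p@_m << m >>) malgM_def fgmulUU mulr1 mul1m.
Qed.

End Monomials.

Section GNSTheory.
Variables (R : realType) (d : nat) (mu : ncMeasure R d).
Local Notation C := R[i].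
Local Notation fpoly := {malg C[{fmonom 'I_d}]}.
Local Notation word := (seq 'I_d).
Local Notation H := (gns mu).
Local Notation S := (gns_ip mu).
Implicit Types (u v w : word) (X Y : H).

Definition zmon w : fpoly := << FMonom w >>.

Lemma FMonom_cat u v : FMonom (u ++ v) = mmul (FMonom u) (FMonom v).
Proof. by apply/val_inj; rewrite /= fmM. Qed.

Lemma zmon_cat u v : zmon (u ++ v) = zmon u * zmon v.
Proof. by rewrite /zmon FMonom_cat; exact: malgU_mul. Qed.

Lemma zmon_cons_mul k w (p : fpoly) : zmon (k :: w) * p = << fmu k >> * (zmon w * p).
Proof. by rewrite /zmon -cat1s FMonom_cat -fmuE; exact: malgU_mulA. Qed.

Lemma zmon_nil : zmon [::] = 1.
Proof. by rewrite /zmon -fmoneE. Qed.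

Lemma fpoly_zmon (p : fpoly) : p = \sum_(m <- msupp p) p@_m *: zmon m.
Proof.
rewrite [LHS]malg_sumU; apply: eq_bigr => m _; rewrite /zmon fmK; exact: erefl.
Qed.

Lemma fmu_scale k a (p : fpoly) : << fmu k >> * (a *: p) = a *: (<< fmu k >> * p).
Proof. exact: malgU_scale. Qed.

(* This is mu of the adjoint of L^w, the complex conjugate of mu (L^w). *)
Definition moment w : C := mu_form mu (zmon w) 1.

Lemma gns_shift_ccls k (U W : cauchySeq S) : (forall n, W n = << fmu k >> * U n) ->
  gns_shift k (ccls U) = ccls W.
Proof.
move=> hW; apply: ccls_eq => e e0; have [N hN] := ccls_reprP U e0.
exists N => n Nn; rewrite /= hW -mulrBr sqn_shift; exact: hN.
Qed.

Lemma gns_shift_ex k (U : cauchySeq S) : exists2 W : cauchySeq S,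
  gns_shift k (ccls U) = ccls W & forall n, W n = << fmu k >> * U n.
Proof.
exists (CauchySeq (asboolT (cauchy_shift k U))) => //.
exact: gns_shift_ccls.
Qed.

Lemma gns_shift_lin k a X Y :
  gns_shift k (a *: X + Y) = a *: gns_shift k X + gns_shift k Y.
Proof.
have [U ->] := ccls_repr X; have [W ->] := ccls_repr Y.
have [U' -> hU] := gns_shift_ex k U; have [W' -> hW] := gns_shift_ex k W.
rewrite -!cclsZ -!cclsD; apply: gns_shift_ccls => n.
have -> : (a *: U' + W') n = a *: U' n + W' n by [].
have -> : (a *: U + W) n = a *: U n + W n by [].
by rewrite mulrDr fmu_scale hU hW.
Qed.

Lemma sqn_gns_shift k X : sqn (cdotp S) (gns_shift k X) = sqn (cdotp S) X.
Proof.
have [U ->] := ccls_repr X; have [W -> hW] := gns_shift_ex k U.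
rewrite /sqn; congr complex.Re; apply: ctends_unique (cdot_ccls _ _) _.
have := cdot_ccls U U; apply: eq_ctends => n.
by rewrite !hW; apply/esym; exact: mu_form_shift.
Qed.

Lemma gns_word_lin w a X Y : gns_word w (a *: X + Y) = a *: gns_word w X + gns_word w Y.
Proof. by elim: w => //= k w ->; rewrite gns_shift_lin. Qed.

Lemma sqn_gns_word w X : sqn (cdotp S) (gns_word w X) = sqn (cdotp S) X.
Proof. by elim: w => [//|k w IH]; rewrite -[RHS]IH; apply: sqn_gns_shift. Qed.

Lemma gns_word_vec w p : gns_word w (gns_vec mu p) = gns_vec mu (zmon w * p).
Proof.
elim: w => [|k w IH] /=; first by rewrite zmon_nil mul1r.
have h1 := congr1 (gns_shift k) IH.
have h2 := gns_shift_vec mu k (zmon w * p).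
have h3 := congr1 (gns_vec mu) (esym (zmon_cons_mul k w p)).
by apply: etrans h1 _; apply: etrans h2 _; exact: h3.
Qed.

Definition back_vec w : H := adj (gns_word w) (gns_vec mu 1).

Lemma cdot_back_vec u w : cdot (gns_vec mu (zmon u)) (back_vec w) = moment (w ++ u).
Proof.
rewrite /back_vec -adjP; last by exists 1 => X; rewrite sqn_gns_word mul1r.
  by rewrite gns_word_vec -zmon_cat cdot_embed.
exact: gns_word_lin.
Qed.

Lemma gns_eq X Y : (forall u, cdot (gns_vec mu (zmon u)) X = cdot (gns_vec mu (zmon u)) Y) ->
  X = Y.
Proof.
move=> h; apply: completion_eq => p; rewrite [p]fpoly_zmon embed_sum.
rewrite [LHS](ip_suml (cdotp S)) [RHS](ip_suml (cdotp S)).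
apply: eq_bigr => m _; rewrite !(ipZl (cdotp S)); congr (_ * _).
exact: h.
Qed.

Lemma H_mu_back_vec w : H_mu (back_vec w).
Proof.
move=> e e0; exists 1%N, (fun=> 1), (fun=> back_vec w); split; first by move=> _; exists w.
rewrite big_ord1 scale1r subrr /cnorm; have := sqn0 (cdotp S); rewrite /sqn => ->.
by rewrite sqrtr0.
Qed.

(** Orthogonality passes to limits of combinations by Cauchy-Schwarz; the tolerance [eW] below is
    scaled by the length of [W]. *)
Lemma cdot_H_mu W X : (forall w, cdot W (back_vec w) = 0) -> H_mu X -> cdot W X = 0.
Proof.
move=> h hX; apply: sqabs0_eq0; apply/eqP; rewrite eq_le sqabs_ge0 andbT.
apply/ler_addgt0Pr => e e0; rewrite add0r.
have W1 : 0 < sqn (cdotp S) W + 1 by rewrite ltr_wpDl ?sqn_ge0.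
have eW : 0 < Num.sqrt (e / (sqn (cdotp S) W + 1)) by rewrite sqrtr_gt0 divr_gt0.
have [n [c [v [hv hlt]]]] := hX _ eW.
set Y := \sum_(i < n) c i *: v i in hlt.
have WY : cdotp S W Y = 0.
  rewrite /Y ip_sumr big1 // => i _; have [w _ <-] := hv i.
  by rewrite ipZr [cdotp _ _ _](h w) mulr0.
have -> : cdot W X = cdotp S W (X - Y) by rewrite ipBr WY subr0.
apply: le_trans (ip_CS _ _ _) _.
move: hlt; rewrite /cnorm ltr_sqrt ?divr_gt0 // ltr_pdivlMr // -/(sqn (cdotp S) _) => hlt.
apply: le_trans (ltW hlt); rewrite mulrC ler_wpM2l ?sqn_ge0 //.
by rewrite lerDl.
Qed.

Lemma finitely_correlatedP : finitely_correlated mu <-> finrank moment.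
Proof.
split=> [[n [v hv]]|fr].
  have /choice[c hc] : forall w, exists c : 'I_n -> C, back_vec w = \sum_(i < n) c i *: v i.
    by move=> w; apply: hv; exact: H_mu_back_vec.
  exists [seq ((fun w => c w i), (fun u => cdot (gns_vec mu (zmon u)) (v i))) | i <- enum 'I_n].
  move=> w u; rewrite big_map big_enum -cdot_back_vec hc [LHS](ip_sumr (cdotp S)) /=.
  by apply: eq_bigr => i _; exact: (ipZr (cdotp S)).
have [r [x [y [_ hm]]]] := hankel_skeleton fr; set G := invmx _ in hm.
exists r, (fun p => back_vec (x p)) => X hX.
exists (fun p => \sum_q cdot (gns_vec mu (zmon (y q))) X * G q p).
apply: gns_eq => u; rewrite [RHS](ip_sumr (cdotp S)).
(* By the skeleton factorization [W] is orthogonal to all back vectors, hence to [H_mu]. This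
   carries their finite expansion over to the closed span without a proof that finite-dimensional
   subspaces are closed. *)
pose W : H := gns_vec mu (zmon u) - \sum_p \sum_q (G q p * moment (x p ++ u))^* *:
   gns_vec mu (zmon (y q)).
have WE Y : cdot W Y = cdot (gns_vec mu (zmon u)) Y -
    \sum_p (\sum_q cdot (gns_vec mu (zmon (y q))) Y * G q p) * moment (x p ++ u).
  rewrite [LHS](ipBl (cdotp S)) ip_suml; congr (_ - _); apply: eq_bigr => p _.
  rewrite ip_suml mulr_suml; apply: eq_bigr => q _.
  by rewrite ipZl conjCK mulrC mulrA.
suff /cdot_H_mu/(_ hX) : forall w, cdot W (back_vec w) = 0.
  rewrite WE => /eqP; rewrite subr_eq0 => /eqP ->; apply: eq_bigr => p _.
  by rewrite -cdot_back_vec; apply/esym/(ipZr (cdotp S)).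
move=> w; rewrite WE cdot_back_vec hm; apply/eqP; rewrite subr_eq0; apply/eqP.
apply: eq_bigr => p _; rewrite mulr_suml; apply: eq_bigr => q _.
by rewrite cdot_back_vec.
Qed.

End GNSTheory.

(** * Rational expressions regular at 0 *)

Section RationalExpressions.
Variables (R : realType) (d : nat).
Local Notation C := R[i].
Local Notation word := (seq 'I_d).
Local Notation rexpr := (rexpr R d).
Implicit Types (r : rexpr).

(** A unital morphism sends inverses to inverses, so domains are preserved. Applied to the
    amplifications [1 (x) M] and [M (x) 1]. *)
Lemma reval_morph n m (phi : 'M[C]_n -> 'M[C]_m) (Z : 'I_d -> 'M[C]_n) r :
  (forall A B, phi (A + B) = phi A + phi B) ->
  (forall A B, phi (A *m B) = phi A *m phi B) ->
  (forall c, phi c%:M = c%:M) -> rdom Z r ->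
  rdom (phi \o Z) r /\ reval (phi \o Z) r = phi (reval Z r).
Proof.
move=> phiD phiM phiC; elim: r => [j|c|r1 IH1 r2 IH2|r1 IH1 r2 IH2|r IH] //=.
- by move=> /andP[/IH1[-> ->] /IH2[-> ->]].
- by move=> /andP[/IH1[-> ->] /IH2[-> ->]].
move=> /andP[/IH[-> ->] u] /=.
have e : phi (reval Z r) *m phi (invmx (reval Z r)) = 1%:M by rewrite -phiM mulmxV.
have [u' _] := mulmx1_unit e; split=> //.
by rewrite -[RHS](mulKmx u') e mulmx1.
Qed.

Lemma poly_pointwise0 (p : {poly C}) : (forall t, p.[t] = 0) -> p = 0.
Proof.
move=> h; apply/eqP; apply/negPn/negP => p0.
have := max_poly_roots p0 (rs := [seq (i%:R : C) | i <- iota 0 (size p)]).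
rewrite size_map size_iota ltnn => H; apply/notF/H.
  by apply/allP => x _; apply/rootP.
rewrite map_inj_uniq ?iota_uniq // => i j /eqP.
by rewrite eqr_nat => /eqP.
Qed.

(* Along a line the value of an expression is P / q, and q vanishes exactly off its domain. *)
Lemma reval_pencil m (A B : 'I_d -> 'M[C]_m) r :
  exists (q : {poly C}) (P : 'M[{poly C}]_m), forall t : C,
    rdom (fun k => A k + t *: B k) r = (q.[t] != 0) /\
    (q.[t] != 0 -> q.[t] *: reval (fun k => A k + t *: B k) r = map_mx (horner_eval t) P).
Proof.
elim: r => [j|c|r1 [q1 [P1 h1]] r2 [q2 [P2 h2]]|r1 [q1 [P1 h1]] r2 [q2 [P2 h2]]|r [q [P h]]].
- exists 1, (map_mx polyC (A j) + 'X *: map_mx polyC (B j)) => t /=.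
  rewrite hornerC oner_eq0; split => // _; rewrite scale1r.
  by apply/matrixP => i k; rewrite !mxE /horner_eval !hornerE.
- exists 1, (c%:P)%:M => t /=; rewrite hornerC oner_eq0; split => // _.
  rewrite scale1r; apply/matrixP => i k; rewrite !mxE /horner_eval hornerMn hornerC //.
- exists (q1 * q2), (q2 *: P1 + q1 *: P2) => t /=; rewrite hornerM mulf_eq0 negb_or.
  have [-> e1] := h1 t; have [-> e2] := h2 t; split=> // /andP[n1 n2].
  rewrite map_mxD !map_mxZ /= /horner_eval -e1 // -e2 // scalerDr !scalerA.
  by rewrite [q2.[t] * _]mulrC.
- exists (q1 * q2), (P1 *m P2) => t /=; rewrite hornerM mulf_eq0 negb_or.
  have [-> e1] := h1 t; have [-> e2] := h2 t; split=> // /andP[n1 n2].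
  by rewrite map_mxM -e1 // -e2 // -scalemxAl -scalemxAr scalerA.
(* For the value E = P / q, Cramer's rule gives E^-1 = q adj(P) / det P. Keeping the factor q in the
   denominator records the domain of the inner expression. *)
exists (q * \det P), (q ^+ 2 *: \adj P) => t /=; rewrite hornerM mulf_eq0 negb_or.
have [-> e] := h t; set E := reval _ r in e *.
have detE : (\det P).[t] = \det (map_mx (horner_eval t) P).
  by rewrite det_map_mx.
have dom : (q.[t] != 0) -> (E \in unitmx) = ((\det P).[t] != 0).
  move=> qt; rewrite detE -(e qt) -unitfE -unitmxE unitmxZ ?unitfE //.
split; first by case: (q.[t] != 0) dom => // /(_ isT).
move=> /andP[qt dt]; rewrite map_mxZ /= map_mx_adj -(e qt) detE -(e qt).
have Eu : E \in unitmx by rewrite dom.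
have hadj := mul_adj_mx (q.[t] *: E).
have -> : \adj (q.[t] *: E) = (q.[t]^-1 * \det (q.[t] *: E)) *: invmx E.
  rewrite -[LHS](mulmxK Eu) -[\adj _ *m E](scalerK qt) scalemxAr hadj.
  by rewrite -scalemxAl mul_scalar_mx scalerA.
by rewrite scalerA /horner_eval horner_exp mulrA expr2 mulfK.
Qed.

(* Two expressions equivalent to a valid r agree wherever both are defined, even at sizes
   where the domain of r is empty: amplify both the given point and a point of the domain of
   r to a common size and let the first approach the second along a line. *)
Lemma requiv_at r r1 r2 n (Z : 'I_d -> 'M[C]_n) : rvalid r -> requiv r r1 -> requiv r r2 ->
  (0 < n)%N -> rdom Z r1 -> rdom Z r2 -> reval Z r1 = reval Z r2.
Proof.
move=> [N [W [N0 Wr]]] rr1 rr2 n0 Z1 Z2.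
pose phi (M : 'M[C]_n) : 'M[C]_(N * n) := tensmx (1%:M : 'M[C]_N) M.
pose psi (M : 'M[C]_N) : 'M[C]_(N * n) := tensmx M (1%:M : 'M[C]_n).
have sc11 : tensmx (1%:M : 'M[C]_N) (1%:M : 'M[C]_n) = 1%:M.
  apply/matrixP => i j; case: (mxtens_indexP i) => i1 i2; case: (mxtens_indexP j) => j1 j2.
  rewrite tensmxE !mxE -natrM; congr (_ *+ _).
  by rewrite (can_eq (@mxtens_indexK _ _)) xpair_eqE mulnb.
have hphi r' : rdom Z r' -> rdom (phi \o Z) r' /\ reval (phi \o Z) r' = phi (reval Z r').
  apply: reval_morph => [M M'|M M'|c].
  - by apply/matrixP => i j; rewrite !mxE mulrDr.
  - by rewrite /phi tensmx_mul mulmx1.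
  - rewrite -[c%:M in RHS]scalemx1 -sc11 -[c%:M]scalemx1; apply/matrixP => i j.
    by rewrite !mxE mulrCA.
have hpsi : rdom (psi \o W) r /\ reval (psi \o W) r = psi (reval W r).
  apply: reval_morph Wr => [M M'|M M'|c].
  - by apply/matrixP => i j; rewrite !mxE mulrDl.
  - by rewrite /psi tensmx_mul mulmx1.
  - rewrite -[c%:M in RHS]scalemx1 -sc11 -[c%:M]scalemx1; apply/matrixP => i j.
    by rewrite !mxE mulrA.
have [d1 e1] := hphi _ Z1; have [d2 e2] := hphi _ Z2; have [dr _] := hpsi.
suff e : reval (phi \o Z) r1 = reval (phi \o Z) r2.
  apply/matrixP => i j; move: e; rewrite e1 e2 => /matrixP/(_
    (mxtens_index (Ordinal N0, i)) (mxtens_index (Ordinal N0, j))).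
  by rewrite !tensmxE !mxE eqxx !mul1r.
pose A k := phi (Z k); pose B k := psi (W k) - phi (Z k).
have [q [P h]] := reval_pencil A B r.
have [q1 [P1 h1]] := reval_pencil A B r1.
have [q2 [P2 h2]] := reval_pencil A B r2.
have A0 : (fun k => A k + 0 *: B k) = phi \o Z.
  by apply/funext => k; rewrite scale0r addr0.
have A1 : (fun k => A k + 1 *: B k) = psi \o W.
  by apply/funext => k; rewrite scale1r /A /B addrC subrK.
have [hd1 hv1] := h1 0; have [hd2 hv2] := h2 0; have [hd _] := h 1.
rewrite A0 in hd1 hv1 hd2 hv2; rewrite A1 in hd.
have n1 : q1.[0] != 0 by rewrite -hd1.
have n2 : q2.[0] != 0 by rewrite -hd2.
have q0 : q.[1] != 0 by rewrite -hd.
have pn0 (p : {poly C}) x : p.[x] != 0 -> p != 0.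
  by apply: contraNneq => ->; rewrite horner0.
(* The cross-multiplied equality holds wherever q q1 q2 is nonzero, and that product is a nonzero
   polynomial because [q.[1]], [q1.[0]] and [q2.[0]] are nonzero. Evaluating at 0 returns to the
   given point. *)
have key : q2 *: P1 = q1 *: P2.
  apply/matrixP => i j; apply/eqP; rewrite -subr_eq0.
  suff : (q * q1 * q2) * ((q2 *: P1) i j - (q1 *: P2) i j) == 0.
    by rewrite mulf_eq0 !mulf_eq0 (negbTE (pn0 _ _ q0)) (negbTE (pn0 _ _ n1))
      (negbTE (pn0 _ _ n2)).
  apply/eqP/poly_pointwise0 => t; rewrite hornerM.
  have [qt|qt] := eqVneq (q * q1 * q2).[t] 0; first by rewrite qt mul0r.
  suff -> : ((q2 *: P1) i j - (q1 *: P2) i j).[t] = 0 by rewrite mulr0.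
  move: qt; rewrite !hornerM !mulf_eq0 !negb_or -andbA => /and3P[qt q1t q2t].
  have [gd _] := h t; have [gd1 gv1] := h1 t; have [gd2 gv2] := h2 t.
  rewrite qt in gd; rewrite q1t in gd1; rewrite q2t in gd2.
  have Nn : (0 < N * n)%N by rewrite muln_gt0 N0.
  have ee := etrans (esym (rr1 _ _ Nn gd gd1)) (rr2 _ _ Nn gd gd2).
  have /matrixP/(_ i j) := gv1 q1t; have /matrixP/(_ i j) := gv2 q2t.
  rewrite -ee !mxE /horner_eval hornerD hornerN !hornerM => <- <-.
  by rewrite mulrCA mulrA subrr.
have := hv1 n1; have := hv2 n2.
have /(congr1 (map_mx (horner_eval 0))) := key.
rewrite !map_mxZ /= /horner_eval => e3 e4 e5; rewrite -e5 -e4 !scalerA in e3.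
by move: e3; rewrite [q1.[0] * _]mulrC => /scalerI; apply; rewrite mulf_neq0.
Qed.

End RationalExpressions.

(** * Expansion at 0 and evaluation at nilpotent path matrices *)

Section PathEvaluation.
Variables (R : realType) (d : nat).
Local Notation C := R[i].
Local Notation word := (seq 'I_d).
Local Notation rexpr := (rexpr R d).
Local Notation series := (word -> C).
Implicit Types (r : rexpr) (f g : series).

Fixpoint ser r : series :=
  match r with
  | RVar j => svar C j
  | RConst c => sconst c
  | RAdd r1 r2 => fun w => ser r1 w + ser r2 w
  | RMul r1 r2 => sconv (ser r1) (ser r2)
  | RInv r1 => sinv (ser r1)
  end.

Lemma ser_nil r : rdom (fun=> 0 : 'M[C]_1) r ->
  reval (fun=> 0 : 'M[C]_1) r = (ser r [::])%:M.
Proof.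
elim: r => [j|c|r1 IH1 r2 IH2|r1 IH1 r2 IH2|r IH] //=.
- by rewrite raddf0.
- by move=> /andP[/IH1-> /IH2->]; rewrite raddfD.
- by move=> /andP[/IH1-> /IH2->]; rewrite -scalar_mxM.
by move=> /andP[/IH-> _]; rewrite invmx_scalar.
Qed.

Lemma ser_nil_neq0 r : rdom (fun=> 0 : 'M[C]_1) (RInv r) -> ser r [::] != 0.
Proof.
by move=> /= /andP[/ser_nil -> ]; rewrite unitmxE det_scalar1 unitfE.
Qed.

Lemma finrank_ser r : rdom (fun=> 0 : 'M[C]_1) r -> finrank (ser r).
Proof.
elim: r => [j|c|r1 IH1 r2 IH2|r1 IH1 r2 IH2|r IH] /=.
- by move=> _; exact: finrank_var.
- by move=> _; exact: finrank_const.
- by move=> /andP[/IH1 h1 /IH2 h2]; exact: finrankD.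
- by move=> /andP[/IH1 h1 /IH2 h2]; exact: finrank_sconv.
move=> h; apply: finrank_sinv; first exact: ser_nil_neq0.
by apply: IH; case/andP: h.
Qed.

Variables (w0 : word) (eps : C).
Local Notation L := (size w0).

Definition subword (i j : nat) : word := take (j - i) (drop i w0).

(* f is evaluated on the upper triangular nilpotent matrices [path_mx (svar k)]. *)
Definition path_mx f : 'M[C]_L.+1 :=
  \matrix_(i, j) if (i <= j)%N then eps ^+ (j - i) * f (subword i j) else 0.

Lemma size_subword i j : (i <= j <= L)%N -> size (subword i j) = (j - i)%N.
Proof. by move=> h; rewrite size_takel // size_drop; lia. Qed.

Lemma path_mxD f g : path_mx (fun w => f w + g w) = path_mx f + path_mx g.
Proof. by apply/matrixP => i j; rewrite !mxE; case: ifP; rewrite ?addr0 // mulrDr. Qed.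

Lemma path_mx_const c : path_mx (sconst c) = c%:M.
Proof.
apply/matrixP => i j; rewrite !mxE; case: ltngtP => [ij|ij|/val_inj ->].
- have : size (subword i j) != 0%N by rewrite size_subword; have := ltn_ord j; lia.
  case: (subword i j) => //= k w _; rewrite mulr0 -val_eqE /= ltn_eqF //.
- by rewrite -val_eqE /= gtn_eqF.
by rewrite /subword subnn expr0 mul1r take0 eqxx.
Qed.

(** The intermediate indices between i and j are the cuts of [subword i j], and the exponents of
    [eps] on the two pieces add up. *)
Lemma path_mxM f g : path_mx (sconv f g) = path_mx f *m path_mx g.
Proof.
apply/matrixP => i j; rewrite !mxE; under [RHS]eq_bigr do rewrite !mxE.
case: leqP => [ij|ji]; last first.
  rewrite big1 // => l _; case: leqP => il; last by rewrite mul0r.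
  by case: leqP => lj; [lia|rewrite mulr0].
have jL := ltn_ord j.
rewrite sconvE size_subword; last lia.
pose F (l : nat) := (if (i <= l)%N then eps ^+ (l - i) * f (subword i l) else 0) *
  (if (l <= j)%N then eps ^+ (j - l) * g (subword l j) else 0).
rewrite -(big_mkord xpredT F) (big_cat_nat (n := i)) //=; last by rewrite ltnW.
rewrite [X in X + _]big1_seq ?add0r; last first.
  move=> l /andP[_]; rewrite mem_index_iota /F => /= li.
  by rewrite leqNgt li mul0r.
rewrite (big_cat_nat (n := j.+1)) ?(leqW ij) //=.
rewrite [X in _ + X]big1_seq ?addr0; last first.
  move=> l /andP[_]; rewrite mem_index_iota /F => /= /andP[jl _].
  by rewrite [(l <= j)%N]leqNgt jl mulr0.
rewrite -[X in \sum_(X <= _ < _) _]add0n big_addn subSn // big_mkord mulr_sumr.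
apply: eq_bigr => -[s sj'] _ /=; have sj : (s <= j - i)%N := sj'.
rewrite /F leq_addl addnK.
have -> : (s + i <= j)%N by lia.
have -> : take s (subword i j) = subword i (s + i).
  by rewrite /subword addnK take_takel.
have -> : drop s (subword i j) = subword (s + i) j.
  rewrite /subword -[in LHS](subnK sj).
  rewrite -take_drop drop_drop; congr (take _ _); lia.
rewrite -[(j - i)%N](subnKC sj) exprD.
have -> : (j - (s + i) = j - i - s)%N by lia.
by rewrite mulrACA.
Qed.

(** Regularity at 0 suffices whatever [eps] is: [path_mx] is multiplicative and unital, so the
    inverse series supplies the inverse matrix. *)
Lemma path_mx_reval r : rdom (fun=> 0 : 'M[C]_1) r ->
  rdom (fun k => path_mx (svar C k)) r /\
  reval (fun k => path_mx (svar C k)) r = path_mx (ser r).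
Proof.
elim: r => [j|c|r1 IH1 r2 IH2|r1 IH1 r2 IH2|r IH] //=.
- by rewrite path_mx_const.
- by move=> /andP[/IH1[-> ->] /IH2[-> ->]]; rewrite path_mxD.
- by move=> /andP[/IH1[-> ->] /IH2[-> ->]]; rewrite path_mxM.
move=> h; have h0 := ser_nil_neq0 h; case/andP: h => /IH[-> ->] _ /=.
have e : path_mx (ser r) *m path_mx (sinv (ser r)) = 1%:M.
  by rewrite -path_mxM sconv_sinv // path_mx_const.
have [u _] := mulmx1_unit e; split=> //.
by rewrite -[RHS](mulKmx u) e mulmx1.
Qed.

End PathEvaluation.

Section MatrixWords.
Variables (R : realType) (d : nat).
Local Notation C := R[i].
Local Notation word := (seq 'I_d).

Lemma path_mx_word (w0 : word) (eps : C) w :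
  mxword (fun k => path_mx w0 eps (svar C k)) w = path_mx w0 eps (fun u => (u == w)%:R).
Proof.
elim: w => [|k w IH] /=.
  by rewrite -(path_mx_const w0 eps); congr path_mx; apply/funext => -[|j u].
rewrite IH -path_mxM; congr path_mx; apply/funext => -[|j u] /=.
  by rewrite mul0r.
rewrite mul0r add0r eqseq_cons.
have -> : (fun u0 : word => if u0 is [::] then (j == k)%:R else 0 : C) =
  sconst (j == k)%:R by [].
have cc c (g : word -> C) v : sconv (sconst c) g v = c * g v.
  rewrite sconvE big_ord_recl /= take0 drop0 big1 ?addr0 // => i _.
  by case: v i => [[]|l v i] //; rewrite mul0r.
by rewrite cc; case: (j == k); rewrite ?mul1r ?mul0r.
Qed.

(** A word contributes to the entry (i, j) only if it equals [subword i j]; the power series is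
    therefore stationary once N exceeds the length of [w0]. *)
Lemma path_mx_sum (w0 : word) (eps : C) (f : word -> C) (N : nat) i j : (size w0 < N)%N ->
  sum_lt (fun w => f w * mxword (fun k => path_mx w0 eps (svar C k)) w i j) N =
  path_mx w0 eps f i j.
Proof.
move=> hN; under eq_fun do rewrite path_mx_word mxE.
rewrite mxE; case: leqP => ij; last first.
  by rewrite sum_ltE big1 // => w _; rewrite mulr0.
have jL := ltn_ord j.
have mem : subword w0 i j \in words_lt d N.
  apply/flatten_mapP; exists (size (subword w0 i j)).
    by rewrite mem_iota add0n /= size_subword; lia.
  by apply/mapP; exists (in_tuple (subword w0 i j)); rewrite ?mem_enum.
rewrite sum_ltE (bigD1_seq _ mem) ?words_lt_uniq //= eqxx mulr1 mulrC.
by rewrite big1 ?addr0 // => w /negbTE; rewrite eq_sym => ->; rewrite !mulr0.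
Qed.

End MatrixWords.

(** * The ball and the Fock space *)

Section ColumnVectors.
Variables (R : realType).
Local Notation C := R[i].
Local Open Scope sesquilinear_scope.

Section Form.
Variable n : nat.
Implicit Types (x y z : 'cV[C]_n) (A B : 'M[C]_n).

Definition cvip x y : C := \sum_(i < n) (x i 0)^* * y i 0.

Lemma cvip_linr x a y z : cvip x (a *: y + z) = a * cvip x y + cvip x z.
Proof.
rewrite /cvip mulr_sumr -big_split /=; apply: eq_bigr => i _.
by rewrite !mxE mulrDr mulrCA.
Qed.

Lemma cvip_linl a x y z : cvip (a *: x + y) z = a^* * cvip x z + cvip y z.
Proof.
rewrite /cvip mulr_sumr -big_split /=; apply: eq_bigr => i _.
by rewrite !mxE rmorphD rmorphM mulrDl mulrA.
Qed.

Lemma cvipxx x : cvip x x = (\sum_(i < n) sqabs (x i 0))%:C.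
Proof. by rewrite /cvip raddf_sum; apply: eq_bigr => i _; rewrite mulCconj. Qed.

Lemma cvip_ge0 x : 0 <= cvip x x.
Proof. by rewrite cvipxx lecR sumr_ge0 // => i _; exact: sqabs_ge0. Qed.

Definition cvdot : preInner 'cV[C]_n := PreInner cvip_linr cvip_linl cvip_ge0.

Lemma sqn_cvdot x : sqn cvdot x = \sum_(i < n) sqabs (x i 0).
Proof. by rewrite /sqn /= cvipxx. Qed.

Lemma sqn_cvdot_eq0 x : sqn cvdot x = 0 -> x = 0.
Proof.
rewrite sqn_cvdot => /eqP; rewrite psumr_eq0; last by move=> i _; exact: sqabs_ge0.
move=> /allP h; apply/matrixP => i j; rewrite ord1 mxE; apply/sqabs0_eq0/eqP/h.
exact: mem_index_enum.
Qed.

Lemma cvipE x A y : (x^t* *m A *m y) 0 0 = cvdot x (A *m y).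
Proof. by rewrite -mulmxA mxE; apply: eq_bigr => i _; rewrite !mxE. Qed.

Lemma cvip_adj x A y : cvdot (A^t* *m x) y = cvdot x (A *m y).
Proof.
rewrite /= /cvip; under [RHS]eq_bigr do rewrite mxE mulr_sumr.
rewrite exchange_big; apply: eq_bigr => i _; rewrite mxE rmorph_sum mulr_suml.
by apply: eq_bigr => j _; rewrite !mxE rmorphM /= conjCK mulrCA mulrA.
Qed.

Lemma sqn_mulmx A x : sqn cvdot (A *m x) <= (\sum_i \sum_j sqabs (A i j)) * sqn cvdot x.
Proof.
rewrite [leLHS]sqn_cvdot mulr_suml; apply: ler_sum => i _.
pose a : 'cV_n := \col_j (A i j)^*.
have -> : (A *m x) i 0 = cvdot a x.
  by rewrite mxE; apply: eq_bigr => j _; rewrite mxE conjCK.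
apply: le_trans (ip_CS cvdot a x) _; rewrite [sqn cvdot a]sqn_cvdot.
by under eq_bigr do rewrite mxE sqabs_conj.
Qed.

End Form.

Variable d : nat.
Section Ball.
Variables (n : nat) (Z : 'I_d -> 'M[C]_n).

Lemma in_ball_form (x : 'cV[C]_n) :
  (x^t* *m (1%:M - \sum_(j < d) Z j *m (Z j)^t* ) *m x) 0 0 =
  (sqn (@cvdot n) x - \sum_(j < d) sqn (@cvdot n) ((Z j)^t* *m x))%:C.
Proof.
rewrite cvipE mulmxBl mul1mx ipBr ip_sqn rmorphB; congr (_ - _).
rewrite mulmx_suml ip_sumr raddf_sum; apply: eq_bigr => j _ /=.
by rewrite -mulmxA -[LHS]cvip_adj ip_sqn.
Qed.

Lemma small_in_ball : (0 < n)%N -> \sum_k \sum_i \sum_j sqabs (Z k i j) < 1 -> in_ball Z.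
Proof.
move=> n0 h; split=> // x x0; rewrite in_ball_form ltcR subr_gt0.
have xp : 0 < sqn (@cvdot n) x.
  rewrite lt_neqAle sqn_ge0 andbT eq_sym; apply: contra_neq x0.
  exact: sqn_cvdot_eq0.
apply: (@le_lt_trans _ _ ((\sum_k \sum_i \sum_j sqabs (Z k i j)) * sqn (@cvdot n) x));
  last by rewrite gtr_pMl.
rewrite mulr_suml; apply: ler_sum => k _; apply: le_trans (sqn_mulmx _ _) _.
rewrite ler_wpM2r ?sqn_ge0 // exchange_big /=; apply: ler_sum => i _; apply: ler_sum => j _.
by rewrite !mxE sqabs_conj.
Qed.

Hypothesis Zball : in_ball Z.

(* Strict positivity is made uniform without compactness: Cauchy-Schwarz for the form of B,
   applied to x and B^-1 x, gives |x|^4 <= <x, B x> <x, B^-1 x>. *)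
Lemma in_ball_strict : exists2 rho : R, 0 < rho < 1 &
  forall x, \sum_(k < d) sqn (@cvdot n) ((Z k)^t* *m x) <= rho * sqn (@cvdot n) x.
Proof.
have [n0 Bpos] := Zball; set B := 1%:M - _ in Bpos.
have Bge0 (x : 'cV[C]_n) : 0 <= cvdot n x (B *m x).
  have [->|x0] := eqVneq x 0; first by rewrite ip0l.
  by rewrite -cvipE; apply/ltW/Bpos.
have linr (x : 'cV[C]_n) a y z : cvdot n x (B *m (a *: y + z)) =
    a * cvdot n x (B *m y) + cvdot n x (B *m z).
  by rewrite mulmxDr -scalemxAr ip_linr.
have linl a (x : 'cV[C]_n) y z : cvdot n (a *: x + y) (B *m z) =
    a^* * cvdot n x (B *m z) + cvdot n y (B *m z) by rewrite ip_linl.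
pose Bf := PreInner linr linl Bge0.
have Bu : B \in unitmx.
  rewrite -row_free_unit -kermx_eq0; apply/rowV0P => v /sub_kermxP vB.
  apply/eqP/negPn/negP => v0.
  have v0' : v^t* != 0.
    apply: contra_neq v0 => /matrixP h; apply/matrixP => i j.
    by have := h j i; rewrite !mxE => /eqP; rewrite conjC_eq0 => /eqP.
  have := Bpos _ v0'; have -> : v^t*^t* = v.
    by apply/matrixP => i j; rewrite !mxE conjCK.
  by rewrite vB mul0mx mxE ltxx.
pose K : R := \sum_i \sum_j sqabs (invmx B i j).
have K0 : 0 <= K by do 2![apply: sumr_ge0 => ? _]; exact: sqabs_ge0.
have key (x : 'cV[C]_n) : sqn (@cvdot n) x <= Num.sqrt K * sqn Bf x.
  have [->|x0] := eqVneq (sqn (@cvdot n) x) 0.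
    by rewrite mulr_ge0 ?sqrtr_ge0 ?sqn_ge0.
  have xp : 0 < sqn (@cvdot n) x by rewrite lt_neqAle eq_sym x0 sqn_ge0.
  pose y := invmx B *m x.
  have h1 := ip_CS Bf x y; have e1 : Bf x y = cvdot n x x by rewrite /= /y mulKVmx.
  have e2 : sqn Bf y = complex.Re (cvdot n y x) by rewrite /sqn /= /y mulKVmx.
  have h2 : nrm (@cvdot n) y <= Num.sqrt K * nrm (@cvdot n) x.
    by rewrite -sqrtrM // ler_wsqrtr // sqn_mulmx.
  have h3 : sqn Bf y <= Num.sqrt K * sqn (@cvdot n) x.
    rewrite e2; apply: le_trans (ler_norm _) _; apply: le_trans (Re_ip_le _ _ _) _.
    apply: le_trans (ler_wpM2r (nrm_ge0 _ _) h2) _.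
    by rewrite -mulrA -expr2 nrm_sqr.
  move: h1; rewrite e1 ip_sqn.
  have -> : sqabs (sqn (@cvdot n) x)%:C = sqn (@cvdot n) x ^+ 2 by rewrite /sqabs /= expr0n /= addr0.
  move=> h1; have := le_trans h1 (ler_wpM2l (sqn_ge0 Bf x) h3).
  by rewrite expr2 mulrA ler_pM2r // mulrC.
(* The term 2 forces s > 1, hence 0 < 1 - 1/s < 1. Replacing [Num.sqrt K] by s in [key] and solving
   for the sum gives the constant 1 - 1/s. *)
pose s := Num.sqrt K + 2; have s0 : 0 <= Num.sqrt K by exact: sqrtr_ge0.
have sp : 0 < s by rewrite /s; lra.
exists (1 - s^-1).
  rewrite gtrBl invr_gt0 sp andbT subr_gt0 invf_lt1 // /s; lra.
move=> x; have := key x; have := sqn_ge0 Bf x.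
have -> : sqn Bf x = sqn (@cvdot n) x - \sum_(j < d) sqn (@cvdot n) ((Z j)^t* *m x).
  by rewrite {1}/sqn /= -[cvip _ _]cvipE in_ball_form.
move: (sqn _ _) (\sum_(_ < _) _) => a b ab h.
have : a <= s * (a - b) by apply: le_trans h _; rewrite /s mulrDl; lra.
rewrite -ler_pdivrMl // mulrBl mul1r; lra.
Qed.

(** Passes from the column of adjoints to the row itself: |x|^2 is the sum of the real parts of the
    pairings of [(Z k)^t* *m x] with [y k], to which the arithmetic-geometric inequality with weight
    rho applies. *)
Lemma row_contraction (rho : R) : 0 < rho ->
  (forall x, \sum_(k < d) sqn (@cvdot n) ((Z k)^t* *m x) <= rho * sqn (@cvdot n) x) ->
  forall y : 'I_d -> 'cV[C]_n, sqn (@cvdot n) (\sum_k Z k *m y k) <= rho * \sum_k sqn (@cvdot n) (y k).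
Proof.
move=> r0 h y; set x := \sum_k _.
have e : sqn (@cvdot n) x = \sum_k complex.Re (cvdot n ((Z k)^t* *m x) (y k)).
  rewrite {1}/sqn {2}/x ip_sumr raddf_sum; apply: eq_bigr => k _.
  by rewrite cvip_adj.
have amgm k : 2 * complex.Re (cvdot n ((Z k)^t* *m x) (y k)) <=
    rho^-1 * sqn (@cvdot n) ((Z k)^t* *m x) + rho * sqn (@cvdot n) (y k).
  have := sqn_ge0 (@cvdot n) ((rho^-1)%:C *: ((Z k)^t* *m x) - y k).
  rewrite sqnDE sqnN sqnZ ipNr ipZl.
  have -> : complex.Re (- (((rho^-1)%:C)^* * cvdot n ((Z k)^t* *m x) (y k))) =
    - (rho^-1 * complex.Re (cvdot n ((Z k)^t* *m x) (y k))).
    by case: (cvdot n _ _) => a b /=; rewrite oppr0 mul0r subr0.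
  have -> : sqabs (rho^-1)%:C = rho^-1 ^+ 2 by rewrite /sqabs /= expr0n /= addr0.
  move: (sqn _ _) (sqn _ _) (complex.Re _) => b a c hh.
  have := mulr_ge0 (ltW r0) hh.
  have -> : rho * (rho^-1 ^+ 2 * a + 2 * - (rho^-1 * c) + b) = rho^-1 * a - 2 * c + rho * b.
    by field; rewrite gt_eqF.
  lra.
have : 2 * sqn (@cvdot n) x <= sqn (@cvdot n) x + rho * \sum_k sqn (@cvdot n) (y k).
  rewrite {1}e mulr_sumr; apply: le_trans (ler_sum _ (fun k _ => amgm k)) _.
  rewrite big_split /= -!mulr_sumr lerD2r.
  by rewrite ler_pdivrMl //; exact: h.
lra.
Qed.

End Ball.

Lemma in_ball_block n m (Z : 'I_d -> 'M[C]_n) (W : 'I_d -> 'M[C]_m) :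
  in_ball Z -> in_ball W -> in_ball (fun j => block_mx (Z j) 0 0 (W j)).
Proof.
move=> [n0 hZ] [m0 hW]; split; first by rewrite addn_gt0 n0.
move=> x x0; rewrite in_ball_form ltcR.
have e (a b : nat) (u : 'cV[C]_a) (v : 'cV[C]_b) : sqn (@cvdot (a + b)) (col_mx u v) =
    sqn (@cvdot a) u + sqn (@cvdot b) v.
  rewrite !sqn_cvdot big_split_ord /=; congr (_ + _); apply: eq_bigr => i _.
    by rewrite col_mxEu.
  by rewrite col_mxEd.
rewrite -[x]vsubmxK in x0 *; set u := usubmx x in x0 *; set v := dsubmx x in x0 *.
have eZ j : (block_mx (Z j) 0 0 (W j))^t* *m col_mx u v = col_mx ((Z j)^t* *m u) ((W j)^t* *m v).
  have -> : (block_mx (Z j) 0 0 (W j))^t* = block_mx ((Z j)^t* ) 0 0 ((W j)^t* ).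
    by rewrite tr_block_mx map_block_mx !trmx0 !map_mx0.
  by rewrite mul_block_col !mul0mx addr0 add0r.
under eq_bigr do rewrite eZ e; rewrite e big_split /= opprD addrACA.
have ge0 a (V : 'I_d -> 'M[C]_a) (t : 'cV[C]_a) : posdef (1%:M - \sum_j V j *m (V j)^t* ) ->
   t != 0 -> 0 < sqn (@cvdot a) t - \sum_j sqn (@cvdot a) ((V j)^t* *m t).
  by move=> hV t0; have := hV t t0; rewrite in_ball_form ltcR.
have ge0' a (V : 'I_d -> 'M[C]_a) (t : 'cV[C]_a) : posdef (1%:M - \sum_j V j *m (V j)^t* ) ->
   0 <= sqn (@cvdot a) t - \sum_j sqn (@cvdot a) ((V j)^t* *m t).
  move=> hV; have [->|t0] := eqVneq t 0; last exact/ltW/ge0.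
  by rewrite sqn0 big1 ?subr0 // => j _; rewrite mulmx0 sqn0.
have [u0|u0] := eqVneq u 0; last by apply: ltr_pwDl; [exact: ge0|exact: ge0'].
apply: ltr_wpDl; first exact: ge0'.
by apply: ge0 => //; apply: contra_neq x0 => ->; rewrite u0 col_mx0.
Qed.

End ColumnVectors.

(** * Completeness of the Fock space and invertibility of [I - Z L^*] *)

Section FockSpace.
Variables (R : realType) (d : nat).
Local Notation C := R[i].
Local Notation word := (seq 'I_d).
Local Notation fock := (fock R d).
Implicit Types (h g : fock) (k : 'I_d) (w : word).

Lemma fock_linr h a g g' : fdot h (a *: g + g') = a * fdot h g + fdot h g'.
Proof. by rewrite fdotDr fdotZr. Qed.

Lemma fock_linl a h h' g : fdot (a *: h + h') g = a^* * fdot h g + fdot h' g.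
Proof. by rewrite fdotDl fdotZl. Qed.

Definition fockp : preInner fock := PreInner fock_linr fock_linl (@fdot_ge0 R d).

Lemma fnormE h : fnorm h = nrm fockp h. Proof. by []. Qed.

Lemma fock_sumE (I : Type) (r : seq I) (P : pred I) (F : I -> fock) w :
  (\sum_(i <- r | P i) F i) w = \sum_(i <- r | P i) F i w.
Proof. by apply: (big_morph (fun h : fock => h w)). Qed.

Lemma sum_lt_ge0 (f : word -> R) N : (forall w, 0 <= f w) -> 0 <= sum_lt f N.
Proof. by move=> h; rewrite sum_ltE sumr_ge0. Qed.

Lemma ler_sum_lt (f g : word -> R) N : (forall w, f w <= g w) -> sum_lt f N <= sum_lt g N.
Proof. by move=> h; rewrite !sum_ltE; apply: ler_sum. Qed.

Lemma sum_lt_mono (f : word -> R) : (forall w, 0 <= f w) -> nondecreasing_seq (sum_lt f).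
Proof.
move=> h; apply/nondecreasing_seqP => n.
rewrite /sum_lt big_ord_recr /= lerDl; apply: sumr_ge0 => w _; exact: h.
Qed.

Lemma fdot_lim h : (sum_lt (fun w => sqabs (h w))) @ \oo --> sqn fockp h.
Proof.
have [hr _] := ccvgn_ctends (fdot_cvg h h).
rewrite /sqn /= /fdot; apply: cvg_trans hr.
rewrite (_ : (fun n => _) = sum_lt (fun w => sqabs (h w))) //.
apply/funext => n; rewrite !sum_ltE Re_sum; apply: eq_bigr => w _.
by rewrite mulCconj.
Qed.

Arguments fdot_lim : clear implicits.

Lemma sum_lt_sqn h N : sum_lt (fun w => sqabs (h w)) N <= sqn fockp h.
Proof.
rewrite -(cvg_lim _ (fdot_lim h)) //; apply: nondecreasing_cvgn_le.
  by apply: sum_lt_mono => w; exact: sqabs_ge0.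
by apply/cvg_ex; exists (sqn fockp h); exact: fdot_lim.
Qed.

Lemma sqn_fock_le h (M : R) : (forall N, sum_lt (fun w => sqabs (h w)) N <= M) ->
  sqn fockp h <= M.
Proof.
move=> hM; rewrite -(cvg_lim _ (fdot_lim h)) //; apply: limr_le.
  by apply/cvg_ex; exists (sqn fockp h); exact: fdot_lim.
by near=> n; exact: hM.
Unshelve. all: by end_near. Qed.

Lemma mem_words_lt w N : (size w < N)%N -> w \in words_lt d N.
Proof.
move=> hN; apply/flatten_mapP; exists (size w); first by rewrite mem_iota add0n.
by apply/mapP; exists (in_tuple w); rewrite ?mem_enum.
Qed.

Lemma sum_uniq_lt (f : word -> R) (s : seq word) : (forall w, 0 <= f w) -> uniq s ->
  exists N, \sum_(w <- s) f w <= sum_lt f N.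
Proof.
move=> f0 us; exists (\max_(w <- s) size w).+1; rewrite sum_ltE.
have sub w : w \in s -> w \in words_lt d (\max_(w <- s) size w).+1.
  by move=> ws; apply: mem_words_lt; rewrite ltnS; exact: leq_bigmax_seq.
rewrite [leRHS](bigID (mem s)) /= -[leLHS]addr0; apply: lerD; last exact: sumr_ge0.
rewrite -[leRHS]big_filter le_eqVlt; apply/orP; left; apply/eqP/perm_big.
apply: uniq_perm; rewrite ?filter_uniq ?words_lt_uniq // => w.
by rewrite mem_filter andbC; case: (boolP (w \in s)) => [/sub->|]; rewrite ?andbF.
Qed.

Lemma sqabs_coef_le h w : sqabs (h w) <= sqn fockp h.
Proof.
have [|N hN] := @sum_uniq_lt (fun w => sqabs (h w)) [:: w] _ isT.
  by move=> u; exact: sqabs_ge0.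
by rewrite big_seq1 in hN; exact: le_trans hN (sum_lt_sqn _ _).
Qed.

Lemma sqn_fock_eq0 h : sqn fockp h = 0 -> h = 0.
Proof.
move=> h0; apply: fockP => w; apply: sqabs0_eq0; apply/eqP.
by rewrite eq_le sqabs_ge0 -h0 sqabs_coef_le.
Qed.

Lemma coef_ctends (u : nat -> fock) : cauchy_for_ip fockp u ->
  forall w, ccvgn (fun n => u n w).
Proof.
move=> hu w.
have key (f : C -> R) : (forall x y, f (x - y) = f x - f y) ->
   (forall x, f x ^+ 2 <= sqabs x) -> cvgn (fun n => f (u n w)).
  move=> fB fle; apply/cauchy_cvgP/cauchy_exP => e e0.
  have [N hN] := hu _ (exprn_gt0 2 e0); exists (f (u N w)); exists N => //= n /= Nn.
  rewrite /ball /= -ltr_sqr ?nnegrE ?normr_ge0 1?ltW // real_normK ?num_real //.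
  apply: le_lt_trans (hN _ _ (leqnn N) Nn); rewrite -fB.
  exact: le_trans (fle _) (sqabs_coef_le (u N - u n) w).
split; apply: key => [x y|x]; rewrite ?raddfB //= /sqabs.
  by rewrite lerDl sqr_ge0.
by rewrite lerDr sqr_ge0.
Qed.

Lemma sqabs_ctends (u : nat -> C) l : ctends u l ->
  ctends (fun n => (sqabs (u n))%:C) (sqabs l)%:C.
Proof.
move=> h; have := ctendsM (ctends_conj h) h; rewrite mulCconj.
by apply: eq_ctends => n; rewrite mulCconj.
Qed.

Lemma sum_sqabs_ctends (s : seq word) (u : nat -> word -> C) (y : word -> C) :
  (forall w, ctends (fun n => u n w) (y w)) ->
  ctends (fun n => (\sum_(w <- s) sqabs (u n w))%:C) (\sum_(w <- s) sqabs (y w))%:C.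
Proof.
move=> h; rewrite rmorph_sum; under eq_fun do rewrite rmorph_sum.
by apply: ctends_sum => w _; exact: sqabs_ctends.
Qed.

(** The limit is taken coefficientwise. Bounds on finite sums of coefficients pass to the limit, and
    give both its square-summability and convergence in norm. *)
Lemma fock_complete (u : nat -> fock) : cauchy_for_ip fockp u ->
  exists2 y : fock, null_for_ip fockp (fun n => u n - y) &
    forall w, ctends (fun n => u n w) (y w).
Proof.
move=> hu; pose y w : C^o := climn (fun n => u n w).
have hy w : ctends (fun n => u n w) (y w) by exact/ccvgn_ctends/coef_ctends.
have tail (k : nat) (v : nat -> C) l : ctends v l -> ctends (fun n => v (n + k)%N) l.
  move=> hv; elim: k => [|k IH]; first by apply: eq_ctends hv => n; rewrite addn0.
  by apply: eq_ctends (ctends_shift IH) => n; rewrite addSnnS.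
have ys : sqsummable y.
  have [M M0 [N hN]] := cauchy_bounded hu; apply/sqsummableP; exists M => s us.
  have := tail N _ _ (sum_sqabs_ctends s hy) => /ctends_Re_le; apply=> n /=.
  have [|N' hN'] := @sum_uniq_lt (fun w => sqabs (u (n + N)%N w)) s _ us.
    by move=> w; exact: sqabs_ge0.
  apply: le_trans hN' _; apply: le_trans (sum_lt_sqn _ _) _; exact/hN/leq_addl.
exists (mkfock ys) => // e e0.
have [N hN] := hu _ (divr_gt0 e0 (ltr0n R 2)); exists N => n Nn.
apply: (@le_lt_trans _ _ (e / 2)); last by rewrite gtr_pMr // invf_lt1 ?ltr1n.
apply: sqn_fock_le => N'.
have hd w : ctends (fun m => u n w - u m w) (u n w - y w).
  by apply: ctendsB => //; exact: ctends_cst.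
have := tail N _ _ (sum_sqabs_ctends (words_lt d N') hd) => /ctends_Re_le.
rewrite /= sum_ltE; apply=> m.
have := sum_lt_sqn (u n - u (m + N)%N) N'; rewrite sum_ltE => /le_trans; apply.
by apply/ltW/hN => //; exact: leq_addl.
Qed.

Lemma sum_Lop_adj h N :
  \sum_k sum_lt (fun w => sqabs (h (k :: w))) N <= sqn fockp h.
Proof.
apply: le_trans (sum_lt_sqn h N.+1); rewrite sum_ltS lerDr; exact: sqabs_ge0.
Qed.

Lemma fnorm_Lop_adj k h : fnorm (Lop_adj k h) <= fnorm h.
Proof.
rewrite ler_wsqrtr //; apply: sqn_fock_le => N.
apply: le_trans (sum_Lop_adj h N); rewrite (bigD1 k) //= lerDl.
by apply: sumr_ge0 => j _; apply: sum_lt_ge0 => w; exact: sqabs_ge0.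
Qed.

Lemma fnorm_Lword_adj w h : fnorm (Lword_adj w h) <= fnorm h.
Proof.
elim: w h => [|k w IH] h //=; exact: le_trans (IH _) (fnorm_Lop_adj _ _).
Qed.

(** Cauchy-Schwarz on |T h|^2 = Re <h, T' (T h)>, then division by |T h|. *)
Lemma fnorm_adjoint (T T' : fock -> fock) (e : R) : 0 <= e ->
  (forall h g, fdot (T h) g = fdot h (T' g)) ->
  (forall g, fnorm (T' g) <= e * fnorm g) -> forall h, fnorm (T h) <= e * fnorm h.
Proof.
move=> e0 adjT T'e h; have [->|n0] := eqVneq (fnorm (T h)) 0.
  by rewrite mulr_ge0 // fnormE nrm_ge0.
have np : 0 < fnorm (T h) by rewrite lt_neqAle eq_sym n0 fnormE nrm_ge0.
rewrite -(ler_pM2r np) -expr2 {1}fnormE nrm_sqr.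
have -> : sqn fockp (T h) = complex.Re (fdot h (T' (T h))) by rewrite -adjT.
apply: le_trans (ler_norm _) _; apply: le_trans (Re_ip_le fockp _ _) _.
rewrite -mulrA mulrCA; apply: ler_wpM2l; first exact: nrm_ge0.
exact: T'e.
Qed.

Section Tuples.
Variable n : nat.
Implicit Types (X Y : 'I_n -> fock).

Definition vip X Y : C := \sum_(i < n) fdot (X i) (Y i).

Lemma vip_linr X a Y Y' : vip X (a *: Y + Y') = a * vip X Y + vip X Y'.
Proof.
rewrite /vip mulr_sumr -big_split /=; apply: eq_bigr => i _; exact: fock_linr.
Qed.

Lemma vip_linl a X X' Y : vip (a *: X + X') Y = a^* * vip X Y + vip X' Y.
Proof.
rewrite /vip mulr_sumr -big_split /=; apply: eq_bigr => i _; exact: fock_linl.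
Qed.

Lemma vip_ge0 X : 0 <= vip X X.
Proof. by apply: sumr_ge0 => i _; exact: fdot_ge0. Qed.

Definition vdot : preInner ('I_n -> fock) := PreInner vip_linr vip_linl vip_ge0.

Lemma sqn_vdot X : sqn vdot X = \sum_(i < n) sqn fockp (X i).
Proof. by rewrite /sqn /= /vip raddf_sum. Qed.

Lemma sqn_vdot_coord X i : sqn fockp (X i) <= sqn vdot X.
Proof.
by rewrite sqn_vdot (bigD1 i) //= lerDl sumr_ge0 // => j _; exact: sqn_ge0.
Qed.

Lemma sqn_vdot_eq0 X : sqn vdot X = 0 -> X = 0.
Proof.
move=> h; apply/funext => i; apply: sqn_fock_eq0; apply/eqP.
by rewrite eq_le sqn_ge0 andbT -h sqn_vdot_coord.
Qed.

Lemma sqn_vdot_le X (M : R) :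
  (forall N, \sum_(i < n) sum_lt (fun w => sqabs (X i w)) N <= M) -> sqn vdot X <= M.
Proof.
move=> hM; rewrite sqn_vdot.
have hl : ctends (fun N => \sum_(i < n) (sum_lt (fun w => sqabs (X i w)) N)%:C)
    (\sum_(i < n) (sqn fockp (X i))%:C).
  by apply: ctends_sum => i _; split; [exact: fdot_lim|exact: cvg_cst].
have := ctends_Re_le hl; rewrite -rmorph_sum /=; apply=> N.
by rewrite -rmorph_sum /=; exact: hM.
Qed.

Variable Z : 'I_d -> 'M[C]_n.
Local Notation T := (ZLadj Z).

Lemma ZLadj_coef X i w : T X i w = \sum_k \sum_j Z k i j * X j (k :: w).
Proof.
by rewrite /ZLadj fock_sumE; apply: eq_bigr => k _; rewrite fock_sumE.
Qed.

Lemma ZLadj_lin a X Y : T (a *: X + Y) = a *: T X + T Y.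
Proof.
apply/funext => i; apply: fockP => w; rewrite fockD fockZ !ZLadj_coef.
rewrite mulr_sumr -big_split /=; apply: eq_bigr => k _.
rewrite mulr_sumr -big_split /=; apply: eq_bigr => j _.
by rewrite mulrDr mulrCA.
Qed.

Lemma ZLadjD X Y : T (X + Y) = T X + T Y.
Proof. by have := ZLadj_lin 1 X Y; rewrite !scale1r. Qed.

Lemma ZLadjN X : T (- X) = - T X.
Proof.
have T0 : T 0 = 0 by have := ZLadj_lin (-1) 0 0; rewrite scaler0 addr0 scaleN1r addNr.
by have := ZLadj_lin (-1) X 0; rewrite T0 !addr0 !scaleN1r.
Qed.

Lemma ZLadjB X Y : T (X - Y) = T X - T Y.
Proof. by rewrite ZLadjD ZLadjN. Qed.

Variable rho : R.
Hypothesis rho01 : 0 < rho < 1.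
Hypothesis Zrow : forall y : 'I_d -> 'cV[C]_n,
  sqn (@cvdot R n) (\sum_k Z k *m y k) <= rho * \sum_k sqn (@cvdot R n) (y k).

(** At each word w the row bound applies to the vectors of coefficients at [k :: w]. As k and w vary
    these words are distinct, so the total is at most the squared norm of X. *)
Lemma ZLadj_contraction X : sqn vdot (T X) <= rho * sqn vdot X.
Proof.
have [r0 _] := andP rho01; apply: sqn_vdot_le => N.
have -> : \sum_(i < n) sum_lt (fun w => sqabs (T X i w)) N =
    sum_lt (fun w => \sum_(i < n) sqabs (T X i w)) N.
  by rewrite [RHS]sum_ltE [RHS]exchange_big /=; apply: eq_bigr => i _; rewrite sum_ltE.
apply: (@le_trans _ _ (sum_lt (fun w => rho * \sum_k \sum_j sqabs (X j (k :: w))) N)).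
  apply: ler_sum_lt => w; pose y k : 'cV[C]_n := \col_j X j (k :: w).
  have := Zrow y; rewrite sqn_cvdot.
  have -> : \sum_k sqn (cvdot R n) (y k) = \sum_k \sum_j sqabs (X j (k :: w)).
    apply: eq_bigr => k _; rewrite sqn_cvdot; apply: eq_bigr => j _.
    by rewrite mxE.
  have e i : (\sum_k Z k *m y k) i 0 = T X i w.
    rewrite ZLadj_coef summxE; apply: eq_bigr => k _.
    by rewrite mxE; apply: eq_bigr => j _; rewrite mxE.
  by under eq_bigr do rewrite e.
rewrite sum_ltE -mulr_sumr ler_pM2l // sqn_vdot exchange_big /=.
have -> : \sum_k \sum_(w <- words_lt d N) \sum_j sqabs (X j (k :: w)) =
   \sum_j \sum_k sum_lt (fun w => sqabs (X j (k :: w))) N.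
  rewrite [RHS]exchange_big; apply: eq_bigr => k _; rewrite exchange_big.
  by apply: eq_bigr => j _; rewrite sum_ltE.
by apply: ler_sum => j _; exact: sum_Lop_adj.
Qed.

Lemma iter_ZLadj_contraction m X : sqn vdot (iter m T X) <= rho ^+ m * sqn vdot X.
Proof.
have [r0 _] := andP rho01.
elim: m => [|m IH] /=; first by rewrite expr0 mul1r.
apply: le_trans (ZLadj_contraction _) _; rewrite exprS -mulrA ler_pM2l //.
Qed.

Let sigma := Num.sqrt rho.

Let sigma_lt1 : sigma < 1.
Proof.
have [r0 r1] := andP rho01.
by rewrite -sqrtr1 ltr_sqrt.
Qed.

Let nrmT X : nrm vdot (T X) <= sigma * nrm vdot X.
Proof.
have [r0 r1] := andP rho01.
by rewrite -sqrtrM ?(ltW r0) // ler_wsqrtr // ZLadj_contraction.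
Qed.

Lemma subZL_bounded X : nrm vdot X <= (1 - sigma)^-1 * nrm vdot (X - T X).
Proof.
have s1 : 0 < 1 - sigma by rewrite subr_gt0.
rewrite -ler_pdivrMl ?invr_gt0 // invrK mulrBl mul1r lerBlDr.
have := nrmD vdot (X - T X) (T X); rewrite subrK => /le_trans; apply.
by rewrite lerD2l.
Qed.

Lemma subZL_inj : injective (fun X => X - T X).
Proof.
move=> X Y /= e; apply/eqP; rewrite -subr_eq0; apply/eqP/sqn_vdot_eq0.
rewrite -nrm_sqr; apply/eqP; rewrite sqrf_eq0 eq_le nrm_ge0 andbT.
have := subZL_bounded (X - Y).
have -> : X - Y - T (X - Y) = (X - T X) - (Y - T Y).
  by rewrite ZLadjB !opprB [LHS]addrACA [RHS]addrACA [- Y - _]addrC.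
by rewrite e subrr nrm0 mulr0.
Qed.

Lemma subZL_surj X : exists Y, Y - T Y = X.
Proof.
have s1 : 0 < 1 - sigma by rewrite subr_gt0.
have [r0 r1] := andP rho01.
pose Y m := iter m (fun Y => X + T Y) 0.
(* The bound B = |X| / (1 - sigma) solves |X| + sigma B = B, so the iteration preserves it. *)
have Ybnd m : sqn vdot (Y m) <= ((1 - sigma)^-1 * nrm vdot X) ^+ 2.
  rewrite -nrm_le_sqr; last by rewrite mulr_ge0 ?invr_ge0 ?nrm_ge0 // ltW.
  elim: m => [|m IH] /=; first by rewrite nrm0 mulr_ge0 ?invr_ge0 ?nrm_ge0 // ltW.
  apply: le_trans (nrmD _ _ _) _; apply: le_trans (lerD (lexx _) (nrmT _)) _.
  apply: le_trans (lerD (lexx _) (ler_wpM2l (sqrtr_ge0 _) IH)) _.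
  rewrite le_eqVlt; apply/orP; left; apply/eqP; rewrite -/sigma.
  by field; rewrite gt_eqF.
have Ydiff m p : Y (m + p)%N - Y m = iter m T (Y p).
  elim: m => [|m IH] /=; first by rewrite add0n subr0.
  by rewrite -IH ZLadjB opprD addrACA subrr add0r.
have Yc i : cauchy_for_ip fockp (fun m => Y m i).
  move=> e e0; set M := (_ * nrm vdot X) ^+ 2 in Ybnd.
  have [N hN] : exists N : nat, rho ^+ N * M < e.
    have h : (fun N => rho ^+ N * M) @ \oo --> (0 : R).
      rewrite -[X in _ --> X](mul0r M); apply: cvgM; last exact: cvg_cst.
      by apply: cvg_expr; rewrite ger0_norm // ltW.
    have /cvgrPdist_lt/(_ _ e0)[N _ hN] := h; exists N.
    by have := hN N (leqnn N); rewrite sub0r normrN /=; apply: le_lt_trans; exact: ler_norm.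
  have main m p : (N <= m)%N -> (m <= p)%N -> sqn fockp (Y p i - Y m i) < e.
    move=> Nm mp; apply: le_lt_trans hN.
    apply: le_trans (sqn_vdot_coord (Y p - Y m) i) _.
    rewrite -(subnKC mp) Ydiff; apply: le_trans (iter_ZLadj_contraction _ _) _.
    apply: ler_pM; rewrite ?exprn_ge0 ?sqn_ge0 ?(ltW r0) //.
    by apply: ler_wiXn2l => //; exact: ltW.
  exists N => m p Nm Np; case: (leqP m p) => [mp|/ltnW pm]; last exact: main.
  by rewrite -sqnN opprB; exact: main.
have [y hy] : exists y : 'I_n -> fock, forall i w, ctends (fun m => Y m i w) (y i w).
  have /choice[y hy] : forall i, exists y : fock, forall w, ctends (fun m => Y m i w) (y w).
    by move=> i; have [y _ hy] := fock_complete (Yc i); exists y.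
  by exists y.
exists y; apply/funext => i; apply: fockP => w.
suff e : y i w = X i w + T y i w.
  by transitivity (y i w - T y i w : C) => //; rewrite e addrK.
apply: ctends_unique (ctends_shift (hy i w)) _.
have -> : (fun m => Y m.+1 i w) = fun m => X i w + T (Y m) i w by [].
apply: ctendsD; first exact: ctends_cst.
rewrite ZLadj_coef; under eq_fun do rewrite ZLadj_coef.
by do 2![apply: ctends_sum => ? _]; apply: ctendsZ.
Qed.

(** A two-sided inverse exists, so [inv_op] does not take its default value. *)
Lemma inv_subZL : let f := fun X => X - T X in
  cancel f (inv_op f) /\ cancel (inv_op f) f.
Proof.
move=> f; rewrite /inv_op; case: xgetP => [g _ //|ng].
have [g hg] := choice subZL_surj.
case: (ng g); split=> X; last exact: hg.
by apply: subZL_inj; rewrite hg.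
Qed.

End Tuples.

End FockSpace.

(** * The functional on the adjoint of the disk algebra *)

Section DiskOperators.
Variables (R : realType) (d : nat).
Local Notation C := R[i].
Local Notation word := (seq 'I_d).
Local Notation fock := (fock R d).
Local Notation op := (fock -> fock).
Local Notation fpoly := {malg C[{fmonom 'I_d}]}.
Implicit Types (h g : fock) (S T : op) (a : C) (w : word).

(** The Herglotz operators are built from the [L_k^*] alone, so their entries lie in this half of
    the disk system, where [mu] admits a norm bound. *)
Definition adj_disk : set op := opclosure (range (@evalL_adj R d)).

Lemma fdotBl h h' g : fdot (h - h') g = fdot h g - fdot h' g.
Proof. exact: (ipBl (fockp R d)). Qed.

Lemma fdotBr h g g' : fdot h (g - g') = fdot h g - fdot h g'.
Proof. exact: (ipBr (fockp R d)). Qed.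

Lemma fnormZ a h : fnorm (a *: h) = Num.sqrt (sqabs a) * fnorm h.
Proof. by rewrite !fnormE /nrm sqnZ sqrtrM // sqabs_ge0. Qed.

Lemma fnormD h g : fnorm (h + g) <= fnorm h + fnorm g.
Proof. exact: (nrmD (fockp R d)). Qed.

Lemma fnormN h : fnorm (- h) = fnorm h.
Proof. exact: (nrmN (fockp R d)). Qed.

Lemma fnorm_ge0 h : 0 <= fnorm h.
Proof. exact: (nrm_ge0 (fockp R d)). Qed.

Lemma opclosure_lin (E : set op) a S T :
  (forall S T, E S -> E T -> E (a *: S + T)) ->
  opclosure E S -> opclosure E T -> opclosure E (a *: S + T).
Proof.
move=> El hS hT e e0; pose M := Num.sqrt (sqabs a) + 1.
have M0 : 0 < M by rewrite ltr_wpDl ?sqrtr_ge0.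
have [S' ES' hS'] := hS _ (divr_gt0 e0 (mulr_gt0 (ltr0n R 2) M0)).
have [T' ET' hT'] := hT _ (divr_gt0 e0 (ltr0n R 2)).
exists (a *: S' + T'); first exact: El.
move=> h; have -> : (a *: S + T) h - (a *: S' + T') h = a *: (S h - S' h) + (T h - T' h).
  by rewrite !opD !opZ scalerBr opprD addrACA.
apply: le_trans (fnormD _ _) _; rewrite fnormZ.
apply: le_trans (lerD (ler_wpM2l (sqrtr_ge0 _) (hS' h)) (hT' h)) _.
rewrite [leRHS](_ : _ = M * (e / (2 * M) * fnorm h) + e / 2 * fnorm h); last first.
  by field; rewrite gt_eqF.
rewrite lerD2r ler_wpM2r ?lerDl //.
by rewrite mulr_ge0 ?fnorm_ge0 // divr_ge0 ?(ltW e0) // mulr_ge0 // ltW.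
Qed.

Lemma adj_disk_lin a S T : adj_disk S -> adj_disk T -> adj_disk (a *: S + T).
Proof.
apply: opclosure_lin => _ _ [p _ <-] [q _ <-]; exists (a^* *: p + q) => //.
by rewrite evalL_adjD evalL_adjZ conjCK.
Qed.

Lemma adj_disk_poly p : adj_disk (evalL_adj p).
Proof. by apply: subset_opclosure; exists p. Qed.

Lemma adj_disk0 : adj_disk 0.
Proof.
by rewrite -(malg_map0 (@Num.conj C) (@Lword_adj R d : {fmonom 'I_d} -> op)); exact: adj_disk_poly.
Qed.

Lemma adj_disk_sum (I : Type) (r : seq I) (P : pred I) (a : I -> C) (F : I -> op) :
  (forall i, adj_disk (F i)) -> adj_disk (\sum_(i <- r | P i) a i *: F i).
Proof.
move=> hF; elim: r => [|i r IH]; first by rewrite big_nil; exact: adj_disk0.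
rewrite big_cons; case: (P i); last exact: IH.
by apply: adj_disk_lin; [exact: hF|exact: IH].
Qed.

Lemma evalL_adj_zmon w : evalL_adj (zmon R w) = Lword_adj w.
Proof. by rewrite evalL_adjE /zmon malg_mapU rmorph1 scale1r. Qed.

Lemma adj_disk_word w : adj_disk (Lword_adj w).
Proof. by rewrite -evalL_adj_zmon; exact: adj_disk_poly. Qed.

Lemma adj_disk_id : adj_disk id.
Proof. exact: (adj_disk_word [::]). Qed.

Lemma evalL_adj_bounded p : exists2 M : R, 0 <= M & forall h, fnorm (evalL_adj p h) <= M * fnorm h.
Proof.
exists (\sum_(m <- msupp p) Num.sqrt (sqabs (p@_m)^*)).
  by apply: sumr_ge0 => m _; exact: sqrtr_ge0.
move=> h; rewrite /evalL_adj fct_sumE mulr_suml.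
apply: (@le_trans _ _ (\sum_(m <- msupp p) fnorm (((p@_m)^* *: Lword_adj m : op) h))).
  elim/big_rec2: _ => [|m y1 y2 _ IH]; first by rewrite fnorm0.
  by apply: le_trans (fnormD _ _) _; rewrite lerD2l.
apply: ler_sum => m _; rewrite opZ fnormZ ler_wpM2l ?sqrtr_ge0 //.
exact: fnorm_Lword_adj.
Qed.

Lemma adj_disk_bounded S : adj_disk S ->
  exists2 M : R, 0 <= M & forall h, fnorm (S h) <= M * fnorm h.
Proof.
move=> hS; have [_ [p _ <-] hp] := hS _ ltr01.
have [M M0 hM] := evalL_adj_bounded p; exists (1 + M); first by rewrite addr_ge0.
move=> h; rewrite -[S h](subrK (evalL_adj p h)) mulrDl.
by apply: le_trans (fnormD _ _) _; exact: lerD.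
Qed.

Lemma adj_disk_system S : adj_disk S -> disk_system S.
Proof.
move=> hS e e0; have [_ [p _ <-] hp] := hS _ e0; exists (evalL_adj p); last exact: hp.
have D0 q : disk_algebra (@evalL R d q) by apply: subset_opclosure; exists q.
exists (evalL 0), (evalL p), (evalL_adj p).
split; [exact: D0|exact: D0|exact: evalL_adjP|].
by rewrite evalLE malg_map0 add0r.
Qed.

Lemma disk_algebra_system S : disk_algebra S -> disk_system S.
Proof.
move=> hS; apply: subset_opclosure; exists S, (evalL 0), (evalL_adj 0); split.
- exact: hS.
- by apply: subset_opclosure; exists 0.
- exact: evalL_adjP.
- by rewrite evalL_adjE malg_map0 addr0.
Qed.

Lemma disk_system_lin a S T : disk_system S -> disk_system T -> disk_system (a *: S + T).
Proof.
have Dl b S1 S2 : disk_algebra S1 -> disk_algebra S2 -> disk_algebra (b *: S1 + S2 : op).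
  apply: opclosure_lin => _ _ [p _ <-] [q _ <-]; exists (b *: p + q) => //.
  by rewrite evalL_D evalL_Z.
apply: opclosure_lin => _ _ [S1 [S2 [S3 [h1 h2 h3 ->]]]] [T1 [T2 [T3 [k1 k2 k3 ->]]]].
exists (a *: S1 + T1), (a^* *: S2 + T2), (a *: S3 + T3); split; [exact: Dl|exact: Dl| |].
  move=> h g; rewrite !opD !opZ fdotDl fdotDr fdotZl fdotZr conjCK.
  by rewrite (h3 h g) (k3 h g).
by rewrite scalerDr addrACA.
Qed.

Lemma fdot_sqabs_le h g : sqabs (fdot h g) <= fnorm h ^+ 2 * fnorm g ^+ 2.
Proof. rewrite !fnormE !nrm_sqr; exact: (ip_CS (fockp R d)). Qed.

(* The adjoint is the norm limit of the operators evalL p_n when S is that of the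
   evalL_adj p_n. *)
Lemma adj_disk_adjoint S : adj_disk S ->
  exists2 S' : op, disk_algebra S' & forall h g, fdot (S' h) g = fdot h (S g).
Proof.
move=> hS; pose eps (n : nat) : R := n.+1%:R^-1.
have eps0 n : 0 < eps n by rewrite invr_gt0 ltr0n.
have /choice[p hp] : forall n, exists p, forall h, fnorm (S h - evalL_adj p h) <= eps n * fnorm h.
  by move=> n; have [_ [p _ <-] hp] := hS _ (eps0 n); exists p.
have epslim (e : R) : 0 < e -> exists N, forall n, (N <= n)%N -> eps n < e.
  move=> e0; have /cvgrPdist_lt/(_ _ e0)[N _ hN] := @cvg_harmonic R; exists N => n Nn.
  by have := hN _ Nn; rewrite /= sub0r normrN ger0_norm // ltW // eps0.
have pdiff m n h : fnorm (evalL (p m) h - evalL (p n) h) <= (eps m + eps n) * fnorm h.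
  apply: (@fnorm_adjoint _ _ (fun h => evalL (p m) h - evalL (p n) h)
    (fun h => evalL_adj (p m) h - evalL_adj (p n) h)) => [|h' g|g].
  - by rewrite addr_ge0 // ltW.
  - by rewrite fdotBl fdotBr !evalL_adjP.
  rewrite -(subrKA (S g)) mulrDl; apply: le_trans (fnormD _ _) _; apply: lerD; last exact: hp.
  by rewrite -fnormN opprB; exact: hp.
have pc h : cauchy_for_ip (fockp R d) (fun n => evalL (p n) h).
  move=> e e0.
  have f1 : 0 < fnorm h + 1 by rewrite ltr_wpDl ?fnorm_ge0.
  have se : 0 < Num.sqrt e by rewrite sqrtr_gt0.
  have [N hN] := epslim _ (divr_gt0 se (mulr_gt0 (ltr0n R 2) f1)).
  exists N => m n Nm Nn; rewrite -nrm_sqr -[ltRHS]sqr_sqrtr ?(ltW e0) //.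
  rewrite ltr_sqr ?nnegrE ?nrm_ge0 ?sqrtr_ge0 // -fnormE.
  apply: le_lt_trans (pdiff m n h) _.
  have := hN _ Nm; have := hN _ Nn; rewrite !ltr_pdivlMr ?mulr_gt0 //.
  have := fnorm_ge0 h; have := eps0 m; have := eps0 n.
  move: (eps m) (eps n) (fnorm h) (Num.sqrt e) => x y z t; nra.
have /choice[S' hS'] : forall h, exists y : fock, null_for_ip (fockp R d) (fun n => evalL (p n) h - y).
  by move=> h; have [y hy _] := fock_complete (pc h); exists y.
have S'adj h g : fdot (S' h) g = fdot h (S g).
  have l1 : ctends (fun n => fdot (evalL (p n) h) g) (fdot (S' h) g).
    have := ctendsD (null_ip g (hS' h)) (ctends_cst (fdot (S' h) g)); rewrite add0r.
    by apply: eq_ctends => n; rewrite -[fockp R d _ _]/(fdot _ _) -fdotDl subrK.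
  apply: ctends_unique l1 _; apply: ctends_eps => e e0.
  have se : 0 < Num.sqrt e by rewrite sqrtr_gt0.
  have f1 : 0 < fnorm h * fnorm g + 1 by rewrite ltr_wpDl ?mulr_ge0 ?fnorm_ge0.
  have [N hN] := epslim _ (divr_gt0 se f1); exists N => n Nn.
  rewrite evalL_adjP.
  have -> : fdot h (evalL_adj (p n) g) - fdot h (S g) = - fdot h (S g - evalL_adj (p n) g).
    by rewrite fdotBr opprB.
  rewrite sqabsN; apply: le_lt_trans (fdot_sqabs_le _ _) _.
  rewrite -exprMn -[ltRHS]sqr_sqrtr ?(ltW e0) // ltr_sqr ?nnegrE ?mulr_ge0 ?fnorm_ge0 ?sqrtr_ge0 //.
  apply: le_lt_trans (ler_wpM2l (fnorm_ge0 h) (hp n g)) _.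
  have := hN _ Nn; rewrite ltr_pdivlMr //; have := eps0 n.
  rewrite mulrCA; have := mulr_ge0 (fnorm_ge0 h) (fnorm_ge0 g).
  move: (eps n) (fnorm h * fnorm g) (Num.sqrt e) => x y z; nra.
exists S'; last exact: S'adj.
move=> e e0; have [N hN] := epslim _ e0.
exists (evalL (p N)); first by exists (p N).
apply: (@fnorm_adjoint _ _ (fun h => S' h - evalL (p N) h) (fun g => S g - evalL_adj (p N) g)).
- exact: ltW.
- by move=> h g; rewrite fdotBl fdotBr S'adj evalL_adjP.
move=> g; apply: le_trans (hp N g) _; rewrite ler_wpM2r ?fnorm_ge0 //.
exact/ltW/hN.
Qed.

Variable mu : ncMeasure R d.

Lemma mu0 : mu 0 = 0.
Proof.
have := @ncm_lin R d mu (-1) 0 0 (adj_disk_system adj_disk0) (adj_disk_system adj_disk0).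
by rewrite scaler0 addr0 mulN1r addNr.
Qed.

Lemma mu_sum (I : Type) (r : seq I) (P : pred I) (a : I -> C) (F : I -> op) :
  (forall i, adj_disk (F i)) ->
  mu (\sum_(i <- r | P i) a i *: F i) = \sum_(i <- r | P i) a i * mu (F i).
Proof.
move=> hF; elim: r => [|i r IH]; first by rewrite !big_nil mu0.
rewrite !big_cons; case: (P i); last exact: IH.
rewrite -IH; apply: ncm_lin; apply: adj_disk_system; first exact: hF.
exact: adj_disk_sum.
Qed.

Lemma mu_id_ge0 : 0 <= mu id.
Proof. by apply: ncm_ge0 => [|h]; [exact/adj_disk_system/adj_disk_id|exact: fdot_ge0]. Qed.

Lemma disk_systemZ a S : disk_system S -> disk_system (a *: S).
Proof.
move=> hS; rewrite -[a *: S]addr0.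
by apply: disk_system_lin; [exact: hS|exact: (adj_disk_system adj_disk0)].
Qed.

Lemma disk_systemD S T : disk_system S -> disk_system T -> disk_system (S + T).
Proof.
by move=> hS hT; rewrite -[S]scale1r; apply: disk_system_lin; [exact: hS|exact: hT].
Qed.

Lemma muZ a S : disk_system S -> mu (a *: S) = a * mu S.
Proof.
move=> hS; rewrite -[a *: S]addr0 (@ncm_lin _ _ mu a S 0 hS (adj_disk_system adj_disk0)).
by rewrite mu0 addr0.
Qed.

Lemma muD S T : disk_system S -> disk_system T -> mu (S + T) = mu S + mu T.
Proof.
by move=> hS hT; rewrite -{1}[S]scale1r (@ncm_lin _ _ mu 1 S T hS hT) mul1r.
Qed.

(* mu is positive on S + S^*, and mu (S^* ) has the same real part as mu S because mu is real
   on the self-adjoint operator i (S - S^* ), which becomes positive after adding a multiple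
   of the identity. *)
Lemma mu_Re_ge0 S : adj_disk S -> (forall h, 0 <= complex.Re (fdot h (S h))) ->
  0 <= complex.Re (mu S).
Proof.
move=> hS hpos; have [S' DS' adjS'] := adj_disk_adjoint hS.
have sS := adj_disk_system hS; have sS' := disk_algebra_system DS'.
have sI := adj_disk_system adj_disk_id.
have adjS2 h g : fdot h (S' g) = (fdot g (S h))^* by rewrite fdotC adjS'.
have pos1 : 0 <= mu (S + S').
  apply: ncm_ge0; first exact: (disk_systemD sS sS').
  move=> h; rewrite opD fdotDr adjS2; have := hpos h.
  case: (fdot h (S h)) => a b /= a0; rewrite lecE /= subrr eqxx /=.
  exact: addr_ge0.
have [M M0 hM] := adj_disk_bounded hS.
have s2 := disk_systemD (disk_systemZ 'i sS) (disk_systemZ (- 'i) sS').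
have s1 := disk_systemZ (2 * M)%:C sI.
(* The quadratic form of i (S - S') is -2 Im <h, S h>, which 2 M |h|^2 compensates. Reality of this
   value, together with that of [mu id], equates the real parts of [mu S] and [mu S']. *)
have pos2 : 0 <= mu ((2 * M)%:C *: id + ('i *: S + (- 'i) *: S')).
  apply: ncm_ge0; first exact: (disk_systemD s1 s2).
  move=> h; rewrite !opD !opZ !fdotDr !fdotZr adjS2.
  have le1 : `|complex.Im (fdot h (S h))| <= M * sqn (fockp R d) h.
    rewrite -ler_sqr ?nnegrE ?mulr_ge0 ?sqn_ge0 // real_normK ?num_real //.
    apply: (@le_trans _ _ (sqabs (fdot h (S h)))); first by rewrite /sqabs lerDr sqr_ge0.
    apply: le_trans (fdot_sqabs_le _ _) _; rewrite -exprMn.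
    rewrite ler_sqr ?nnegrE ?mulr_ge0 ?fnorm_ge0 ?sqn_ge0 //.
    rewrite -nrm_sqr -fnormE expr2 mulrCA; apply: ler_wpM2l; first exact: fnorm_ge0.
    exact: hM.
  have -> : fdot h h = (sqn (fockp R d) h)%:C by exact: (ip_sqn (fockp R d)).
  case: (fdot h (S h)) le1 => a b /=; rewrite ler_norml => /andP[b1 b2].
  rewrite lecE /=; apply/andP; split; first by apply/eqP; ring.
  move: (sqn _ _) b1 b2 => q b1 b2; nra.
move: pos1 pos2; rewrite (muD sS sS') (muD s1 s2) (muZ _ sI).
rewrite (muD (disk_systemZ 'i sS) (disk_systemZ (- 'i) sS')) (muZ _ sS) (muZ _ sS').
have := mu_id_ge0; case: (mu id) (mu S) (mu S') => [m m'] [a b] [c e].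
rewrite !lecE /= => /andP[/eqP m0 mg] /andP[/eqP h1 h2] /andP[/eqP h3 _].
move: h1 h2 h3; rewrite m0; lra.
Qed.

(** For |c| = 1 both e I + c S and e I - c S have nonnegative real part. The values c = 1 and c = i
    bound the real and imaginary parts of [mu S] separately, whence the factor 2. *)
Lemma mu_bound S (e : R) : adj_disk S -> 0 <= e -> (forall h, fnorm (S h) <= e * fnorm h) ->
  sqabs (mu S) <= 2 * (e * complex.Re (mu id)) ^+ 2.
Proof.
move=> hS e0 hSe.
have one (c : C) : sqabs c = 1 -> `|complex.Re (c * mu S)| <= e * complex.Re (mu id).
  move=> c1.
  have half (c' : C) : sqabs c' = 1 -> 0 <= complex.Re (e%:C * mu id + c' * mu S).
    move=> c'1.
    have K : adj_disk (e%:C *: id + (c' *: S + 0)).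
      apply: adj_disk_lin; first exact: adj_disk_id.
      by apply: adj_disk_lin; [exact: hS|exact: adj_disk0].
    have sS := adj_disk_system hS.
    have := mu_Re_ge0 K; rewrite addr0.
    rewrite (muD (disk_systemZ _ (adj_disk_system adj_disk_id)) (disk_systemZ c' sS)).
    rewrite (muZ _ (adj_disk_system adj_disk_id)) (muZ _ sS).
    apply=> h; rewrite opD !opZ fdotDr !fdotZr.
      have -> : fdot h h = (sqn (fockp R d) h)%:C by exact: (ip_sqn (fockp R d)).
      have : `|complex.Re (c' * fdot h (S h))| <= e * sqn (fockp R d) h.
        rewrite -fdotZr; apply: le_trans (Re_ip_le (fockp R d) _ _) _.
        rewrite -!fnormE fnormZ c'1 sqrtr1 mul1r -nrm_sqr -fnormE expr2 mulrCA.
        by apply: ler_wpM2l; [exact: fnorm_ge0|exact: hSe].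
      move: (sqn _ _) (c' * fdot h (S h)) => q [x y] /=; rewrite ler_norml => /andP[h1 _].
      nra.
  have h1 := half _ c1; have := half (- c); rewrite sqabsN => /(_ c1) h2.
  move: h1 h2; rewrite mulNr ler_norml; case: (mu id) (c * mu S) => [m m'] [x y] /=.
  by move=> h1 h2; apply/andP; split; nra.
have h1 : `|complex.Re (mu S)| <= e * complex.Re (mu id).
  by rewrite -[mu S]mul1r; apply: one; rewrite /sqabs /= expr1n expr0n /= addr0.
have h2 : `|complex.Im (mu S)| <= e * complex.Re (mu id).
  have := one 'i; rewrite /sqabs /= expr1n expr0n /= add0r => /(_ erefl).
  by case: (mu S) => a b /=; rewrite mul0r mul1r sub0r normrN.
have m0 : 0 <= e * complex.Re (mu id).
  by rewrite mulr_ge0 //; have := mu_id_ge0; rewrite lecE => /andP[].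
have sq (x : R) : `|x| <= e * complex.Re (mu id) -> x ^+ 2 <= (e * complex.Re (mu id)) ^+ 2.
  by move=> h; rewrite -real_normK ?num_real // ler_sqr ?nnegrE.
by rewrite mulr2n mulrDl mul1r; apply: lerD; exact: sq.
Qed.

Lemma mu_Lword_adj w : mu (Lword_adj w) = moment mu w.
Proof.
rewrite /moment /mu_form evalL_adj_zmon; congr (ncm mu _); apply/funext => h /=.
have -> : evalL 1 h = h; last by [].
have -> : (1 : fpoly) = zmon R [::] by rewrite zmon_nil.
by rewrite evalLE /zmon malg_mapU scale1r.
Qed.

End DiskOperators.

(** * The Herglotz transform *)

Section Herglotz.
Variables (R : realType) (d : nat).
Local Notation C := R[i].
Local Notation word := (seq 'I_d).
Local Notation fock := (fock R d).
Local Notation op := (fock -> fock).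
Implicit Types (h g : fock) (w : word).

Lemma Lword_adj_cat u v h : Lword_adj (u ++ v) h = Lword_adj v (Lword_adj u h).
Proof. by elim: u h => //= k u IH h; rewrite IH. Qed.

Lemma Lword_adj_rev_cons k w h :
  Lword_adj (rev (k :: w)) h = Lop_adj k (Lword_adj (rev w) h).
Proof. by rewrite rev_cons -cats1 Lword_adj_cat. Qed.

Lemma Lword_adj_sum (I : Type) (r : seq I) (a : I -> C) (F : I -> fock) w :
  Lword_adj w (\sum_(i <- r) a i *: F i) = \sum_(i <- r) a i *: Lword_adj w (F i).
Proof.
elim: r => [|i r IH]; first by rewrite !big_nil Lword_adj0.
by rewrite !big_cons Lword_adj_lin IH.
Qed.

Lemma Lop_adj_sum (I : Type) (r : seq I) (a : I -> C) (F : I -> fock) k :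
  Lop_adj k (\sum_(i <- r) a i *: F i) = \sum_(i <- r) a i *: Lop_adj k (F i).
Proof. exact: (Lword_adj_sum r a F [:: k]). Qed.

Lemma tuple_sumS (V : zmodType) (f : word -> V) m :
  \sum_(w : m.+1.-tuple 'I_d) f w = \sum_k \sum_(w : m.-tuple 'I_d) f (k :: w).
Proof.
have := sum_ltS f m.+1; rewrite {1}/sum_lt big_ord_recr /= -/(sum_lt f m.+1) sum_ltS -addrA.
move=> /addrI; under [RHS]eq_bigr do rewrite /sum_lt big_ord_recr /=.
by rewrite big_split /= => /addrI.
Qed.

Variables (n : nat) (Z : 'I_d -> 'M[C]_n).
Local Notation T := (ZLadj Z).

(** Entry (i, l) of the m-th power of [Z L^*]. The word is reversed because each new factor acts
    last, whereas [Lword_adj] applies the adjoint of the first letter first. *)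
Definition wordop m i l : op := \sum_(w : m.-tuple 'I_d) mxword Z w i l *: Lword_adj (rev w).

Lemma wordopE m i l h :
  wordop m i l h = \sum_(w : m.-tuple 'I_d) mxword Z w i l *: Lword_adj (rev w) h.
Proof. by rewrite /wordop fct_sumE. Qed.

Lemma iter_ZLadj m (X : 'I_n -> fock) i : iter m T X i = \sum_l wordop m i l (X l).
Proof.
elim: m i => [|m IH] i.
  rewrite /= (bigD1 i) //= big1 ?addr0 => [|l /negbTE li]; rewrite wordopE.
    rewrite (big_pred1 [tuple]); last by move=> t; apply/esym/eqP; exact: tuple0.
    by rewrite mxE eqxx scale1r.
  rewrite big1 // => t _; have -> : t = [tuple] by exact: tuple0.
  by rewrite mxE eq_sym li scale0r.
rewrite iterS /ZLadj; under eq_bigr do under eq_bigr do rewrite IH.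
under [RHS]eq_bigr => l _ do rewrite wordopE
  (tuple_sumS (fun w => mxword Z w i l *: Lword_adj (rev w) (X l))).
rewrite [RHS]exchange_big; apply: eq_bigr => k _ /=.
have Lsum (F : 'I_n -> fock) : Lop_adj k (\sum_l F l) = \sum_l Lop_adj k (F l).
  elim: (index_enum _) => [|l r IH']; first by rewrite !big_nil; exact: (Lword_adj0 R [:: k]).
  by rewrite !big_cons -IH'; have := Lop_adj_lin k 1 (F l) (\sum_(j <- r) F j); rewrite !scale1r.
under eq_bigr do rewrite Lsum scaler_sumr.
rewrite exchange_big; apply: eq_bigr => l _ /=.
under eq_bigr do rewrite wordopE Lop_adj_sum scaler_sumr.
rewrite exchange_big; apply: eq_bigr => w _ /=.
rewrite mxE scaler_suml; apply: eq_bigr => j _.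
by rewrite scalerA Lword_adj_rev_cons.
Qed.

Definition dvec (j : 'I_n) h : 'I_n -> fock := fun l => if l == j then h else 0.

Lemma wordop0 m i l : wordop m i l 0 = 0.
Proof. by rewrite wordopE big1 // => w _; rewrite Lword_adj0 scaler0. Qed.

Lemma iter_ZLadj_dvec m i j h : iter m T (dvec j h) i = wordop m i j h.
Proof.
rewrite iter_ZLadj (bigD1 j) //= /dvec eqxx big1 ?addr0 // => l /negbTE ->.
exact: wordop0.
Qed.

Lemma nrm_dvec j h : nrm (vdot R d n) (dvec j h) = fnorm h.
Proof.
rewrite /nrm sqn_vdot (bigD1 j) //= /dvec eqxx big1 ?addr0 // => l /negbTE ->.
exact: sqn0.
Qed.

Hypothesis Zball : in_ball Z.

Lemma ball_contraction : exists2 rho : R, 0 < rho < 1 & forall y : 'I_d -> 'cV[C]_n,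
  sqn (@cvdot R n) (\sum_k Z k *m y k) <= rho * \sum_k sqn (@cvdot R n) (y k).
Proof.
have [rho rho01 h] := in_ball_strict Zball; exists rho => //.
by apply: row_contraction => //; case/andP: rho01.
Qed.

Lemma nrm_iter_ZLadj (rho : R) m X : 0 < rho < 1 ->
  (forall y : 'I_d -> 'cV[C]_n,
    sqn (@cvdot R n) (\sum_k Z k *m y k) <= rho * \sum_k sqn (@cvdot R n) (y k)) ->
  nrm (vdot R d n) (iter m T X) <= Num.sqrt rho ^+ m * nrm (vdot R d n) X.
Proof.
move=> rho01 Zrow; have [r0 _] := andP rho01.
rewrite nrm_le_sqr; last by rewrite mulr_ge0 ?exprn_ge0 ?sqrtr_ge0 ?nrm_ge0.
rewrite exprMn nrm_sqr -exprM mulnC exprM sqr_sqrtr ?(ltW r0) //.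
exact: iter_ZLadj_contraction.
Qed.

Lemma fnorm_coord (X : 'I_n -> fock) i : fnorm (X i) <= nrm (vdot R d n) X.
Proof. by rewrite fnormE ler_wsqrtr // sqn_vdot_coord. Qed.

Lemma wordop_small : exists2 s : R, 0 <= s < 1 &
  forall m i l h, fnorm (wordop m i l h) <= s ^+ m * fnorm h.
Proof.
have [rho rho01 Zrow] := ball_contraction; have [r0 r1] := andP rho01.
exists (Num.sqrt rho).
  by rewrite sqrtr_ge0 -[ltRHS]sqrtr1 ltr_sqrt.
move=> m i l h; rewrite -iter_ZLadj_dvec; apply: le_trans (fnorm_coord _ _) _.
by rewrite -(nrm_dvec l h); exact: nrm_iter_ZLadj.
Qed.

Lemma inv_subZL_ball : let f := fun X => X - T X in
  cancel f (inv_op f) /\ cancel (inv_op f) f.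
Proof. by have [rho rho01 Zrow] := ball_contraction; exact: (inv_subZL rho01). Qed.

Definition entry_op i j : op := fun h => herglotz_op Z (dvec j h) i.

(* (I + T) (I - T)^-1 = 2 (I - T)^-1 - I. *)
Definition neumann_op N i j : op :=
  (2 : C) *: (\sum_(m < N) (1 : C) *: wordop m i j) + (- (i == j)%:R : C) *: id.

(** With (I - T) Y = [dvec j h], the truncation error is exactly 2 T^N Y. Here |Y| <= |h| / (1 - s)
    and T^N contracts by s^N, where s is the square root of the contraction constant. *)
Lemma entry_op_neumann : exists s K : R, [/\ 0 <= s < 1, 0 <= K &
  forall N i j h, fnorm (entry_op i j h - neumann_op N i j h) <= (K * s ^+ N) * fnorm h].
Proof.
have [rho rho01 Zrow] := ball_contraction; have [r0 r1] := andP rho01.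
have s1 : Num.sqrt rho < 1 by rewrite -[ltRHS]sqrtr1 ltr_sqrt.
exists (Num.sqrt rho), (2 * (1 - Num.sqrt rho)^-1); split.
- by rewrite sqrtr_ge0.
- by rewrite mulr_ge0 // invr_ge0 subr_ge0 ltW.
move=> N i j h; have [_ invK] := inv_subZL_ball.
set Y := inv_op (fun X => X - T X) (dvec j h).
have YE : Y - T Y = dvec j h by exact: invK.
have Yexp m : Y = \sum_(l < m) iter l T (dvec j h) + iter m T Y.
  elim: m => [|m IH]; first by rewrite big_ord0 add0r.
  rewrite big_ord_recr /= -addrA [iter m T _ + _](_ : _ = iter m T Y) //.
  rewrite -iterS -YE; elim: m {IH} => [|m IH] /=; first by rewrite subrK.
  by rewrite -ZLadjD IH.
have -> : entry_op i j h - neumann_op N i j h = (2 : C) *: iter N T Y i.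
  have -> : entry_op i j h = (2 : C) *: Y i - dvec j h i.
    have e : T Y = Y - dvec j h by rewrite -YE opprB addrCA subrr addr0.
    rewrite /entry_op /herglotz_op /= -/Y.
    transitivity (Y i + T Y i) => //; rewrite e.
    transitivity (Y i + (Y i - dvec j h i)) => //.
    by rewrite addrA -[Y i + Y i](mulr2n) scaler_nat.
  have -> : neumann_op N i j h =
      (2 : C) *: (\sum_(l < N) iter l T (dvec j h) i) - dvec j h i.
    rewrite /neumann_op opD !opZ; congr (_ + _).
      rewrite fct_sumE; congr (_ *: _); apply: eq_bigr => m _.
      by rewrite opZ scale1r iter_ZLadj_dvec.
    by rewrite /dvec; case: (i == j); rewrite ?scaleN1r // oppr0 scale0r oppr0.
  rewrite {1}(Yexp N) opprB addrA subrK -scalerBr; congr (_ *: _).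
  transitivity ((\sum_(l < N) iter l T (dvec j h)) i + iter N T Y i -
    \sum_(l < N) iter l T (dvec j h) i) => //.
  by rewrite fct_sumE addrC addKr.
rewrite fnormZ; have -> : Num.sqrt (sqabs (2 : C)) = 2 :> R.
  have -> : (2 : C) = 2%:C by rewrite rmorph_nat.
  by rewrite /sqabs /= expr0n /= addr0 sqrtr_sqr ger0_norm.
rewrite -!mulrA ler_pM2l // mulrCA; apply: le_trans (fnorm_coord _ _) _.
apply: le_trans (nrm_iter_ZLadj _ _ rho01 Zrow) _.
apply: ler_wpM2l; first by rewrite exprn_ge0 ?sqrtr_ge0.
rewrite -(nrm_dvec j h) -YE; exact: subZL_bounded.
Qed.

Lemma adj_disk_wordop m i j : adj_disk (wordop m i j).
Proof. by apply: adj_disk_sum => w; exact: adj_disk_word. Qed.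

Lemma adj_disk_neumann N i j : adj_disk (neumann_op N i j).
Proof.
rewrite /neumann_op; apply: adj_disk_lin.
  by apply: adj_disk_sum => m; exact: adj_disk_wordop.
rewrite -[_ *: id]addr0; apply: adj_disk_lin; first exact: adj_disk_id.
exact: adj_disk0.
Qed.

Lemma geometric_lim (s K : R) : 0 <= s < 1 -> (fun N => K * s ^+ N) @ \oo --> (0 : R).
Proof.
move=> /andP[s0 s1]; rewrite -[X in _ --> X](mulr0 K).
apply: cvgM; first exact: cvg_cst.
by apply: cvg_expr; rewrite ger0_norm.
Qed.

Lemma adj_disk_entry i j : adj_disk (entry_op i j).
Proof.
have [s [K [s01 K0 hN]]] := entry_op_neumann.
move=> e e0; have /cvgrPdist_lt/(_ _ (divr_gt0 e0 (ltr0n R 2)))[N _ h] := geometric_lim K s01.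
have [_ [p _ <-] hp] := adj_disk_neumann N i j (divr_gt0 e0 (ltr0n R 2)).
exists (evalL_adj p); first by exists p.
move=> g; rewrite -(subrKA (neumann_op N i j g)); apply: le_trans (fnormD _ _) _.
have -> : e * fnorm g = e / 2 * fnorm g + e / 2 * fnorm g by field.
apply: lerD; last exact: hp.
apply: le_trans (hN N i j g) _; rewrite ler_wpM2r ?fnorm_ge0 //.
have := h N (leqnn N); rewrite /= sub0r normrN => /ltW; apply: le_trans; exact: ler_norm.
Qed.

Variable mu : ncMeasure R d.

(* Word reversal turns (L^w)^* into L_{i_1}^* ... L_{i_m}^*, the order in which the powers of
   Z L^* produce the adjoints. *)
Definition rmoment w : C := moment mu (rev w).

Lemma herglotzE i j : herglotz mu Z i j = mu (entry_op i j).
Proof. by rewrite mxE. Qed.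

Lemma mu_wordop m i j :
  mu (wordop m i j) = \sum_(w : m.-tuple 'I_d) mxword Z w i j * rmoment w.
Proof.
rewrite /wordop mu_sum; last by move=> w; exact: adj_disk_word.
by apply: eq_bigr => w _; rewrite mu_Lword_adj.
Qed.

Lemma mu_neumann N i j : mu (neumann_op N i j) =
  2 * sum_lt (fun w => rmoment w * mxword Z w i j) N - (i == j)%:R * rmoment [::].
Proof.
have h1 : adj_disk (\sum_(m < N) (1 : C) *: wordop m i j).
  by apply: adj_disk_sum => m; exact: adj_disk_wordop.
have s1 := disk_systemZ (2 : C) (adj_disk_system h1).
have sI := adj_disk_system (@adj_disk_id R d).
rewrite /neumann_op (muD mu s1 (disk_systemZ _ sI)) (muZ mu _ (adj_disk_system h1)) (muZ mu _ sI).
rewrite mulNr; congr (_ * _ - _ * _); last by rewrite /rmoment -mu_Lword_adj.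
rewrite mu_sum; last by move=> m; exact: adj_disk_wordop.
apply: eq_bigr => m _; rewrite mul1r mu_wordop; apply: eq_bigr => w _; exact: mulrC.
Qed.

Lemma herglotz_lim i j :
  ctends (fun N => 2 * sum_lt (fun w => rmoment w * mxword Z w i j) N -
    (i == j)%:R * rmoment [::]) (herglotz mu Z i j).
Proof.
have [s [K [s01 K0 hN]]] := entry_op_neumann.
pose m0 := complex.Re (mu id).
apply: (@ctends_squeeze _ _ _ (fun N => 2 * ((K * m0 * s ^+ N) * (K * m0 * s ^+ N)))); last first.
  rewrite -[X in _ --> X](mulr0 2); apply: cvgM; first exact: cvg_cst.
  by rewrite -[X in _ --> X](mulr0 0); apply: cvgM; exact: geometric_lim.
move=> N; rewrite -mu_neumann herglotzE -sqabsN opprB.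
have hE := adj_disk_system (adj_disk_entry i j).
have hP := adj_disk_system (adj_disk_neumann N i j).
have -> : mu (entry_op i j) - mu (neumann_op N i j) =
   mu ((- 1 : C) *: neumann_op N i j + entry_op i j).
  by rewrite (muD mu (disk_systemZ _ hP) hE) (muZ mu _ hP) mulN1r addrC.
apply: le_trans (mu_bound (e := K * s ^+ N) mu _ _ _) _.
- by apply: adj_disk_lin; [exact: adj_disk_neumann|exact: adj_disk_entry].
- by rewrite mulr_ge0 // exprn_ge0 //; case/andP: s01.
- by move=> h; rewrite opD opZ scaleN1r addrC; exact: hN.
by rewrite -expr2 -/m0 mulrAC.
Qed.

(** Padding by x and y composes [wordop] with words in the [L_k^*] on either side. These do not
    increase norms, so the geometric decay of [wordop] remains and [mu_bound] transfers it to the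
    moments. *)
Lemma rmoment_decay (x y : word) i l :
  ctends (fun m => \sum_(w : m.-tuple 'I_d) rmoment (x ++ w ++ y) * mxword Z w i l) 0.
Proof.
have [s s01 hs] := wordop_small; have [s0 _] := andP s01.
pose D m : op := \sum_(w : m.-tuple 'I_d) mxword Z w i l *: Lword_adj (rev (x ++ w ++ y)).
pose m0 := complex.Re (mu id).
apply: (@ctends_squeeze _ _ _ (fun N => 2 * ((m0 * s ^+ N) * (m0 * s ^+ N)))); last first.
  rewrite -[X in _ --> X](mulr0 2); apply: cvgM; first exact: cvg_cst.
  by rewrite -[X in _ --> X](mulr0 0); apply: cvgM; exact: geometric_lim.
move=> m; rewrite subr0.
have -> : \sum_(w : m.-tuple 'I_d) rmoment (x ++ w ++ y) * mxword Z w i l = mu (D m).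
  rewrite /D mu_sum; last by move=> w; exact: adj_disk_word.
  by apply: eq_bigr => w _; rewrite mu_Lword_adj mulrC.
apply: le_trans (mu_bound (e := s ^+ m) mu _ _ _) _.
- by apply: adj_disk_sum => w; exact: adj_disk_word.
- exact: exprn_ge0.
- move=> h; have -> : D m h = Lword_adj (rev x) (wordop m i l (Lword_adj (rev y) h)).
    rewrite /D fct_sumE wordopE Lword_adj_sum; apply: eq_bigr => w _.
    by rewrite opZ !rev_cat !Lword_adj_cat.
  apply: le_trans (fnorm_Lword_adj _ _) _; apply: le_trans (hs _ _ _ _) _.
  by apply: ler_wpM2l; [exact: exprn_ge0|exact: fnorm_Lword_adj].
by rewrite expr2 -/m0 [m0 * _]mulrC.
Qed.

(** Let Y solve (I - T) Y = v (x) h. Then <h, S h> = <(I - T) Y, (I + T) Y>, whose real part is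
    |Y|^2 - |T Y|^2, nonnegative because T is a contraction; [mu_Re_ge0] concludes. *)
Lemma herglotz_Re_ge0 (v : 'cV[C]_n) :
  0 <= complex.Re (cvdot R n v (herglotz mu Z *m v)).
Proof.
pose S : op := \sum_(p : 'I_n * 'I_n) ((v p.1 0)^* * v p.2 0) *: entry_op p.1 p.2.
have -> : cvdot R n v (herglotz mu Z *m v) = mu S.
  rewrite /S mu_sum; last by move=> p; exact: adj_disk_entry.
  rewrite -(pair_bigA _ (fun i j => (v i 0)^* * v j 0 * mu (entry_op i j))) /=.
  apply: eq_bigr => i _; rewrite mxE mulr_sumr; apply: eq_bigr => j _.
  by rewrite herglotzE -mulrA [mu _ * _]mulrC.
apply: mu_Re_ge0; first by apply: adj_disk_sum => p; exact: adj_disk_entry.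
move=> h; have [_ invK] := inv_subZL_ball.
pose Yj j := inv_op (fun X => X - T X) (dvec j h).
have YjE j : Yj j - T (Yj j) = dvec j h by exact: invK.
pose Y : 'I_n -> fock := \sum_j v j 0 *: Yj j.
have TY : T Y = \sum_j v j 0 *: T (Yj j).
  rewrite /Y; elim: (index_enum _) => [|j r IH].
    by rewrite !big_nil; have := ZLadjB Z 0 0; rewrite !subrr.
  by rewrite !big_cons ZLadj_lin IH.
have -> : fdot h (S h) = vdot R d n (Y - T Y) (Y + T Y).
  rewrite /S fct_sumE [LHS](ip_sumr (fockp R d)).
  rewrite -(pair_bigA _ (fun i j => fockp R d h
    ((((v i 0)^* * v j 0) *: entry_op i j) h))) /=.
  apply: eq_bigr => i _.
  have -> : (Y - T Y) i = v i 0 *: h.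
    rewrite TY /Y -sumrB.
    rewrite fct_sumE (bigD1 i) //= big1 ?addr0 => [|j ji].
      by rewrite -scalerBr YjE /dvec; transitivity (v i 0 *: (if i == i then h else 0)) => //; rewrite eqxx.
    rewrite -scalerBr YjE /dvec.
    by transitivity (v j 0 *: (if i == j then h else 0)) => //; rewrite eq_sym (negbTE ji) scaler0.
  have -> : (Y + T Y) i = \sum_j v j 0 *: entry_op i j h.
    rewrite TY /Y -big_split /= fct_sumE; apply: eq_bigr => j _.
    by rewrite -scalerDr.
  rewrite fdotZl [fdot h _](ip_sumr (fockp R d)) mulr_sumr; apply: eq_bigr => j _ /=.
  by rewrite opZ !fdotZr mulrA.
rewrite ipBl !ipDr (ip_sym _ Y (T Y)) !ip_sqn.
have [rho rho01 Zrow] := ball_contraction; have [r0 r1] := andP rho01.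
have := ZLadj_contraction rho01 Zrow Y; have := sqn_ge0 (vdot R d n) Y.
case: (vdot R d n Y (T Y)) => a b; move: (sqn _ Y) (sqn _ (T Y)) => p q /=.
nra.
Qed.

End Herglotz.

(** * A rational Clark function forces finite Hankel rank *)

Section ClarkRational.
Variables (R : realType) (d : nat) (mu : ncMeasure R d).
Local Notation C := R[i].
Local Notation word := (seq 'I_d).

Lemma path_in_ball (w0 : word) : exists2 eps : C, eps != 0 &
  in_ball (fun k => path_mx w0 eps (svar C k)).
Proof.
(* M counts all the entries of the d matrices. Each has squared modulus at most e = 1/(M+1), so
   [small_in_ball] sees a sum at most M/(M+1). *)
pose M := (d * ((size w0).+1 * (size w0).+1))%N.
pose e : R := M.+1%:R^-1; have e0 : 0 < e by rewrite invr_gt0.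
have e1 : e <= 1 by rewrite invf_le1 // ler1n.
exists e%:C; first by rewrite eq_complex /= (gt_eqF e0).
apply: small_in_ball => //.
have entry k i j : sqabs (path_mx w0 e%:C (svar C k) i j) <= e.
  rewrite mxE; case: leqP => ij; last by rewrite sqabs0 ltW.
  have sv (u : word) : u != [::] -> size u != 1%N -> svar C k u = 0 by case: u => [|a [|b u]].
  have s1 (u : word) : sqabs (svar C k u) <= 1.
    case: u => [|a [|b u]] /=; rewrite ?sqabs0 //.
    by case: (a == k); rewrite /sqabs /= ?expr1n expr0n /= ?addr0.
  have [ji|n0] := eqVneq (j - i)%N 0%N.
    by rewrite /subword ji take0 /= mulr0 sqabs0 ltW.
  rewrite sqabsM.
  have se : sqabs (e%:C ^+ (j - i)) <= e.
    have -> : e%:C ^+ (j - i) = (e ^+ (j - i))%:C by rewrite rmorphXn.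
    rewrite /sqabs /= expr0n /= addr0 -exprM.
    rewrite -[leRHS]expr1; apply: ler_wiXn2l; rewrite ?(ltW e0) //.
    by rewrite muln_gt0 lt0n n0.
  rewrite -[leRHS]mulr1; apply: ler_pM => //; exact: sqabs_ge0.
apply: (@le_lt_trans _ _ (\sum_(k < d) \sum_(i < (size w0).+1) \sum_(j < (size w0).+1) e)).
  by do 3![apply: ler_sum => ? _]; exact: entry.
rewrite !sumr_const !card_ord -!mulrnA.
rewrite [X in e *+ X](_ : _ = M); last by rewrite /M mulnA mulnC.
by rewrite -mulr_natl /e ltr_pdivrMr // mul1r ltr_nat.
Qed.

Lemma zero_in_ball : in_ball (fun=> 0 : 'M[C]_1) (d := d).
Proof.
apply: small_in_ball => //; rewrite big1 // => k _; rewrite big1 // => i _.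
by rewrite big1 // => j _; rewrite mxE sqabs0.
Qed.

Lemma subword_full (w0 : word) : subword w0 0 (size w0) = w0.
Proof. by rewrite /subword subn0 drop0 take_size. Qed.

Lemma herglotz_path (w0 : word) (eps : C) : in_ball (fun k => path_mx w0 eps (svar C k)) ->
  herglotz mu (fun k => path_mx w0 eps (svar C k)) =
  2 *: path_mx w0 eps (rmoment mu) - (rmoment mu [::])%:M.
Proof.
move=> hb; apply/matrixP => i j; apply: ctends_unique (herglotz_lim hb mu i j) _.
apply: (@ctends_near _ (fun=> (2 *: path_mx w0 eps (rmoment mu) - (rmoment mu [::])%:M) i j)
   _ _ (size w0).+1); last exact: ctends_cst.
move=> N hN; rewrite path_mx_sum //; move: (path_mx _ _ _) => P.
by rewrite !mxE !mulr_natl.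
Qed.

Lemma clark_rational_finrank (b : ncfun R d) : nc_rational b -> is_clark_measure b mu ->
  finrank (moment mu).
Proof.
move=> [r rv hr] hc.
have [r0 [_ rr0 d0 b0]] := hr _ _ zero_in_ball.
have [u0 _] := hc _ _ zero_in_ball.
(* The Cayley transform of a representative regular at 0. It is itself regular there because 1 -
   b(0) is invertible. *)
pose e := RMul (RAdd (RConst d 1) r0) (RInv (RAdd (RConst d 1) (RMul (RConst d (-1)) r0))).
have de : rdom (fun=> 0 : 'M[C]_1) e.
  by rewrite /= d0 /= -b0 mul_scalar_mx scaleN1r.
pose t : C := 0 +i* complex.Im ((1 + b 1%N (fun=> 0) 0 0) / (1 - b 1%N (fun=> 0) 0 0)).
(* Evaluate at the path matrices of w itself and read the corner entry, [eps ^+ size w] times the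
   coefficient at w. The constants affect only the empty word, where the corner lies on the
   diagonal. *)
have key w : rmoment mu w = 2^-1 * ser e w + sconst ((rmoment mu [::] - t) / 2) w.
  have [eps eps0 hb] := path_in_ball w; set Z := fun k => _ in hb.
  have [_] := hc _ _ hb; have [r1 [_ rr1 d1 b1]] := hr _ _ hb.
  have [dZe vZe] := path_mx_reval w eps de; have [dZ0 _] := path_mx_reval w eps d0.
  (* The representative valid at [Z] depends on w. It is replaced by the single [r0], also defined
     at [Z], so that one series serves all words. *)
  have e01 : b _ Z = reval Z r0 by rewrite b1; apply: requiv_at rv rr1 rr0 _ d1 dZ0.
  have -> : (1%:M + b _ Z) *m invmx (1%:M - b _ Z) = reval Z e.
    by rewrite /= e01 mul_scalar_mx scaleN1r.
  rewrite vZe herglotz_path // -/t; move: {dZe vZe} (ser e) => f /matrixP/(_ ord0 ord_max).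
  rewrite !mxE /= subn0 subword_full => h.
  have n0 := expf_neq0 (size w) eps0.
  have two0 : (2 : C) != 0 by rewrite pnatr_eq0.
  case: w Z hb eps0 h n0 {dZ0 e01 b1 d1} => [|k w] Z hb eps0 h n0.
    move: h; rewrite /= expr0 !mul1r !mulr1n => ->.
    by field.
  move: h; rewrite /= !mulr0n subr0 addr0 mulrCA => h'.
  have -> : f (k :: w) = 2 * rmoment mu (k :: w) by apply: (mulfI n0); exact: h'.
  by rewrite mulKf // addr0.
have fr : finrank (rmoment mu).
  have -> : rmoment mu = fun w => 2^-1 * ser e w + sconst ((rmoment mu [::] - t) / 2) w.
    exact/funext.
  by apply: finrankD; [exact/finrankZ/finrank_ser|exact: finrank_const].
have -> : moment mu = fun w => rmoment mu (rev w).
  by apply/funext => w; exact: (congr1 (moment mu) (esym (revK w))).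
exact: finrank_rev.
Qed.

End ClarkRational.

(** * Realizations and inverses of pencils *)

Section ExpressionMatrices.
Variables (R : realType) (d : nat).
Local Notation C := R[i].
Local Notation rexpr := (rexpr R d).

Definition rsum (s : seq rexpr) : rexpr := foldr (@RAdd R d) (RConst d 0) s.

Lemma reval_rsum n (W : 'I_d -> 'M[C]_n) (s : seq rexpr) :
  reval W (rsum s) = \sum_(e <- s) reval W e.
Proof.
elim: s => [|e s IH] /=; first by rewrite big_nil raddf0.
by rewrite big_cons IH.
Qed.

Lemma rdom_rsum n (W : 'I_d -> 'M[C]_n) (s : seq rexpr) :
  rdom W (rsum s) = all (rdom W) s.
Proof. by elim: s => //= e s ->. Qed.

Definition ematrix m n := 'I_m -> 'I_n -> rexpr.

Definition emul m n p (A : ematrix m n) (B : ematrix n p) : ematrix m p :=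
  fun i j => rsum [seq RMul (A i k) (B k j) | k <- enum 'I_n].

Definition eadd m n (A B : ematrix m n) : ematrix m n := fun i j => RAdd (A i j) (B i j).

Definition eopp m n (A : ematrix m n) : ematrix m n := fun i j => RMul (RConst d (-1)) (A i j).

Definition econst m n (c : 'M[C]_(m, n)) : ematrix m n := fun i j => RConst d (c i j).

Definition edom n (W : 'I_d -> 'M[C]_n) m p (A : ematrix m p) : Prop :=
  forall i j, rdom W (A i j).

Lemma edom_mul n (W : 'I_d -> 'M[C]_n) m p q (A : ematrix m p) (B : ematrix p q) :
  edom W A -> edom W B -> edom W (emul A B).
Proof.
move=> hA hB i j; rewrite rdom_rsum all_map; apply/allP => k _ /=.
by rewrite hA hB.
Qed.

(** The domain of a product sees every entry of the factors. The index [j] guarantees that the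
    product has a column, without which its domain condition would be empty. *)
Lemma edom_mull n (W : 'I_d -> 'M[C]_n) m p q (A : ematrix m p) (B : ematrix p q) (j : 'I_q) :
  edom W (emul A B) -> edom W A.
Proof.
move=> h i k; have := h i j; rewrite rdom_rsum all_map => /allP/(_ k).
by rewrite mem_enum => /(_ isT)/andP[].
Qed.

Lemma edom_mulr n (W : 'I_d -> 'M[C]_n) m p q (A : ematrix m p) (B : ematrix p q) (i : 'I_m) :
  edom W (emul A B) -> edom W B.
Proof.
move=> h k j; have := h i j; rewrite rdom_rsum all_map => /allP/(_ k).
by rewrite mem_enum => /(_ isT)/andP[].
Qed.

Lemma edom_add n (W : 'I_d -> 'M[C]_n) m p (A B : ematrix m p) :
  edom W A -> edom W B -> edom W (eadd A B).
Proof. by move=> hA hB i j; rewrite /= hA hB. Qed.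

Lemma edom_opp n (W : 'I_d -> 'M[C]_n) m p (A : ematrix m p) :
  edom W A -> edom W (eopp A).
Proof. by move=> hA i j; rewrite /= hA. Qed.

Section Evaluation.
Variables (n : nat) (W : 'I_d -> 'M[C]_n.+1).

Definition eeval m p (A : ematrix m p) : 'M['M[C]_n.+1]_(m, p) :=
  \matrix_(i, j) reval W (A i j).

Lemma eeval_mul m p q (A : ematrix m p) (B : ematrix p q) :
  eeval (emul A B) = eeval A *m eeval B.
Proof.
apply/matrixP => i j; rewrite !mxE reval_rsum big_map big_enum /=.
by apply: eq_bigr => k _; rewrite !mxE.
Qed.

Lemma eeval_add m p (A B : ematrix m p) : eeval (eadd A B) = eeval A + eeval B.
Proof. by apply/matrixP => i j; rewrite !mxE. Qed.

Lemma eeval_opp m p (A : ematrix m p) : eeval (eopp A) = - eeval A.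
Proof. by apply/matrixP => i j; rewrite !mxE /= mul_scalar_mx scaleN1r. Qed.

Lemma eeval_const m p (c : 'M[C]_(m, p)) : eeval (econst c) = map_mx (fun a => a%:M) c.
Proof. by apply/matrixP => i j; rewrite !mxE. Qed.

End Evaluation.

Definition ereblock m1 m2 p1 p2 (A : ematrix m1 p1) (B : ematrix m1 p2)
    (D : ematrix m2 p1) (E : ematrix m2 p2) : ematrix (m1 + m2) (p1 + p2) :=
  fun i j => match fintype.split i, fintype.split j with
    | inl i, inl j => A i j | inl i, inr j => B i j
    | inr i, inl j => D i j | inr i, inr j => E i j end.

Lemma splitL m p (i : 'I_m) : fintype.split (lshift p i) = inl i.
Proof. exact: (unsplitK (inl i)). Qed.

Lemma splitR m p (i : 'I_p) : fintype.split (rshift m i) = inr i.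
Proof. exact: (unsplitK (inr i)). Qed.

Lemma eeval_block n (W : 'I_d -> 'M[C]_n.+1) m1 m2 p1 p2 (A : ematrix m1 p1)
    (B : ematrix m1 p2) (D : ematrix m2 p1) (E : ematrix m2 p2) :
  eeval W (ereblock A B D E) =
  block_mx (eeval W A) (eeval W B) (eeval W D) (eeval W E).
Proof.
apply/matrixP => i j; rewrite -[ i ]splitK -[ j ]splitK.
case: (fintype.split i) => p; case: (fintype.split j) => q /=;
  rewrite ?block_mxEul ?block_mxEur ?block_mxEdl ?block_mxEdr;
  by rewrite !mxE /ereblock !(splitL, splitR).
Qed.

Lemma eeval_submx n (W : 'I_d -> 'M[C]_n.+1) m1 m2 p1 p2 (M : ematrix (m1 + m2) (p1 + p2)) :
  eeval W M = block_mx
    (eeval W (fun i j => M (lshift m2 i) (lshift p2 j)))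
    (eeval W (fun i j => M (lshift m2 i) (rshift p1 j)))
    (eeval W (fun i j => M (rshift m1 i) (lshift p2 j)))
    (eeval W (fun i j => M (rshift m1 i) (rshift p1 j))).
Proof.
apply/matrixP => i j; rewrite -[ i ]splitK -[ j ]splitK.
case: (fintype.split i) => p; case: (fintype.split j) => q /=;
  rewrite ?block_mxEul ?block_mxEur ?block_mxEdl ?block_mxEdr;
  by rewrite !mxE.
Qed.

(* Gaussian elimination without pivoting: at a point where the matrix evaluates to the
   identity all pivots are 1. *)
Lemma ematrix_inverse N (M : ematrix N N) n (Z : 'I_d -> 'M[C]_n.+1) :
  edom Z M -> eeval Z M = 1%:M ->
  exists2 Q : ematrix N N, edom Z Q &
    forall m (W : 'I_d -> 'M[C]_m.+1), edom W Q ->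
      eeval W M *m eeval W Q = 1%:M /\ eeval W Q *m eeval W M = 1%:M.
Proof.
elim: N M => [|N IH] M domM valM.
  by exists M => // m W _; split; apply/matrixP => -[].
pose a : ematrix 1 1 := fun i j => M (lshift N i) (lshift N j).
pose b : ematrix 1 N := fun i j => M (lshift N i) (rshift 1 j).
pose c : ematrix N 1 := fun i j => M (rshift 1 i) (lshift N j).
pose D : ematrix N N := fun i j => M (rshift 1 i) (rshift 1 j).
pose ai : ematrix 1 1 := fun i j => RInv (a i j).
have Mblock m (W : 'I_d -> 'M[C]_m.+1) : eeval W M =
    block_mx (eeval W a) (eeval W b) (eeval W c) (eeval W D).
  exact: (@eeval_submx _ W 1 N 1 N).
have vals : block_mx (eeval Z a) (eeval Z b) (eeval Z c) (eeval Z D) =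
    block_mx 1%:M 0 0 1%:M := etrans (esym (Mblock n Z)) (etrans valM (scalar_mx_block 1 N _)).
have [va vb vc vD] := eq_block_mx vals.
have domai : edom Z ai.
  move=> i j; rewrite /= domM /=.
  by have /matrixP/(_ i j) := va; rewrite !mxE !ord1 /= => ->; exact: unitmx1.
(* The Schur complement of the first pivot. At [Z] the off-diagonal blocks vanish, so it is again
   the identity there and the induction applies. *)
pose S := eadd D (eopp (emul (emul c ai) b)).
have domb : edom Z b by move=> i j; exact: domM.
have domc : edom Z c by move=> i j; exact: domM.
have domD : edom Z D by move=> i j; exact: domM.
have domS : edom Z S.
  by apply: edom_add => //; apply: edom_opp; do 2!apply: edom_mul => //.
have valS : eeval Z S = 1%:M.
  by rewrite eeval_add eeval_opp !eeval_mul vb vD mulmx0 oppr0 addr0.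
have [Q' domQ' hQ'] := IH S domS valS.
pose q11 : ematrix 1 1 := eadd ai (emul (emul (emul ai b) Q') (emul c ai)).
pose q12 : ematrix 1 N := eopp (emul (emul ai b) Q').
pose q21 : ematrix N 1 := eopp (emul Q' (emul c ai)).
pose Q : ematrix (1 + N) (1 + N) := ereblock q11 q12 q21 Q'.
exists Q.
  move=> i j; rewrite -[ i ](@splitK 1 N) -[ j ](@splitK 1 N).
  case: (@fintype.split 1 N i) => p; case: (@fintype.split 1 N j) => q;
    rewrite /Q /ereblock /unsplit !(splitL, splitR); move: p q => p q.
  - by apply: edom_add => //; apply: edom_mul; do 2?apply: edom_mul.
  - by apply: edom_opp; do 2?apply: edom_mul.
  - by apply: edom_opp; do 2?apply: edom_mul.
  - exact: domQ'.
move=> m W domW.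
have dQ' : edom W Q'.
  move=> p q; have := domW (rshift 1 p) (rshift 1 q).
  by rewrite /Q /ereblock !splitR.
(* The inverted pivot is a summand of the corner block of Q, so it is defined wherever Q is, and the
   pivot is invertible at [W]. *)
have dai : rdom W (ai 0 0).
  have := domW (lshift N (0 : 'I_1)) (lshift N (0 : 'I_1)).
  by rewrite /Q /ereblock !splitL => /andP[].
have ua : reval W (a 0 0) \in unitmx by have /andP[] := dai.
have aai : eeval W a *m eeval W ai = 1%:M.
  by apply/matrixP => i j; rewrite !ord1 !mxE big_ord1 !mxE; exact: mulmxV.
have aia : eeval W ai *m eeval W a = 1%:M.
  by apply/matrixP => i j; rewrite !ord1 !mxE big_ord1 !mxE; exact: mulVmx.
have [SQ QS] := hQ' m W dQ'.
have QE : eeval W Q = block_mx (eeval W q11) (eeval W q12) (eeval W q21) (eeval W Q') :=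
  eeval_block W q11 q12 q21 Q'.
rewrite Mblock QE !(eeval_add, eeval_opp, eeval_mul).
rewrite /S !(eeval_add, eeval_opp, eeval_mul) in SQ QS.
move: (eeval W a) (eeval W ai) (eeval W b) (eeval W c) (eeval W D) (eeval W Q') aai aia SQ QS.
move=> A Ai B E F G aai aia SQ QS.
have FG : F *m G = 1%:M + E *m Ai *m B *m G by rewrite -SQ mulmxBl subrK.
have GF : G *m F = 1%:M + G *m E *m Ai *m B by rewrite -QS mulmxBr !mulmxA subrK.
split; apply: etrans (@mulmx_block _ 1 N 1 N 1 N _ _ _ _ _ _ _ _) _;
  apply: etrans _ (esym (scalar_mx_block 1 N _)); congr block_mx.
- by rewrite mulmxDr mulmxN !mulmxA aai mul1mx addrK.
- by rewrite mulmxN !mulmxA aai mul1mx addNr.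
- by rewrite mulmxDr mulmxN !mulmxA FG !mulmxDl !mul1mx subrr.
- by rewrite mulmxN !mulmxA FG addrC addrK.
- by rewrite mulmxDl aia mulNmx -!mulmxA aia mulmx1 addrK.
- by rewrite mulmxDl mulNmx -(mulmxA (Ai *m B) G F) GF mulmxDr mulmx1 !mulmxA subrr.
- by rewrite mulNmx -!mulmxA aia mulmx1 addNr.
- by rewrite mulNmx GF !mulmxA addrC addrK.
Qed.

End ExpressionMatrices.

(** * Inverses that are polynomials in the matrix *)

Section PolynomialInverse.
Variable R : realType.
Local Notation C := R[i].

(** A list of coefficients in Horner form: the same list is later evaluated at block matrices and at
    matrices of expressions. *)
Definition horner_seq n (s : seq C) (A : 'M[C]_n) : 'M[C]_n :=
  foldr (fun c P => c%:M + A *m P) 0 s.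

Lemma horner_mx_seq n (A : 'M[C]_n.+1) (s : seq C) :
  horner_mx A (Poly s) = horner_seq s A.
Proof.
elim: s => [|c s IH] /=; first by rewrite rmorph0.
rewrite cons_poly_def mulrC rmorphD rmorphM /= horner_mx_X horner_mx_C addrC.
by rewrite -IH mulmxE.
Qed.

(* By Cayley-Hamilton the inverse of 1 - A is a polynomial in A, once 1 is not an eigenvalue. *)
Lemma poly_inverse n (A : 'M[C]_n) :
  (forall i j, ctends (fun k => iter k (mulmx A) 1%:M i j) 0) ->
  exists s, horner_seq s A *m (1%:M - A) = 1%:M.
Proof.
case: n A => [|n] A hA; first by exists [::]; apply/matrixP => -[].
have ev : ~~ root (char_poly A) 1.
  rewrite -eigenvalue_root_char; apply/negP => /eigenvalueP[v vA v0].
  case/negP: v0; apply/eqP/matrixP => i j; rewrite ord1 mxE.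
  (* A left eigenvector for 1 is fixed by all powers of A; these tend to 0, so it vanishes. *)
  have vk k : v = v *m iter k (mulmx A) 1%:M.
    elim: k => [|k IH] /=; first by rewrite mulmx1.
    by rewrite mulmxA vA scale1r.
  have h : ctends (fun k => \sum_l v 0 l * iter k (mulmx A) 1%:M l j) (\sum_l v 0 l * 0).
    by apply: ctends_sum => l _; exact: ctendsZ.
  rewrite big1 in h; last by move=> l _; rewrite mulr0.
  apply: ctends_unique h; apply: eq_ctends (ctends_cst (v 0 j)) => k.
  by rewrite [in LHS](vk k) mxE.
(* With chi the characteristic polynomial, chi - chi(1) = q (X - 1). At A this reads -chi(1) = q(A)
   (A - 1), so q / chi(1) inverts 1 - A. *)
set x := (char_poly A).[1]; have x0 : x != 0 by [].
have /factor_theorem[q hq] : root (char_poly A - x%:P) 1.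
  by rewrite rootE !hornerE subrr.
have := congr1 (horner_mx A) hq.
rewrite rmorphB rmorphM rmorphB /= Cayley_Hamilton horner_mx_X !horner_mx_C sub0r => e.
exists (x^-1 *: q); rewrite -horner_mx_seq polyseqK linearZ /= -scalemxAl.
have -> : 1%:M - A = - (A - 1%:M) by rewrite opprB.
rewrite mulmxN mulmxE -e opprK -mul_scalar_mx -scalar_mxM mulVf //.
Qed.

Section Flatten.
Variable n : nat.

(* A block matrix with entries in M_n, seen as one complex matrix. *)
Definition flat m (A : 'M['M[C]_n.+1]_m) : 'M[C]_(m * n.+1) :=
  \matrix_(i, j) A (mxtens_unindex i).1 (mxtens_unindex j).1
    (mxtens_unindex i).2 (mxtens_unindex j).2.

Lemma flatE m (A : 'M['M[C]_n.+1]_m) i j k l :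
  flat A (mxtens_index (i, k)) (mxtens_index (j, l)) = A i j k l.
Proof. by rewrite mxE !mxtens_indexK. Qed.

Lemma flat_inj m : injective (@flat m).
Proof.
move=> A B e; apply/matrixP => i j; apply/matrixP => k l.
by rewrite -!flatE e.
Qed.

Lemma flatP m (A : 'M['M[C]_n.+1]_m) (B : 'M[C]_(m * n.+1)) :
  (forall i j k l, A i j k l = B (mxtens_index (i, k)) (mxtens_index (j, l))) -> flat A = B.
Proof.
move=> h; apply/matrixP => s t; case: (mxtens_indexP s) => i k; case: (mxtens_indexP t) => j l.
by rewrite flatE h.
Qed.

Lemma flatD m (A B : 'M['M[C]_n.+1]_m) : flat (A + B) = flat A + flat B.
Proof. by apply: flatP => i j k l; rewrite !mxE !mxtens_indexK. Qed.

Lemma flatN m (A : 'M['M[C]_n.+1]_m) : flat (- A) = - flat A.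
Proof. by apply: flatP => i j k l; rewrite !mxE !mxtens_indexK. Qed.

Lemma flat_scalar m (c : C) : flat (c%:M%:M : 'M['M[C]_n.+1]_m) = c%:M.
Proof.
apply: flatP => i j k l; rewrite !mxE (can_eq (@mxtens_indexK _ _)) xpair_eqE.
by case: (i == j); rewrite ?mulr1n ?mulr0n !mxE.
Qed.

Lemma flatM m (A B : 'M['M[C]_n.+1]_m) : flat (A *m B) = flat A *m flat B.
Proof.
apply: flatP => i j k l; transitivity (\sum_p \sum_q A i p k q * B p j q l).
  by rewrite mxE summxE; apply: eq_bigr => p _; rewrite mxE.
rewrite mxE pair_bigA /= [RHS](reindex (@mxtens_index m n.+1)) /=; last first.
  by exists (@mxtens_unindex m n.+1) => ? _; [exact: mxtens_indexK|exact: mxtens_unindexK].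
by apply: eq_bigr => -[p q] _; rewrite !flatE.
Qed.

End Flatten.

Definition bhorner_seq n m (s : seq C) (A : 'M['M[C]_n.+1]_m) : 'M['M[C]_n.+1]_m :=
  foldr (fun c P => c%:M%:M + A *m P) 0 s.

Lemma block_poly_inverse n m (A : 'M['M[C]_n.+1]_m) :
  (forall i j k l, ctends (fun t => iter t (mulmx A) 1%:M i j k l) 0) ->
  exists s, bhorner_seq s A *m (1%:M - A) = 1%:M.
Proof.
move=> hA.
have flat1 : flat (1%:M : 'M['M[C]_n.+1]_m) = 1%:M by exact: flat_scalar.
have flatX t : flat (iter t (mulmx A) 1%:M) = iter t (mulmx (flat A)) 1%:M.
  by elim: t => [|t IH] /=; rewrite ?flat1 // flatM IH.
have [|s hs] := @poly_inverse _ (flat A).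
  move=> i j; case: (mxtens_indexP i) => p k; case: (mxtens_indexP j) => q l.
  by apply: eq_ctends (hA p q k l) => t; rewrite -flatX flatE.
exists s; apply: flat_inj; rewrite flatM flatD flatN flat1 -[RHS]hs; congr (_ *m _).
elim: s {hs} => [|c s IH] /=.
  by apply: flatP => i j k l; rewrite !mxE.
by rewrite flatD flatM flat_scalar IH.
Qed.

Variable d : nat.

Definition epoly m (s : seq C) (E : ematrix R d m m) : ematrix R d m m :=
  foldr (fun c P => eadd (econst d c%:M) (emul E P)) (econst d 0) s.

Lemma edom_poly n (W : 'I_d -> 'M[C]_n) m s (E : ematrix R d m m) :
  edom W E -> edom W (epoly s E).
Proof.
move=> hE; elim: s => [|c s IH] //=; apply: edom_add => //; exact: edom_mul.
Qed.

Lemma eeval_poly n (W : 'I_d -> 'M[C]_n.+1) m s (E : ematrix R d m m) :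
  eeval W (epoly s E) = bhorner_seq s (eeval W E).
Proof.
elim: s => [|c s IH] /=.
  by rewrite eeval_const; apply/matrixP => i j; rewrite !mxE raddf0.
rewrite eeval_add eeval_mul IH eeval_const; congr (_ + _).
by apply/matrixP => i j; rewrite !mxE; case: (i == j); rewrite ?mulr1n ?mulr0n ?raddf0.
Qed.

End PolynomialInverse.

(** * The resolvent of the realization on the ball *)

Section Resolvent.
Variables (R : realType) (d : nat) (mu : ncMeasure R d).
Local Notation C := R[i].
Local Notation word := (seq 'I_d).
Local Notation c := (rmoment mu).
Variables (r : nat) (A : 'I_d -> 'M[C]_r) (gam : 'rV[C]_r) (bet : 'cV[C]_r).

Definition pencil : ematrix R d r r :=
  fun p q => rsum [seq RMul (RConst d (A k p q)) (RVar R k) | k <- enum 'I_d].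

Lemma edom_pencil n (W : 'I_d -> 'M[C]_n) : edom W pencil.
Proof. by move=> p q; rewrite rdom_rsum all_map; apply/allP. Qed.

Lemma eeval_pencil n (W : 'I_d -> 'M[C]_n.+1) p q :
  eeval W pencil p q = \sum_k A k p q *: W k.
Proof.
rewrite mxE reval_rsum big_map big_enum; apply: eq_bigr => k _ /=.
by rewrite mul_scalar_mx.
Qed.

Lemma iter_pencil n (W : 'I_d -> 'M[C]_n.+1) t p q :
  iter t (mulmx (eeval W pencil)) 1%:M p q =
  \sum_(w : t.-tuple 'I_d) mxword A w p q *: mxword W w.
Proof.
elim: t p q => [|t IH] p q.
  rewrite (big_pred1 [tuple]) => [|v]; last by apply/esym/eqP; exact: tuple0.
  by rewrite /= !mxE; case: (p == q); rewrite ?scale1r ?scale0r.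
rewrite (tuple_sumS (fun w => mxword A w p q *: mxword W w)) iterS mxE.
under eq_bigr do rewrite IH eeval_pencil mulr_suml.
rewrite exchange_big; apply: eq_bigr => k _ /=.
under eq_bigr do rewrite mulr_sumr.
rewrite exchange_big; apply: eq_bigr => w _ /=.
rewrite mxE scaler_suml; apply: eq_bigr => s _.
by rewrite -scalerAl -scalerAr scalerA.
Qed.

Definition rpencil : ematrix R d r r := eadd (econst d 1%:M) (eopp pencil).

Lemma edom_rpencil n (W : 'I_d -> 'M[C]_n) : edom W rpencil.
Proof. by apply: edom_add => //; apply: edom_opp; exact: edom_pencil. Qed.

Lemma eeval_rpencil n (W : 'I_d -> 'M[C]_n.+1) :
  eeval W rpencil = 1%:M - eeval W pencil.
Proof.
rewrite eeval_add eeval_opp eeval_const; congr (_ - _).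
by apply/matrixP => i j; rewrite !mxE; case: (i == j); rewrite ?mulr1n ?mulr0n ?raddf0.
Qed.

Definition scalar_form n (S : 'M['M[C]_n.+1]_r) : 'M[C]_n.+1 :=
  (map_mx (fun a : C => (a%:M : 'M[C]_n.+1)) gam *m S *m
   map_mx (fun a : C => (a%:M : 'M[C]_n.+1)) bet) 0 0.

Lemma scalar_formE n (S : 'M['M[C]_n.+1]_r) i j :
  scalar_form S i j = \sum_q \sum_p (gam 0 p * bet q 0) * S p q i j.
Proof.
have -> : scalar_form S = \sum_q \sum_p (gam 0 p * bet q 0) *: S p q.
  rewrite /scalar_form mxE; apply: eq_bigr => q _.
  have -> : (map_mx (fun a : C => (a%:M : 'M[C]_n.+1)) gam *m S) 0 q =
      \sum_p gam 0 p *: S p q.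
    by rewrite mxE; apply: eq_bigr => p _; rewrite mxE; exact: mul_scalar_mx.
  have -> : map_mx (fun a : C => (a%:M : 'M[C]_n.+1)) bet q 0 = (bet q 0)%:M by rewrite mxE.
  apply: etrans (mul_mx_scalar _ _) _; rewrite scaler_sumr; apply: eq_bigr => p _.
  by rewrite scalerA mulrC.
rewrite summxE; apply: eq_bigr => q _; rewrite summxE; apply: eq_bigr => p _.
by rewrite mxE.
Qed.

Lemma scalar_formB n (S T : 'M['M[C]_n.+1]_r) :
  scalar_form (S - T) = scalar_form S - scalar_form T.
Proof. by rewrite /scalar_form mulmxBr mulmxBl !mxE. Qed.

Lemma scalar_form_sum n N (S : 'I_N -> 'M['M[C]_n.+1]_r) :
  scalar_form (\sum_t S t) = \sum_t scalar_form (S t).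
Proof. by rewrite /scalar_form mulmx_sumr mulmx_suml summxE. Qed.

Definition gexpr (N : ematrix R d r r) : rexpr R d :=
  emul (emul (econst d gam) N) (econst d bet) 0 0.

Lemma reval_gexpr n (W : 'I_d -> 'M[C]_n.+1) N :
  reval W (gexpr N) = scalar_form (eeval W N).
Proof.
have <- : eeval W (emul (emul (econst d gam) N) (econst d bet)) 0 0 = reval W (gexpr N).
  by rewrite mxE.
by rewrite !eeval_mul !eeval_const.
Qed.

Lemma rdom_gexpr n (W : 'I_d -> 'M[C]_n) N : edom W N -> rdom W (gexpr N).
Proof. by move=> hN; apply: edom_mul => //; apply: edom_mul. Qed.

Lemma edom_gexpr n (W : 'I_d -> 'M[C]_n) N : rdom W (gexpr N) -> edom W N.
Proof.
move=> h; have h1 : edom W (emul (emul (econst d gam) N) (econst d bet)).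
  by move=> i j; rewrite !ord1.
exact: edom_mulr 0 (edom_mull 0 h1).
Qed.

Hypothesis cE : forall w, c w = (gam *m mxword A w *m bet) 0 0.
Hypothesis Adecay : exists (x y : 'I_r -> word) (G : 'M[C]_r), forall w p q,
  mxword A w p q = \sum_s c (x p ++ w ++ y s) * G s q.

Section Point.
Variables (n : nat) (Z : 'I_d -> 'M[C]_n.+1).
Hypothesis Zball : in_ball Z.

Lemma pencil_decay p q i l :
  ctends (fun t => iter t (mulmx (eeval Z pencil)) 1%:M p q i l) 0.
Proof.
have [x [y [G hG]]] := Adecay.
have h : ctends (fun t => \sum_s G s q *
    \sum_(w : t.-tuple 'I_d) c (x p ++ w ++ y s) * mxword Z w i l) (\sum_s G s q * 0).
  by apply: ctends_sum => s _; apply: ctendsZ; exact: rmoment_decay.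
rewrite big1 in h; last by move=> s _; rewrite mulr0.
apply: eq_ctends h => t; rewrite iter_pencil summxE.
under eq_bigr do rewrite mulr_sumr.
rewrite exchange_big; apply: eq_bigr => w _ /=; rewrite mxE hG mulr_suml.
by apply: eq_bigr => s _; rewrite mulrA [G s q * _]mulrC.
Qed.

Lemma left_inverse_expr : exists2 N : ematrix R d r r, edom Z N &
  forall m (W : 'I_d -> 'M[C]_m.+1), edom W N -> eeval W N *m eeval W rpencil = 1%:M.
Proof.
have [s hs] := block_poly_inverse pencil_decay.
pose PM := emul (epoly s pencil) rpencil.
have domP n' (W : 'I_d -> 'M[C]_n') : edom W (epoly s pencil).
  by apply: edom_poly; exact: edom_pencil.
have domPM : edom Z PM by apply: edom_mul => //; exact: edom_rpencil.
have [|Q domQ hQ] := ematrix_inverse domPM.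
  by rewrite eeval_mul eeval_poly eeval_rpencil.
exists (emul Q (epoly s pencil)); first exact: edom_mul.
move=> m W domN; have domQW : edom W Q by move=> i k; exact: (edom_mull i domN).
have [_ <-] := hQ m W domQW.
by rewrite !eeval_mul mulmxA.
Qed.

(** With X the value of the pencil, a left inverse N of 1 - X turns the sum of the first T powers of
    X into N - N X^T. Compressed by gam and bet, this is a partial sum of the moment series, and the
    remainder vanishes by [pencil_decay]. *)
Lemma herglotz_left_inverse (N : 'M['M[C]_n.+1]_r) : N *m eeval Z rpencil = 1%:M ->
  herglotz mu Z = 2 *: scalar_form N - (c [::])%:M.
Proof.
move=> hN; pose X := eeval Z pencil; pose X_ t := iter t (mulmx X) 1%:M.
have XS T : (1%:M - X) *m (\sum_(t < T) X_ t) = 1%:M - X_ T.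
  elim: T => [|T IH]; first by rewrite big_ord0 mulmx0 subrr.
  by rewrite big_ord_recr /= mulmxDr IH mulmxBl mul1mx addrA subrK.
have NS T : scalar_form (\sum_(t < T) X_ t) = scalar_form N - scalar_form (N *m X_ T).
  rewrite -scalar_formB; congr scalar_form.
  rewrite -[LHS]mul1mx -hN eeval_rpencil -mulmxA XS mulmxBr mulmx1 //.
apply/matrixP => i l; apply: ctends_unique (herglotz_lim Zball mu i l) _.
have sumE T : sum_lt (fun w => c w * mxword Z w i l) T =
    scalar_form N i l - scalar_form (N *m X_ T) i l.
  transitivity ((scalar_form N - scalar_form (N *m X_ T)) i l); last by rewrite !mxE.
  rewrite -NS scalar_form_sum summxE; apply: eq_bigr => t _.
  rewrite scalar_formE; under [RHS]eq_bigr do under eq_bigr do rewrite iter_pencil summxE mulr_sumr.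
  under [RHS]eq_bigr do rewrite exchange_big.
  rewrite [RHS]exchange_big; apply: eq_bigr => w _ /=.
  rewrite cE mxE mulr_suml; apply: eq_bigr => q _; rewrite mxE !mulr_suml.
  apply: eq_bigr => p _; rewrite mxE; ring.
have lim0 : ctends (fun T => scalar_form (N *m X_ T) i l) 0.
  have h : ctends (fun T => \sum_q \sum_p (gam 0 p * bet q 0) *
      \sum_s \sum_a N p s i a * X_ T s q a l)
    (\sum_q \sum_p (gam 0 p * bet q 0) * \sum_(s < r) \sum_(a < n.+1) N p s i a * 0).
    apply: ctends_sum => q _; apply: ctends_sum => p _; apply: ctendsZ.
    apply: ctends_sum => s _; apply: ctends_sum => a _; apply: ctendsZ.
    exact: pencil_decay.
  rewrite [X in ctends _ X]big1 in h; last first.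
    move=> q _; rewrite big1 // => p _; rewrite big1 ?mulr0 // => s _.
    by rewrite big1 // => a _; rewrite mulr0.
  apply: eq_ctends h => T; rewrite scalar_formE; apply: eq_bigr => q _.
  apply: eq_bigr => p _; congr (_ * _); rewrite mxE summxE.
  by apply: eq_bigr => s _; rewrite mxE.
have lim := ctendsB (ctendsZ 2 (ctendsB (ctends_cst (scalar_form N i l)) lim0))
  (ctends_cst ((i == l)%:R * c [::])).
rewrite subr0 in lim; move: (scalar_form N) lim sumE => F lim sumE.
have -> : (2 *: F - (c [::])%:M) i l = 2 * F i l - (i == l)%:R * c [::].
  by rewrite !mxE !mulr_natl.
by apply: eq_ctends lim => T; rewrite sumE.
Qed.

End Point.

End Resolvent.

(** * The Cayley transform *)

Section CayleyTransform.
Variables (R : realType) (d : nat) (mu : ncMeasure R d).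
Local Notation C := R[i].
Local Notation word := (seq 'I_d).
Local Open Scope sesquilinear_scope.

Definition cayley : ncfun R d := fun n Z =>
  (herglotz mu Z - 1%:M) *m invmx (herglotz mu Z + 1%:M).

Lemma invmx_uniq n (A B : 'M[C]_n) : A *m B = 1%:M -> invmx A = B.
Proof. by move=> e; have [u _] := mulmx1_unit e; rewrite -[LHS]mulmx1 -e mulKmx. Qed.

Section Point.
Variables (n : nat) (Z : 'I_d -> 'M[C]_n).
Hypothesis Zball : in_ball Z.
Local Notation H := (herglotz mu Z).

(** On a kernel vector v one has H v = -v, so Re <v, H v> = -|v|^2, which positivity forces to be
    0. *)
Lemma herglotz1_unit : H + 1%:M \in unitmx.
Proof.
rewrite -unitmx_tr -row_free_unit -kermx_eq0; apply/rowV0P => v /sub_kermxP vH.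
have e : (H + 1%:M) *m v^T = 0 by rewrite -[LHS]trmxK trmx_mul trmxK vH trmx0.
have := herglotz_Re_ge0 Zball mu v^T.
have -> : H *m v^T = - v^T by apply/eqP; rewrite -addr_eq0 -[X in _ + X]mul1mx -mulmxDl e.
rewrite ipNr ip_sqn /= oppr_ge0 => h.
have v0 : v^T = 0 by apply: sqn_cvdot_eq0; apply/eqP; rewrite eq_le h sqn_ge0.
by rewrite -[v]trmxK v0 trmx0.
Qed.

(** Writing x = H y + y, the difference |H y + y|^2 - |H y - y|^2 equals 4 Re <y, H y>. *)
Lemma cayley_contraction : mx_contraction (cayley Z).
Proof.
move=> x; have norm_sqn (y : 'cV[C]_n) : \sum_(i < n) `|y i 0| ^+ 2 = (sqn (cvdot R n) y)%:C.
  rewrite sqn_cvdot rmorph_sum; apply: eq_bigr => i _.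
  by rewrite normCK mulrC mulCconj.
rewrite !norm_sqn lecR; pose y := invmx (H + 1%:M) *m x.
have xE : x = H *m y + y by rewrite -[X in _ + X]mul1mx -mulmxDl mulKVmx // herglotz1_unit.
have -> : cayley Z *m x = H *m y - y.
  by rewrite /cayley -mulmxA -/y mulmxBl mul1mx.
rewrite [in leRHS]xE !sqnDE sqnN ipNr raddfN /=.
have := herglotz_Re_ge0 Zball mu y; rewrite (ip_sym _ (H *m y) y) cRe_conj.
move: (complex.Re _) => a; lra.
Qed.

Lemma cayley_clark : 1%:M - cayley Z \in unitmx /\
  (1%:M + cayley Z) *m invmx (1%:M - cayley Z) = H.
Proof.
have u := herglotz1_unit; set K := H + 1%:M in u.
have two0 : (2 : C) != 0 by rewrite pnatr_eq0.
have n1 : K - (H - 1%:M) = 2 *: 1%:M.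
  by rewrite /K opprB addrC addrA subrK -mulr2n scaler_nat.
have n2 : K + (H - 1%:M) = 2 *: H.
  by rewrite /K addrACA subrr addr0 -mulr2n scaler_nat.
have e1 : 1%:M - cayley Z = 2 *: invmx K.
  by rewrite /cayley -/K -{1}(mulmxV u) -mulmxBl n1 -scalemxAl mul1mx.
have e2 : 1%:M + cayley Z = 2 *: (H *m invmx K).
  by rewrite /cayley -/K -{1}(mulmxV u) -mulmxDl n2 -scalemxAl.
have e3 : (1%:M - cayley Z) *m (2^-1 *: K) = 1%:M.
  by rewrite e1 -scalemxAl -scalemxAr scalerA mulfV // scale1r mulVmx.
have [u1 _] := mulmx1_unit e3; split=> //.
rewrite (invmx_uniq e3) e2 -scalemxAl -scalemxAr scalerA mulfV // scale1r.
by rewrite mulmxKV.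
Qed.

End Point.

Lemma herglotz_block n m (Z : 'I_d -> 'M[C]_n) (W : 'I_d -> 'M[C]_m) :
  in_ball Z -> in_ball W ->
  herglotz mu (fun j => block_mx (Z j) 0 0 (W j)) = block_mx (herglotz mu Z) 0 0 (herglotz mu W).
Proof.
move=> hZ hW; have hB := in_ball_block hZ hW; set B := fun j => _ in hB *.
have wB w : mxword B w = block_mx (mxword Z w) 0 0 (mxword W w).
  elim: w => [|k w IH] /=; first exact: scalar_mx_block.
  by rewrite IH mulmx_block !mulmx0 !mul0mx !addr0 add0r.
apply/matrixP => i j; apply: ctends_unique (herglotz_lim hB mu i j) _.
rewrite -[ i ]splitK -[ j ]splitK.
case: (fintype.split i) => p; case: (fintype.split j) => q /=;
  rewrite ?block_mxEul ?block_mxEur ?block_mxEdl ?block_mxEdr.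
- apply: eq_ctends (herglotz_lim hZ mu p q) => N; rewrite (inj_eq (@lshift_inj _ _)).
  congr (_ * _ - _); rewrite !sum_ltE; apply: eq_bigr => w _.
  by rewrite wB block_mxEul.
- rewrite mxE; apply: eq_ctends (ctends_cst 0) => N.
  rewrite eq_lrshift mul0r subr0 sum_ltE big1 ?mulr0 // => w _.
  by rewrite wB block_mxEur mxE mulr0.
- rewrite mxE; apply: eq_ctends (ctends_cst 0) => N.
  rewrite eq_rlshift mul0r subr0 sum_ltE big1 ?mulr0 // => w _.
  by rewrite wB block_mxEdl mxE mulr0.
apply: eq_ctends (herglotz_lim hW mu p q) => N; rewrite (inj_eq (@rshift_inj _ _)).
congr (_ * _ - _); rewrite !sum_ltE; apply: eq_bigr => w _.
by rewrite wB block_mxEdr.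
Qed.

Lemma herglotz_conj n (S : 'M[C]_n) (Z : 'I_d -> 'M[C]_n) : S \in unitmx ->
  in_ball Z -> in_ball (fun j => S *m Z j *m invmx S) ->
  herglotz mu (fun j => S *m Z j *m invmx S) = S *m herglotz mu Z *m invmx S.
Proof.
move=> Su hZ hS; set W := fun j => _ in hS *.
have wW w : mxword W w = S *m mxword Z w *m invmx S.
  elim: w => [|k w IH] /=; first by rewrite mulmx1 mulmxV.
  by rewrite IH /W !mulmxA mulmxKV.
apply/matrixP => i j; apply: ctends_unique (herglotz_lim hS mu i j) _.
have entry (M : 'M[C]_n) : (S *m M *m invmx S) i j = \sum_b \sum_a S i a * invmx S b j * M a b.
  rewrite mxE; apply: eq_bigr => b _; rewrite mxE mulr_suml.
  by apply: eq_bigr => a _; rewrite mulrAC.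
rewrite entry.
have lim : ctends (fun N => \sum_b \sum_a S i a * invmx S b j *
    (2 * sum_lt (fun w => rmoment mu w * mxword Z w a b) N - (a == b)%:R * rmoment mu [::]))
  (\sum_b \sum_a S i a * invmx S b j * herglotz mu Z a b).
  apply: ctends_sum => b _; apply: ctends_sum => a _; apply: ctendsZ.
  exact: herglotz_lim.
apply: eq_ctends lim => N.
have -> : (i == j)%:R * rmoment mu [::] =
    \sum_b \sum_a S i a * invmx S b j * ((a == b)%:R * rmoment mu [::]).
  have := entry 1%:M; rewrite mulmx1 mulmxV // mxE => ->.
  rewrite mulr_suml; apply: eq_bigr => b _; rewrite mulr_suml; apply: eq_bigr => a _.
  by rewrite mxE mulrA.
have -> : sum_lt (fun w => rmoment mu w * mxword W w i j) N =
    \sum_b \sum_a S i a * invmx S b j * sum_lt (fun w => rmoment mu w * mxword Z w a b) N.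
  rewrite sum_ltE; under [RHS]eq_bigr do under eq_bigr do rewrite sum_ltE mulr_sumr.
  under [RHS]eq_bigr do rewrite exchange_big.
  rewrite [RHS]exchange_big; apply: eq_bigr => w _ /=; rewrite wW entry mulr_sumr.
  apply: eq_bigr => b _; rewrite mulr_sumr; apply: eq_bigr => a _; exact: mulrCA.
rewrite mulr_sumr -sumrB; apply: eq_bigr => b _; rewrite mulr_sumr -sumrB.
by apply: eq_bigr => a _; rewrite mulrBr mulrCA.
Qed.

Lemma cayley_nc : nc_function cayley.
Proof.
split=> [n m Z W hZ hW|n S Z Su hZ hS].
  rewrite /cayley herglotz_block //.
  rewrite (scalar_mx_block n m (1 : C)) opp_block_mx !add_block_mx !oppr0 !addr0.
  have uZ := herglotz1_unit hZ; have uW := herglotz1_unit hW.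
  have -> : invmx (block_mx (herglotz mu Z + 1%:M) 0 0 (herglotz mu W + 1%:M)) =
      block_mx (invmx (herglotz mu Z + 1%:M)) 0 0 (invmx (herglotz mu W + 1%:M)).
    apply: invmx_uniq; rewrite mulmx_block !mulmx0 !mul0mx !addr0 !add0r !mulmxV //.
    by rewrite -scalar_mx_block.
  by rewrite mulmx_block !mulmx0 !mul0mx !addr0 !add0r.
rewrite /cayley herglotz_conj //; have uZ := herglotz1_unit hZ.
have cS (e : C) : S *m herglotz mu Z *m invmx S + e%:M = S *m (herglotz mu Z + e%:M) *m invmx S.
  by rewrite mulmxDr mulmxDl mul_mx_scalar -[X in _ = _ + X]scalemxAl mulmxV // scalemx1.
have Ne : - 1%:M = (-1)%:M :> 'M[C]_n by rewrite raddfN.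
rewrite Ne !cS.
have -> : invmx (S *m (herglotz mu Z + 1%:M) *m invmx S) =
    S *m invmx (herglotz mu Z + 1%:M) *m invmx S.
  by apply: invmx_uniq; rewrite !mulmxA mulmxKV // mulmxK // mulmxV.
by rewrite !mulmxA mulmxKV.
Qed.

Lemma herglotz_zero : herglotz mu (fun=> 0 : 'M[C]_1) = (rmoment mu [::])%:M.
Proof.
apply/matrixP => i j; apply: ctends_unique (herglotz_lim (zero_in_ball R d) mu i j) _.
rewrite !ord1 mxE eqxx mulr1n.
apply: (ctends_near (N := 1%N) _ (ctends_cst (rmoment mu [::]))) => -[//|N] _.
rewrite sum_ltS big1 => [|k _]; last by rewrite sum_ltE big1 // => w _; rewrite /= mul0mx mxE mulr0.
by rewrite mxE eqxx mulr1 mul1r addr0; ring.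
Qed.

Lemma cayley_is_clark : is_clark_measure cayley mu.
Proof.
move=> n Z hZ; have [u e] := cayley_clark hZ; split=> //.
(* At the origin the Cayley transform inverts to [mu id], which is real by positivity, so the
   normalizing constant vanishes. *)
set t := complex.Im _; suff -> : t = 0 by rewrite e (_ : 0 +i* 0 = 0) // raddf0 addr0.
have [u0 e0] := cayley_clark (zero_in_ball R d).
have b0E := mx11_scalar (cayley (fun=> 0 : 'M[C]_1)).
move: e0; rewrite b0E herglotz_zero /t; move: (cayley _ 0 0) => b0.
rewrite -raddfD -raddfB invmx_scalar -scalar_mxM.
move=> /matrixP/(_ 0 0); rewrite !mxE !eqxx !mulr1n => ->.
rewrite /rmoment -mu_Lword_adj; have := mu_id_ge0 mu.
by rewrite lecE => /andP[/eqP].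
Qed.

Lemma cayley_neq1 : not_identically_one cayley.
Proof.
exists 1%N, (fun=> 0); split; first exact: zero_in_ball.
move=> e; have [u _] := cayley_clark (zero_in_ball R d).
by rewrite e subrr unitmxE det0 unitr0 in u.
Qed.

Lemma cayley_rational : finrank (rmoment mu) -> nc_rational cayley.
Proof.
move=> /realization[r [A [gam [bet [x [y [G [cE hG]]]]]]]].
have decay : exists (x y : 'I_r -> word) (G : 'M[C]_r), forall w p q,
    mxword A w p q = \sum_s rmoment mu (x p ++ w ++ y s) * G s q by exists x, y, G.
set c0 := rmoment mu [::].
(* When N inverts the pencil from the left this evaluates to H + c0 + a. The shifts -c0 - 1 and 1 -
   c0 give the numerator H - 1 and the denominator H + 1. *)
pose lin N a : rexpr R d := RAdd (RMul (RConst d 2) (gexpr gam bet N)) (RConst d a).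
pose bexp N := RMul (lin N (- c0 - 1)) (RInv (lin N (1 - c0))).
have at_ball n (Z : 'I_d -> 'M[C]_n.+1) N : in_ball Z -> edom Z N ->
    eeval Z N *m eeval Z (rpencil A) = 1%:M ->
    rdom Z (bexp N) /\ cayley Z = reval Z (bexp N).
  move=> hZ dN vN; have hE := herglotz_left_inverse cE decay hZ vN.
  have lE a : reval Z (lin N a) = herglotz mu Z + (c0 + a)%:M.
    by rewrite /= reval_gexpr mul_scalar_mx hE raddfD addrA subrK.
  have dl a : rdom Z (lin N a) by rewrite /= rdom_gexpr.
  have l1 : reval Z (lin N (1 - c0)) = herglotz mu Z + 1%:M by rewrite lE [c0 + _]addrC subrK.
  have l2 : reval Z (lin N (- c0 - 1)) = herglotz mu Z - 1%:M.
    by rewrite lE [c0 + _]addrA subrr add0r raddfN.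
  split; last first.
    rewrite -[RHS]/(reval Z (lin N (- c0 - 1)) *m invmx (reval Z (lin N (1 - c0)))).
    by rewrite l1 l2.
  have -> : rdom Z (bexp N) = [&& rdom Z (lin N (- c0 - 1)), rdom Z (lin N (1 - c0)) &
    reval Z (lin N (1 - c0)) \in unitmx] by [].
  by rewrite !dl l1; exact: herglotz1_unit.
have hZ0 := zero_in_ball R d.
have [|Q0 dQ0 hQ0] := ematrix_inverse (edom_rpencil A (fun=> 0 : 'M[C]_1)).
  rewrite eeval_rpencil [X in _ - X](_ : _ = 0) ?subr0 //.
  apply/matrixP => p q; rewrite eeval_pencil big1 ?mxE // => k _.
  by rewrite scaler0.
have [_ Q0l] := hQ0 _ _ dQ0.
have [d0 _] := at_ball _ _ _ hZ0 dQ0 Q0l.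
exists (bexp Q0); first by exists 1%N, (fun=> 0).
move=> n Z hZ; have n0 : (0 < n)%N by case: hZ.
case: n n0 Z hZ => [//|n] _ Z hZ.
have [N dN hN] := left_inverse_expr decay hZ.
have [dZ eZ] := at_ball _ _ _ hZ dN (hN _ _ dN).
exists (bexp N); split; [by exists n.+1, Z| |exact: dZ|exact: eZ].
move=> m W m0 dW dW'; case: m m0 W dW dW' => [m0|m _] W dW dW'; first by case: (notF m0).
have /andP[/andP[/andP[_ /edom_gexpr dQW] _] _] := dW.
have /andP[/andP[/andP[_ /edom_gexpr dNW] _] _] := dW'.
have [MQ _] := hQ0 _ _ dQW; have NM := hN _ _ dNW.
have NQ : eeval W N = eeval W Q0 by rewrite -[LHS]mulmx1 -MQ mulmxA NM mul1mx.
by rewrite /= !reval_gexpr NQ.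
Qed.

End CayleyTransform.

Theorem theorem1 (R : realType) (d : nat) (hd : (0 < d)%N)
    (mu : ncMeasure R d) :
  (exists b : ncfun R d,
     [/\ Hinf_unit_ball b, not_identically_one b, nc_rational b &
         is_clark_measure b mu]) <->
  finitely_correlated mu.
Proof.
rewrite finitely_correlatedP; split=> [[b [_ _ hr hc]]|fr].
  exact: clark_rational_finrank hr hc.
exists (cayley mu); split.
- by split; [exact: cayley_nc|exact: cayley_contraction].
- exact: cayley_neq1.
- by apply: cayley_rational; exact: finrank_rev.
- exact: cayley_is_clark.
Qed.
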